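(* Let $K$ be an algebraically closed field of characteristic zero and let $H$ be a semisimple Hopf algebra over $K$. If $H$ has a nontrivial self-dual simple module, then the dimension $\dim_K H$ is even.
   Context: For a Hopf algebra $H$ over $K$ we denote the comultiplication by $\Delta(h)=h_{(1)}\otimes h_{(2)}$, the counit by $\varepsilon$ and the antipode by $S$. $H$ is semisimple if it is semisimple as an algebra; a semisimple Hopf algebra over a field is automatically finite-dimensional. Modules are left modules. The trivial module is $K$ with action $h.\lambda=\varepsilon(h)\lambda$; a simple module is nontrivial if it is not isomorphic to the trivial module. For a finite-dimensional $H$-module $V$, the dual $V^*=\mathrm{Hom}_K(V,K)$ is an $H$-module via $(h.f)(v)=f(S(h).v)$. A simple $H$-module $V$ is called self-dual if $V\cong V^*$ as $H$-modules; equivalently, if there is a nondegenerate bilinear form $\langle\cdot,\cdot\rangle:V\times V\to K$ with $\langle h_{(1)}.v,h_{(2)}.v'\rangle=\varepsilon(h)\langle v,v'\rangle$ for all $h\in H$, $v,v'\in V$. *)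

(* Defs.v *)
From HB Require Import structures.
From mathcomp Require Import all_boot all_order all_algebra.
From mathcomp Require Import boolp functions.

Set Implicit Arguments.
Unset Strict Implicit.
Unset Printing Implicit Defensive.

Import GRing.Theory.
Local Open Scope ring_scope.
Local Open Scope quotient_scope.

(* An element of the tensor product is a class of formal sums
   u_1 ⊗ v_1 + ... + u_k ⊗ v_k, represented by [:: (u_1, v_1); ...; (u_k, v_k)].
   Since formal sums only form a monoid, 0 ⊗ v = 0 has to be imposed. *)
Inductive tens_eq (K : fieldType) (U V : lmodType K) :
    seq (U * V) -> seq (U * V) -> Prop :=
| tens_eq_refl s : tens_eq s s
| tens_eq_sym s t : tens_eq s t -> tens_eq t s
| tens_eq_trans s t r : tens_eq s t -> tens_eq t r -> tens_eq s r
| tens_eq_cat s s' t t' :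
    tens_eq s s' -> tens_eq t t' -> tens_eq (s ++ t) (s' ++ t')
| tens_eq_catC s t : tens_eq (s ++ t) (t ++ s)
| tens_eq_0l v : tens_eq [:: (0, v)] [::]
| tens_eq_Dl u u' v : tens_eq [:: (u + u', v)] [:: (u, v); (u', v)]
| tens_eq_Dr u v v' : tens_eq [:: (u, v + v')] [:: (u, v); (u, v')]
| tens_eq_Z a u v : tens_eq [:: (a *: u, v)] [:: (u, a *: v)].

Section TensorQuotient.
Variables (K : fieldType) (U V : lmodType K).

Let tens_eqb (s t : seq (U * V)) : bool := `[< tens_eq s t >].

Fact tens_eqb_refl : reflexive tens_eqb.
Proof. by move=> s; apply/asboolP; exact: tens_eq_refl. Qed.

Fact tens_eqb_sym : symmetric tens_eqb.
Proof. by move=> s t; apply/asboolP/asboolP; exact: tens_eq_sym. Qed.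

Fact tens_eqb_trans : transitive tens_eqb.
Proof.
by move=> s t r /asboolP rs /asboolP st; apply/asboolP; exact: tens_eq_trans st.
Qed.

Definition tens_equiv :=
  EquivRel tens_eqb tens_eqb_refl tens_eqb_sym tens_eqb_trans.

Definition tensor : Type := {eq_quot tens_equiv}.
HB.instance Definition _ := Choice.on tensor.
HB.instance Definition _ := EqQuotient.on tensor.

End TensorQuotient.

(* The canonical surjection and a section of it, locked to keep conversion
   from unfolding the choice of representatives. *)
HB.lock Definition tensor_class (K : fieldType) (U V : lmodType K)
  (s : seq (U * V)) : tensor U V := \pi_(tensor U V) s.
HB.lock Definition tensor_repr (K : fieldType) (U V : lmodType K)
  (x : tensor U V) : seq (U * V) := repr x.

Section TensorProduct.
Variables (K : fieldType) (U V : lmodType K).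
Local Notation tensor := (tensor U V).
Implicit Types (s t r : seq (U * V)) (x y z : tensor).

Definition tens (u : U) (v : V) : tensor := tensor_class [:: (u, v)].

Definition tensor_zero : tensor := tensor_class [::].
Definition tensor_add x y : tensor :=
  tensor_class (tensor_repr x ++ tensor_repr y).
Definition tensor_scale (a : K) x : tensor :=
  tensor_class [seq (a *: p.1, p.2) | p <- tensor_repr x].
Definition tensor_opp x : tensor := tensor_scale (-1) x.

Lemma tensor_reprK x : tensor_class (tensor_repr x) = x.
Proof. by rewrite tensor_class.unlock tensor_repr.unlock reprK. Qed.

Lemma tensor_classW (P : tensor -> Prop) :
  (forall s, P (tensor_class s)) -> forall x, P x.
Proof. by move=> Pcls x; rewrite -(tensor_reprK x). Qed.

Lemma tensor_classP s t :
  tensor_class s = tensor_class t :> tensor <-> tens_eq s t.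
Proof.
rewrite tensor_class.unlock; split=> [/eqmodP/asboolP //|st].
exact/eqmodP/asboolP.
Qed.

Lemma tensor_reprP s : tens_eq (tensor_repr (tensor_class s)) s.
Proof. by apply/tensor_classP; rewrite tensor_reprK. Qed.

Lemma tensor_add_class s t :
  tensor_add (tensor_class s) (tensor_class t) = tensor_class (s ++ t).
Proof. by apply/tensor_classP/tens_eq_cat; exact: tensor_reprP. Qed.

Lemma tens_eq_map_scale a (s t : seq (U * V)) : tens_eq s t ->
  tens_eq [seq (a *: p.1, p.2) | p <- s] [seq (a *: p.1, p.2) | p <- t].
Proof.
elim=> {s t}.
- by move=> s; exact: tens_eq_refl.
- by move=> s t _; exact: tens_eq_sym.
- by move=> s t r _ + _; exact: tens_eq_trans.
- by move=> s s' t t' _ ? _ ?; rewrite !map_cat; exact: tens_eq_cat.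
- by move=> s t; rewrite !map_cat; exact: tens_eq_catC.
- by move=> v /=; rewrite scaler0; exact: tens_eq_0l.
- by move=> u u' v /=; rewrite scalerDr; exact: tens_eq_Dl.
- by move=> u v v' /=; exact: tens_eq_Dr.
- by move=> b u v /=; rewrite scalerA mulrC -scalerA; exact: tens_eq_Z.
Qed.

Lemma tensor_scale_class a s :
  tensor_scale a (tensor_class s) = tensor_class [seq (a *: p.1, p.2) | p <- s].
Proof. by apply/tensor_classP/tens_eq_map_scale/tensor_reprP. Qed.

Fact tensor_addA : associative tensor_add.
Proof.
elim/tensor_classW=> s; elim/tensor_classW=> t; elim/tensor_classW=> r.
by rewrite !tensor_add_class catA.
Qed.

Fact tensor_addC : commutative tensor_add.
Proof.
elim/tensor_classW=> s; elim/tensor_classW=> t; rewrite !tensor_add_class.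
exact/tensor_classP/tens_eq_catC.
Qed.

Fact tensor_add0 : left_id tensor_zero tensor_add.
Proof. by elim/tensor_classW=> s; rewrite tensor_add_class. Qed.

Lemma tensor_class_scaleDl a b s :
  tensor_add (tensor_class [seq (a *: p.1, p.2) | p <- s])
             (tensor_class [seq (b *: p.1, p.2) | p <- s]) =
  tensor_class [seq ((a + b) *: p.1, p.2) | p <- s].
Proof.
elim: s => [|[u v] s IHs] /=; first by rewrite tensor_add_class.
rewrite scalerDl -![_ :: map _ _]cat1s -3!tensor_add_class -IHs.
have -> : tensor_class [:: (a *: u + b *: u, v)] =
    tensor_add (tensor_class [:: (a *: u, v)]) (tensor_class [:: (b *: u, v)]).
  by rewrite tensor_add_class; exact/tensor_classP/tens_eq_Dl.
rewrite -!tensor_addA; congr tensor_add; rewrite !tensor_addA; congr tensor_add.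
exact: tensor_addC.
Qed.

Lemma tensor_class_scale0l s :
  tensor_class [seq (0 *: p.1, p.2) | p <- s] = tensor_zero :> tensor.
Proof.
elim: s => [|[u v] s IHs] //=; rewrite scale0r -cat1s -tensor_add_class IHs.
by rewrite tensor_addC tensor_add0; exact/tensor_classP/tens_eq_0l.
Qed.

Fact tensor_addN : left_inverse tensor_zero tensor_opp tensor_add.
Proof.
elim/tensor_classW=> s; rewrite /tensor_opp tensor_scale_class.
have {2}-> : s = [seq ((1 : K) *: p.1, p.2) | p <- s].
  by rewrite -[LHS]map_id; apply: eq_map => -[u v]; rewrite scale1r.
by rewrite tensor_class_scaleDl addNr tensor_class_scale0l.
Qed.

HB.instance Definition _ := GRing.isZmodule.Build tensor
  tensor_addA tensor_addC tensor_add0 tensor_addN.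

Fact tensor_scaleA a b x :
  tensor_scale a (tensor_scale b x) = tensor_scale (a * b) x.
Proof.
elim/tensor_classW: x => s; rewrite !tensor_scale_class -map_comp; congr tensor_class.
by apply: eq_map => p /=; rewrite scalerA.
Qed.

Fact tensor_scale1 : left_id 1 tensor_scale.
Proof.
elim/tensor_classW=> s; rewrite tensor_scale_class; congr tensor_class.
by rewrite -[RHS]map_id; apply: eq_map => -[u v]; rewrite scale1r.
Qed.

Fact tensor_scaleDr : right_distributive tensor_scale +%R.
Proof.
move=> a; elim/tensor_classW=> s; elim/tensor_classW=> t.
change (tensor_scale a (tensor_add (tensor_class s) (tensor_class t)) =
  tensor_add (tensor_scale a (tensor_class s)) (tensor_scale a (tensor_class t))).
by rewrite !(tensor_add_class, tensor_scale_class) map_cat.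
Qed.

Fact tensor_scaleDl x : {morph tensor_scale^~ x : a b / a + b}.
Proof.
move=> a b; elim/tensor_classW: x => s; rewrite !tensor_scale_class.
by rewrite -tensor_class_scaleDl.
Qed.

HB.instance Definition _ := GRing.Zmodule_isLmodule.Build K tensor
  tensor_scaleA tensor_scale1 tensor_scaleDr tensor_scaleDl.

Lemma tensor_consE p s :
  tensor_class (p :: s) = tens p.1 p.2 + tensor_class s :> tensor.
Proof. by case: p => u v; exact/esym/(tensor_add_class [:: (u, v)] s). Qed.

Lemma tensorE (x : tensor) : x = \sum_(p <- tensor_repr x) tens p.1 p.2.
Proof.
rewrite -[LHS]tensor_reprK; elim: (tensor_repr x) => [|p s IHs]; first by rewrite big_nil.
by rewrite big_cons tensor_consE IHs.
Qed.

Lemma tensor_ind (P : tensor -> Prop) :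
  P 0 -> (forall x y, P x -> P y -> P (x + y)) ->
  (forall u v, P (tens u v)) -> forall x, P x.
Proof. by move=> P0 PD Pt x; rewrite (tensorE x); apply: big_ind. Qed.

Lemma tens_bilinear : bilinear_for *:%R *:%R tens.
Proof.
have DL u u' v : tens (u + u') v = tens u v + tens u' v.
  by apply: etrans (esym (tensor_add_class _ _)); exact/tensor_classP/tens_eq_Dl.
have DR u v v' : tens u (v + v') = tens u v + tens u v'.
  by apply: etrans (esym (tensor_add_class _ _)); exact/tensor_classP/tens_eq_Dr.
have ZL a u v : tens (a *: u) v = a *: tens u v.
  exact/esym/(tensor_scale_class a [:: (u, v)]).
have ZR a u v : tens u (a *: v) = a *: tens u v.
  by rewrite -ZL; apply/esym/tensor_classP/tens_eq_Z.
by split=> ? a ? ? /=; rewrite (DL, DR) (ZL, ZR).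
Qed.

(* The linear map induced by f; meaningful only when f is bilinear, in which
   case it does not depend on the representing formal sum (see tliftE). *)
Definition tlift (W : lmodType K) (f : U -> V -> W) (x : tensor) : W :=
  \sum_(p <- tensor_repr x) f p.1 p.2.

Section Lift.
Variables (W : lmodType K) (f : U -> V -> W).
Hypothesis f_bilin : bilinear_for *:%R *:%R f.

Let fDl u u' v : f (u + u') v = f u v + f u' v.
Proof. by have := f_bilin.1 v 1 u u'; rewrite /= !scale1r. Qed.
Let fDr u v v' : f u (v + v') = f u v + f u v'.
Proof. by have := f_bilin.2 u 1 v v'; rewrite /= !scale1r. Qed.
Let f0l v : f 0 v = 0.
Proof. by apply: (@addrI _ (f 0 v)); rewrite -fDl !addr0. Qed.
Let f0r u : f u 0 = 0.
Proof. by apply: (@addrI _ (f u 0)); rewrite -fDr !addr0. Qed.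
Let fZl a u v : f (a *: u) v = a *: f u v.
Proof. by have := f_bilin.1 v a u 0; rewrite /= f0l !addr0. Qed.
Let fZr a u v : f u (a *: v) = a *: f u v.
Proof. by have := f_bilin.2 u a v 0; rewrite /= f0r !addr0. Qed.

Lemma tlift_eq s t : tens_eq s t ->
  \sum_(p <- s) f p.1 p.2 = \sum_(p <- t) f p.1 p.2.
Proof.
elim=> {s t} //.
- by move=> s t r _ -> _ ->.
- by move=> s s' t t' _ ess' _ ett'; rewrite !big_cat /= ess' ett'.
- by move=> s t; rewrite !big_cat /= addrC.
- by move=> v; rewrite big_seq1 big_nil /= f0l.
- by move=> u u' v; rewrite !big_cons !big_nil /= !addr0 fDl.
- by move=> u v v'; rewrite !big_cons !big_nil /= !addr0 fDr.
- by move=> a u v; rewrite !big_seq1 /= fZl fZr.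
Qed.

Lemma tlift_class s : tlift f (tensor_class s) = \sum_(p <- s) f p.1 p.2.
Proof. exact/tlift_eq/tensor_reprP. Qed.

Lemma tliftE u v : tlift f (tens u v) = f u v.
Proof. by rewrite tlift_class big_seq1. Qed.

Lemma tlift_linear : linear (tlift f).
Proof.
move=> a; elim/tensor_classW=> s; elim/tensor_classW=> t.
have -> : a *: tensor_class s + tensor_class t =
    tensor_class ([seq (a *: p.1, p.2) | p <- s] ++ t) :> tensor.
  by rewrite -tensor_add_class -tensor_scale_class.
rewrite !tlift_class big_cat /= big_map scaler_sumr; congr (_ + _).
by apply: eq_bigr => p _; rewrite fZl.
Qed.

End Lift.

Lemma tlift_param_linear (T W : lmodType K) (f : T -> U -> V -> W) x :
  (forall u v, linear (fun c : T => f c u v)) ->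
  linear (fun c : T => tlift (f c) x).
Proof.
move=> flin a c c'; rewrite /tlift /= scaler_sumr -big_split /=.
by apply: eq_bigr => p _; rewrite flin.
Qed.

End TensorProduct.

Arguments tens {K U V}.

Definition tmap (K : fieldType) (U U' V V' : lmodType K)
    (f : U -> U') (g : V -> V') : tensor U V -> tensor U' V' :=
  tlift (fun u v => tens (f u) (g v)).

Definition tassoc (K : fieldType) (U V W : lmodType K) :
    tensor (tensor U V) W -> tensor U (tensor V W) :=
  tlift (fun x w => tlift (fun u v => tens u (tens v w)) x).

Section TensorAlgebra.
Variables (K : fieldType) (A B : algType K).

Definition tensor_mul (x y : tensor A B) : tensor A B :=
  tlift (fun a b => tlift (fun c d => tens (a * c) (b * d)) y) x.
Definition tensor_one : tensor A B := tens 1 1.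

Let tens_linearl b : linear (tens^~ b : A -> tensor A B).
Proof. exact: (tens_bilinear A B).1. Qed.
Let tens_linearr a : linear (tens a : B -> tensor A B).
Proof. exact: (tens_bilinear A B).2. Qed.

Lemma tensor_mul_inner (a : A) (b : B) :
  bilinear_for *:%R *:%R (fun c d => tens (a * c) (b * d) : tensor A B).
Proof.
by split=> z k x y /=; rewrite mulrDr -scalerAr (tens_linearl, tens_linearr).
Qed.

Lemma tensor_mul_outer (y : tensor A B) :
  bilinear_for *:%R *:%R
    (fun a b => tlift (fun c d => tens (a * c) (b * d) : tensor A B) y).
Proof.
split=> z; apply: tlift_param_linear => c d k x x';
  by rewrite mulrDl -scalerAl (tens_linearl, tens_linearr).
Qed.

Lemma tensor_mul_linearl y : linear (tensor_mul^~ y).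
Proof. exact/tlift_linear/tensor_mul_outer. Qed.

Lemma tensor_mul_linearr x : linear (tensor_mul x).
Proof.
apply: tlift_param_linear => a b; exact/tlift_linear/tensor_mul_inner.
Qed.

Lemma tensor_mulE a b c d :
  tensor_mul (tens a b) (tens c d) = tens (a * c) (b * d).
Proof.
rewrite /tensor_mul (tliftE (tensor_mul_outer _)).
by rewrite (tliftE (tensor_mul_inner _ _)).
Qed.

Fact tensor_mulDl : left_distributive tensor_mul +%R.
Proof.
by move=> x y z; have := tensor_mul_linearl z 1 x y; rewrite /= !scale1r.
Qed.

Fact tensor_mulDr : right_distributive tensor_mul +%R.
Proof.
by move=> z x y; have := tensor_mul_linearr z 1 x y; rewrite /= !scale1r.
Qed.

Lemma tensor_mul0l x : tensor_mul 0 x = 0.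
Proof. by apply: (@addrI _ (tensor_mul 0 x)); rewrite -tensor_mulDl !addr0. Qed.

Lemma tensor_mul0r x : tensor_mul x 0 = 0.
Proof. by apply: (@addrI _ (tensor_mul x 0)); rewrite -tensor_mulDr !addr0. Qed.

Fact tensor_mulA : associative tensor_mul.
Proof.
move=> x y z; elim/tensor_ind: x => [|x x' IHx IHx'|a b].
- by rewrite !tensor_mul0l.
- by rewrite !tensor_mulDl IHx IHx'.
elim/tensor_ind: y => [|y y' IHy IHy'|c d].
- by rewrite !(tensor_mul0l, tensor_mul0r).
- by rewrite !(tensor_mulDl, tensor_mulDr) IHy IHy'.
elim/tensor_ind: z => [|z z' IHz IHz'|e f].
- by rewrite !tensor_mul0r.
- by rewrite !tensor_mulDr IHz IHz'.
by rewrite !tensor_mulE !mulrA.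
Qed.

Fact tensor_mul1l : left_id tensor_one tensor_mul.
Proof.
elim/tensor_ind=> [|x y IHx IHy|a b]; first by rewrite tensor_mul0r.
  by rewrite tensor_mulDr IHx IHy.
by rewrite tensor_mulE !mul1r.
Qed.

Fact tensor_mul1r : right_id tensor_one tensor_mul.
Proof.
elim/tensor_ind=> [|x y IHx IHy|a b]; first by rewrite tensor_mul0l.
  by rewrite tensor_mulDl IHx IHy.
by rewrite tensor_mulE !mulr1.
Qed.

HB.instance Definition _ := GRing.Zmodule_isPzRing.Build (tensor A B)
  tensor_mulA tensor_mul1l tensor_mul1r tensor_mulDl tensor_mulDr.

End TensorAlgebra.

HB.mixin Record Algebra_isHopfAlgebra (K : fieldType) H of GRing.Algebra K H := {
  comul : {linear H -> tensor H H};
  counit : {scalar H};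
  antipode : {linear H -> H};
  comul_monoid_morphism : monoid_morphism comul;
  counit_monoid_morphism : monoid_morphism counit;
  comulA : forall h : H,
    tassoc (tmap comul idfun (comul h)) = tmap idfun comul (comul h);
  counitl : forall h : H, tlift (fun a b => counit a *: b) (comul h) = h;
  counitr : forall h : H, tlift (fun a b => counit b *: a) (comul h) = h;
  antipodel : forall h : H,
    tlift (fun a b => antipode a * b) (comul h) = (counit h)%:A;
  antipoder : forall h : H,
    tlift (fun a b => a * antipode b) (comul h) = (counit h)%:A
}.

#[short(type="hopfAlgType")]
HB.structure Definition HopfAlgebra (K : fieldType) :=
  {H of GRing.Algebra K H & Algebra_isHopfAlgebra K H}.

Section HopfTheory.
Variables (K : fieldType) (H : hopfAlgType K).
Implicit Types a b h : H.

Local Notation S := (@antipode K H).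
Local Notation eps := (@counit K H).
Local Notation D := (fun h : H => tensor_repr (comul h)).

Lemma counit1 : eps 1 = 1.
Proof. by have [] := @counit_monoid_morphism K H. Qed.

Lemma counitM a b : eps (a * b) = eps a * eps b.
Proof. by have [_ ->] := @counit_monoid_morphism K H. Qed.

Let tlift_linear_sum (W : lmodType K) (U V : lmodType K) (f : U -> V -> W)
    (I : Type) (r : seq I) (F : I -> tensor U V) :
  bilinear_for *:%R *:%R f ->
  tlift f (\sum_(i <- r) F i) = \sum_(i <- r) tlift f (F i).
Proof.
move=> fbil; have flin := tlift_linear fbil.
have fD x y : tlift f (x + y) = tlift f x + tlift f y.
  by have := flin 1 x y; rewrite !scale1r.
have f0 : tlift f 0 = 0.
  by apply: (@addrI _ (tlift f 0)); rewrite -fD !addr0.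
by elim: r => [|i r IHr]; rewrite ?big_nil // !big_cons fD IHr.
Qed.

Let sum_comulA (W : lmodType K) (F : H -> H -> H -> W) h :
  (forall b c, linear (fun a => F a b c)) ->
  (forall a c, linear (fun b => F a b c)) ->
  (forall a b, linear (fun c => F a b c)) ->
  \sum_(p <- D h) \sum_(q <- D p.1) F q.1 q.2 p.2 =
  \sum_(p <- D h) \sum_(q <- D p.2) F p.1 q.1 q.2.
Proof.
move=> F1 F2 F3.
have inner a : bilinear_for *:%R *:%R (F a) by split=> ?; [exact: F2|exact: F3].
have outer : bilinear_for *:%R *:%R (fun a => tlift (F a)).
  split=> z; last exact: tlift_linear.
  by apply: tlift_param_linear => b c; exact: F1.
have tl (U V : lmodType K) v : linear (tens^~ v : U -> tensor U V).
  exact: (tens_bilinear U V).1.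
have tr (U V : lmodType K) u : linear (tens u : V -> tensor U V).
  exact: (tens_bilinear U V).2.
have assoc1 (w : H) : bilinear_for *:%R *:%R
    (fun u v : H => tens u (tens v w)).
  by split=> z k x y /=; rewrite ?tl ?tr.
have assoc2 : bilinear_for *:%R *:%R
    (fun x (w : H) => tlift (fun u v : H => tens u (tens v w)) x).
  split=> z; first exact: tlift_linear.
  by apply: tlift_param_linear => u v k x y; rewrite !tr.
pose T := tlift (fun a => tlift (F a)).
have TL : T (tassoc (tmap comul idfun (comul h))) =
    \sum_(p <- D h) \sum_(q <- D p.1) F q.1 q.2 p.2.
  rewrite -[tmap _ _ _]/(\sum_(p <- D h) tens (comul p.1) p.2).
  rewrite /tassoc tlift_linear_sum // /T tlift_linear_sum //.
  apply: eq_bigr => p _; rewrite tliftE //.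
  rewrite -[tlift _ (comul _)]/(\sum_(q <- D p.1) tens q.1 (tens q.2 p.2)).
  rewrite tlift_linear_sum //.
  by apply: eq_bigr => q _; rewrite tliftE // tliftE.
have TR : T (tmap idfun comul (comul h)) =
    \sum_(p <- D h) \sum_(q <- D p.2) F p.1 q.1 q.2.
  rewrite -[tmap _ _ _]/(\sum_(p <- D h) tens p.1 (comul p.2)).
  by rewrite /T tlift_linear_sum //; apply: eq_bigr => p _; rewrite tliftE.
by rewrite -TL comulA TR.
Qed.

Let sum_comulM (W : lmodType K) (F : H -> H -> W) a b :
  bilinear_for *:%R *:%R F ->
  \sum_(r <- D (a * b)) F r.1 r.2 =
  \sum_(p <- D a) \sum_(q <- D b) F (p.1 * q.1) (p.2 * q.2).
Proof.
move=> Fbil; rewrite -[LHS]/(tlift F (comul (a * b))).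
have [_ ->] := @comul_monoid_morphism K H.
rewrite -[comul a * _]/(\sum_(p <- D a) \sum_(q <- D b)
  tens (p.1 * q.1) (p.2 * q.2)) tlift_linear_sum //.
apply: eq_bigr => p _; rewrite tlift_linear_sum //.
by apply: eq_bigr => q _; rewrite tliftE.
Qed.

Let sum_linear (W W' : lmodType K) (I : Type) (r : seq I) (F : I -> W -> W') :
  (forall i, linear (F i)) -> linear (fun x => \sum_(i <- r) F i x).
Proof.
move=> Flin k x y; rewrite scaler_sumr -big_split /=.
by apply: eq_bigr => i _; rewrite Flin.
Qed.

Ltac hopf_linear :=
  by rewrite ?(linearP, mulrDl, mulrDr, =^~ scalerAl, =^~ scalerAr).

Lemma antipode1 : S 1 = 1.
Proof.
have := antipodel (1 : H); have [-> _] := @comul_monoid_morphism K H.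
rewrite counit1 scale1r tliftE ?mulr1 //.
by split=> z k x y /=; hopf_linear.
Qed.

Lemma antipodeM a b : S (a * b) = S b * S a.
Proof.
have sumV h : \sum_(p <- D h) S p.1 * p.2 = (eps h)%:A by exact: antipodel.
have sumVr h : \sum_(p <- D h) p.1 * S p.2 = (eps h)%:A by exact: antipoder.
have sum1 h : \sum_(p <- D h) eps p.1 *: p.2 = h by exact: counitl.
have sum2 h : \sum_(p <- D h) eps p.2 *: p.1 = h by exact: counitr.
transitivity (\sum_(p <- D a) \sum_(q <- D b) \sum_(r <- D p.2)
    \sum_(s <- D q.2) S (p.1 * q.1) * (r.1 * (s.1 * S s.2) * S r.2)).
  rewrite -[in LHS](sum2 a) -[in LHS](sum2 b) mulr_suml linear_sum.
  apply: eq_bigr => p _; rewrite mulr_sumr linear_sum.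
  apply: eq_bigr => q _; rewrite -scalerAl -scalerAr !linearZ /=.
  under eq_bigr => r _.
    rewrite -mulr_sumr -mulr_suml -mulr_sumr sumVr -scalerAr mulr1 -scalerAl.
    rewrite -scalerAr; over.
  by rewrite -scaler_sumr -mulr_sumr sumVr -scalerAr mulr1 scalerA mulrC -scalerA.
pose G (x y z : H) :=
  \sum_(q <- D b) \sum_(s <- D q.1) S (x * s.1) * (y * (s.2 * S q.2) * S z).
transitivity (\sum_(p <- D a) \sum_(r <- D p.2) G p.1 r.1 r.2).
  apply: eq_bigr => p _; rewrite exchange_big; apply: eq_bigr => r _ /=.
  apply/esym/(sum_comulA (F := fun x y z =>
    S (p.1 * x) * (r.1 * (y * S z) * S r.2))) => ? ? k x y; hopf_linear.
rewrite -sum_comulA; first last.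
- by move=> x y; do 2!apply: sum_linear => ?; move=> k z z'; hopf_linear.
- by move=> x y; do 2!apply: sum_linear => ?; move=> k z z'; hopf_linear.
- by move=> x y; do 2!apply: sum_linear => ?; move=> k z z'; hopf_linear.
transitivity (\sum_(p <- D a) \sum_(q <- D b)
    (eps p.1 *: (eps q.1 *: (S q.2 * S p.2)))).
  apply: eq_bigr => p _; rewrite exchange_big /=; apply: eq_bigr => q _.
  transitivity ((\sum_(r <- D p.1) \sum_(s <- D q.1)
      S (r.1 * s.1) * (r.2 * s.2)) * (S q.2 * S p.2)).
    rewrite mulr_suml; apply: eq_bigr => r _; rewrite mulr_suml.
    by apply: eq_bigr => s _; rewrite !mulrA.
  rewrite -(sum_comulM (F := fun x y => S x * y)) ?sumV.
    by rewrite counitM -scalerAl mul1r scalerA.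
  by split=> x k y z /=; hopf_linear.
rewrite -[in RHS](sum1 a) -[in RHS](sum1 b) !linear_sum mulr_suml exchange_big.
apply: eq_bigr => q _ /=; rewrite linearZ mulr_sumr; apply: eq_bigr => p _ /=.
by rewrite [S (_ *: p.2)]linearZ -scalerAr -scalerAl.
Qed.

End HopfTheory.

Section Modules.
Variable R : pzRingType.

Definition isomorphic (V W : lmodType R) : Prop :=
  exists f : {linear V -> W}, bijective f.

Definition simple_module (V : lmodType R) : Prop :=
  (exists v : V, v != 0) /\
  forall M : {pred V}, submod_closed M ->
    (forall v, v \in M -> v = 0) \/ (forall v, v \in M).

(* Every submodule M has a complement N, i.e., V = M + N with M, N meeting
   only at 0. *)
Definition semisimple_module (V : lmodType R) : Prop :=
  forall M : {pred V}, submod_closed M ->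
  exists N : {pred V}, [/\ submod_closed N,
    forall v, v \in M -> v \in N -> v = 0 &
    forall v, exists m n, [/\ m \in M, n \in N & v = m + n]].

End Modules.

(* H^o is H as a left module over itself. *)
Definition semisimple_algebra (K : fieldType) (H : algType K) : Prop :=
  semisimple_module (H^o : lmodType H).

Definition has_dimension (K : fieldType) (V : lmodType K) (n : nat) : Prop :=
  isomorphic V 'rV[K]_n.

(* The ground field with the action h . a = counit h * a. *)
Definition trivial_module (K : fieldType) (H : hopfAlgType K) : Type := K.

Section TrivialModule.
Variables (K : fieldType) (H : hopfAlgType K).
Local Notation triv := (trivial_module H).

HB.instance Definition _ := GRing.Zmodule.on triv.

Definition trivial_scale (h : H) (a : triv) : triv := counit h * (a : K).

Fact trivial_scaleA h k a :
  trivial_scale h (trivial_scale k a) = trivial_scale (h * k) a.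
Proof. by rewrite /trivial_scale counitM mulrA. Qed.

Fact trivial_scale1 : left_id 1 trivial_scale.
Proof. by move=> a; rewrite /trivial_scale counit1 mul1r. Qed.

Fact trivial_scaleDr : right_distributive trivial_scale +%R.
Proof. by move=> h a b; exact: (@mulrDr K). Qed.

Fact trivial_scaleDl a : {morph trivial_scale^~ a : h k / h + k}.
Proof. by move=> h k; rewrite /trivial_scale raddfD; exact: (@mulrDl K). Qed.

HB.instance Definition _ := GRing.Zmodule_isLmodule.Build H triv
  trivial_scaleA trivial_scale1 trivial_scaleDr trivial_scaleDl.

End TrivialModule.

(* The vector space over K underlying an H-module, K acting through k%:A. *)
Definition underlying (K : fieldType) (H : algType K) (V : lmodType H) : Type :=
  V.

Section Underlying.
Variables (K : fieldType) (H : algType K) (V : lmodType H).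
Local Notation U := (underlying V).

HB.instance Definition _ := GRing.Zmodule.on U.

Definition underlying_scale (k : K) (v : U) : U := (k%:A : H) *: (v : V).

Fact underlying_scaleA k l v :
  underlying_scale k (underlying_scale l v) = underlying_scale (k * l) v.
Proof. by rewrite /underlying_scale scalerA mulr_algl scalerA. Qed.

Fact underlying_scale1 : left_id 1 underlying_scale.
Proof. by move=> v; rewrite /underlying_scale !scale1r. Qed.

Fact underlying_scaleDr : right_distributive underlying_scale +%R.
Proof. by move=> k v w; exact: (@scalerDr H V). Qed.

Fact underlying_scaleDl v : {morph underlying_scale^~ v : k l / k + l}.
Proof. by move=> k l; rewrite /underlying_scale !scalerDl. Qed.

HB.instance Definition _ := GRing.Zmodule_isLmodule.Build K U
  underlying_scaleA underlying_scale1 underlying_scaleDr underlying_scaleDl.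

End Underlying.

Section Dual.
Variables (K : fieldType) (H : hopfAlgType K) (V : lmodType H).

Definition is_functional : {pred underlying V -> K} := fun f => `[< scalar f >].

Record dual : Type := Dual {
  dual_fun :> underlying V -> K;
  dual_funP : dual_fun \in is_functional
}.

HB.instance Definition _ := [isSub for dual_fun].
HB.instance Definition _ := [Choice of dual by <:].

Fact is_functional_zmod_closed : zmod_closed is_functional.
Proof.
split=> [|f g /asboolP flin /asboolP glin]; apply/asboolP => k v w.
  by rewrite /= mulr0 addr0.
change (f (k *: v + w) - g (k *: v + w) = k * (f v - g v) + (f w - g w)).
by rewrite flin glin mulrBr opprD addrACA.
Qed.

HB.instance Definition _ :=
  GRing.isZmodClosed.Build _ is_functional is_functional_zmod_closed.
HB.instance Definition _ := [SubChoice_isSubZmodule of dual by <:].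

Fact dual_scale_functional (h : H) (f : dual) :
  (fun v : underlying V => f (antipode h *: (v : V))) \in is_functional.
Proof.
have /asboolP flin := dual_funP f; apply/asboolP => k v w; rewrite -flin.
congr (f _); rewrite -[k *: v]/(k%:A *: (v : V)).
rewrite [LHS](@scalerDr H V); congr (_ + _).
by rewrite -[RHS]/(k%:A *: (_ : V)) !scalerA mulr_algl mulr_algr.
Qed.

Definition dual_scale (h : H) (f : dual) : dual :=
  Dual (dual_scale_functional h f).

Lemma dualP (f g : dual) : (forall v, f v = g v) -> f = g.
Proof. by move=> fg; apply/val_inj/funext. Qed.

Fact dual_scaleA h k f : dual_scale h (dual_scale k f) = dual_scale (h * k) f.
Proof. by apply: dualP => v /=; rewrite antipodeM scalerA. Qed.

Fact dual_scale1 : left_id 1 dual_scale.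
Proof. by move=> f; apply: dualP => v /=; rewrite antipode1 scale1r. Qed.

Fact dual_scaleDr : right_distributive dual_scale +%R.
Proof. by move=> h f g; apply: dualP. Qed.

Fact dual_scaleDl f : {morph dual_scale^~ f : h k / h + k}.
Proof.
move=> h k; apply: dualP => v /=; rewrite raddfD scalerDl.
have /asboolP flin := dual_funP f.
by have := flin 1 (antipode h *: v) (antipode k *: v); rewrite scale1r mul1r.
Qed.

HB.instance Definition _ := GRing.Zmodule_isLmodule.Build H dual
  dual_scaleA dual_scale1 dual_scaleDr dual_scaleDl.

End Dual.

Definition self_dual (K : fieldType) (H : hopfAlgType K) (V : lmodType H) :
  Prop := isomorphic V (dual V).

(* Main.v *)
Require Import Defs.
From HB Require Import structures.
From mathcomp Require Import all_boot all_order all_algebra all_field.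
From mathcomp Require Import boolp classical_sets.
From mathcomp Require cyclic.

Set Implicit Arguments.
Unset Strict Implicit.
Unset Printing Implicit Defensive.

Import GRing.Theory.
Local Open Scope ring_scope.

(** Write [n] for the dimension of [H], [phi] for the square of the antipode and
    [L] for the integral with [eps L = 1]; Sweedler indices denote coproducts.

    The dimension is finite because [L_1 (x) S L_2] is a Casimir element of the
    regular module: a Casimir element made of as few tensors as possible yields a
    finite spanning family ([hopf_finite]).

    The antipode is an involution ([phi_id]).  The functional
    [lam h = Tr (y |-> phi y * h)] is an integral on [H] ([lam_integral]), and its
    distinguished grouplike element intertwines [phi^2] with the identity
    ([phi_phi]).  Grouplike elements have finite order, hence so does [phi], and an
    automorphism of finite order of a semisimple algebra which fixes a
    one-dimensional block has nonzero trace ([finite_order_trace]).  So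
    [lam 1 = Tr phi] is nonzero, which makes the distinguished grouplike trivial and
    [phi^2 = id].  The character of the regular comodule is [n] times an idempotent on
    which [lam] takes an integral value; thus [n] divides [Tr phi], which is
    possible only for [phi = id].  That character is then [n L] ([tr_regular]).

    For an [H]-module [V] let [theta (v (x) g) = g_1 v (x) g_2] on [V (x) H].  Then
    [Tr theta = n Tr_V L] and [Tr theta^2 = n Tr_V (L_2 L_1)].  When [V] is simple,
    nontrivial and self-dual, [L] acts by zero, and the second trace is [n] or [- n]
    according to whether the invariant form is symmetric or alternating
    ([frobenius_schur]).

    The eigenvalues of [theta] are roots of unity ([theta_eigenvalue]).  Indeed
    [V (x) H] is a Yetter-Drinfeld module on which [theta] is the twist
    [m |-> m_1 m_0], so each eigenspace of [theta] is a Yetter-Drinfeld module [M]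
    on which the twist is a scalar [t].  On [M (x) H] the four operators sending
    [m (x) h] to [m_0 (x) m_1 h], [m_0 (x) h m_1], [h_1 m (x) h_2] and
    [h_2 m (x) h_1] satisfy a relation in which [t] is the only other factor.  Acting
    on two of the three factors of [M (x) H (x) H], the first and the third have
    determinant [1] by a pentagon equation, and conjugation by the antipode relates
    them to the inverses of the other two ([twist_root_of_unity]).

    Finally [(Tr theta)^2 - Tr theta^2] is twice the second elementary symmetric
    function of the eigenvalues, an algebraic integer ([tr_sqr_integral]).  Here it
    is [n] or [- n], so [n / 2] is a rational algebraic integer and [n] is even. *)

(** * Linear maps, bases and traces *)

Section Linearity.
Variable K : fieldType.
Implicit Types U W : lmodType K.

Lemma lin_id U : linear (fun x : U => x).
Proof. by []. Qed.

Lemma lin_comp U W (X : lmodType K) (g : W -> X) (f : U -> W) :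
  linear g -> linear f -> linear (fun x => g (f x)).
Proof. by move=> gl fl a x y; rewrite fl gl. Qed.

Lemma lin_mull (A : algType K) U (f : U -> A) c :
  linear f -> linear (fun x => f x * c).
Proof. by move=> fl a x y; rewrite fl mulrDl scalerAl. Qed.

Lemma lin_mulr (A : algType K) U (f : U -> A) c :
  linear f -> linear (fun x => c * f x).
Proof. by move=> fl a x y; rewrite fl mulrDr scalerAr. Qed.

Lemma lin_mulKl U (f : U -> K) (c : K) :
  linear (f : U -> K^o) -> linear (fun x => f x * c : K^o).
Proof. by move=> fl a x y; rewrite fl mulrDl /= -[LHS]/(_ * _ * _ + _) -mulrA. Qed.

Lemma lin_mulKr U (f : U -> K) (c : K) :
  linear (f : U -> K^o) -> linear (fun x => c * f x : K^o).
Proof.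
move=> fl a x y; rewrite fl mulrDr /= -[LHS]/(_ * (_ * _) + _).
by rewrite mulrCA.
Qed.

Lemma lin_scaler U W (f : U -> W) a : linear f -> linear (fun x => a *: f x).
Proof. by move=> fl b x y; rewrite fl scalerDr !scalerA mulrC. Qed.

Lemma lin_scalel U W (f : U -> K) (w : W) :
  linear (f : U -> K^o) -> linear (fun x => f x *: w).
Proof.
move=> fl b x y; rewrite fl scalerDl; congr (_ + _).
by rewrite scalerA.
Qed.

Lemma lin_sum U W I (r : seq I) (P : pred I) (F : U -> I -> W) :
  (forall i, linear (fun x => F x i)) ->
  linear (fun x => \sum_(i <- r | P i) F x i).
Proof.
move=> Fl a x y; rewrite scaler_sumr -big_split.
by apply: eq_bigr => i _; rewrite Fl.
Qed.

Lemma lin_add U W (f g : U -> W) :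
  linear f -> linear g -> linear (fun x => f x + g x).
Proof. by move=> fl gl a x y; rewrite fl gl scalerDr addrACA. Qed.

Lemma lin0 U W (f : U -> W) : linear f -> f 0 = 0.
Proof. by move=> fl; have := fl (-1) 0 0; rewrite scaleN1r oppr0 addr0 scaleN1r addNr. Qed.
Lemma linD U W (f : U -> W) x y : linear f -> f (x + y) = f x + f y.
Proof. by move=> fl; have := fl 1 x y; rewrite !scale1r. Qed.
Lemma linZ U W (f : U -> W) a x : linear f -> f (a *: x) = a *: f x.
Proof. by move=> fl; have := fl a x 0; rewrite (lin0 fl) !addr0. Qed.
Lemma linZK U (f : U -> K^o) a x : linear f -> f (a *: x) = a * f x.
Proof. exact: linZ. Qed.
Lemma linB U W (f : U -> W) x y : linear f -> f (x - y) = f x - f y.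
Proof. by move=> fl; rewrite linD // -scaleN1r linZ // scaleN1r. Qed.
Lemma lin_bigsum U W (f : U -> W) I (r : seq I) (P : pred I) (F : I -> U) :
  linear f -> f (\sum_(i <- r | P i) F i) = \sum_(i <- r | P i) f (F i).
Proof.
by move=> fl; apply: (big_morph f (fun x y => linD x y fl)); rewrite (lin0 fl).
Qed.

End Linearity.

Section FiniteBasis.
Variable K : fieldType.
Implicit Types V : lmodType K.

(** The coordinates are part of the data, and take values in the regular module
    [K^o], so that they are linear maps of [K]-modules. *)
Definition is_basis V n (e : 'I_n -> V) (c : 'I_n -> V -> K^o) :=
  [/\ forall i, linear (c i), forall v, v = \sum_i c i v *: e i &
      forall i j, c i (e j) = (i == j)%:R].

(** A spanning family of minimal size is a basis. *)
Lemma finite_basis V (I : finType) (w : I -> V) :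
  (forall v, exists a : I -> K, v = \sum_i a i *: w i) ->
  exists n (e : 'I_n -> V) c, is_basis e c.
Proof.
pose spans m (w : 'I_m -> V) :=
  forall v, exists a : 'I_m -> K, v = \sum_i a i *: w i.
pose P m := `[< exists w : 'I_m -> V, spans m w >].
move=> spw; have exP : exists m, P m.
  exists #|I|; apply/asboolP; exists (fun k => w (enum_val k)) => v.
  have [a ->] := spw v; exists (fun k => a (enum_val k)).
  by rewrite (reindex (enum_val : 'I_#|I| -> I)) //; apply: onW_bij; exact: enum_val_bij.
case: (ex_minnP exP) => n /asboolP[e spe] nmin.
have indep (a : 'I_n -> K) : \sum_i a i *: e i = 0 -> forall i, a i = 0.
  move=> a0 i; apply/eqP/negPn/negP => ai.
  case: n => [|n] in e spe nmin a a0 i ai *; first by case: i {ai}.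
  suff: P n by move/nmin; rewrite ltnn.
  apply/asboolP; exists (fun j => e (lift i j)) => v.
  have [b bE] := spe v.
  exists (fun j => b (lift i j) - b i / a i * a (lift i j)).
  transitivity (\sum_j b j *: e j - (b i / a i) *: \sum_j a j *: e j).
    by rewrite a0 scaler0 subr0.
  rewrite scaler_sumr -sumrB.
  rewrite (bigD1_ord i) //= scalerA mulfVK // subrr add0r.
  by apply: eq_bigr => j _; rewrite scalerA -scalerBl.
have [c cE] := choice spe.
exists n, e, (fun i v => c v i); split=> //.
- move=> i a v u; apply/eqP; rewrite -subr_eq0; apply/eqP.
  refine (indep (fun i => c (a *: v + u) i - (a * c v i + c u i)) _ i).
  under eq_bigr => j _ do rewrite scalerBl scalerDl -scalerA.
  by rewrite sumrB big_split -scaler_sumr -!cE subrr.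
- move=> i j; apply/eqP; rewrite -subr_eq0; apply/eqP.
  refine (indep (fun i => c (e j) i - (i == j)%:R) _ i).
  under eq_bigr => k _ do rewrite scalerBl.
  rewrite sumrB -cE (bigD1 j) //= eqxx scale1r big1 ?addr0 ?subrr // => k /negPf->.
  by rewrite scale0r.
Qed.

Lemma basis_dim V n (e : 'I_n -> V) c : is_basis e c -> has_dimension V n.
Proof.
case=> cl ce cd.
pose f v : 'rV[K]_n := \row_i c i v.
have fl : linear f by move=> a x y; apply/rowP => i; rewrite !mxE cl.
pose ff : {linear V -> 'rV[K]_n} :=
  HB.pack f (GRing.isLinear.Build K V 'rV[K]_n _ f fl).
exists ff; exists (fun r : 'rV[K]_n => \sum_i r 0 i *: e i) => [v|r] /=.
  by rewrite [RHS]ce; apply: eq_bigr => i _; rewrite mxE.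
apply/rowP => i; rewrite mxE lin_bigsum // (bigD1 i) //= big1 => [|j ji].
  by rewrite linZ // cd eqxx addr0 /GRing.scale /= mulr1.
by rewrite linZ // cd eq_sym (negPf ji) scaler0.
Qed.

(** By Zorn's lemma there is a maximal subspace containing [P] and avoiding [v]; it
    is a hyperplane. *)
Lemma functional_sep V (P : set V) v :
  P 0 -> (forall a x y, P x -> P y -> P (a *: x + y)) -> ~ P v ->
  exists f : V -> K^o, [/\ linear f, f v = 1 & forall x, P x -> f x = 0].
Proof.
move=> P0 PD nPv.
pose sub (M : set V) := [/\ M 0, (forall a x y, M x -> M y -> M (a *: x + y)),
  ~ M v & (P `<=` M)%classic].
pose Q (M : set V) := sub (M `|` P)%classic.
have [F FQ Ftot|M [QM maxM]] := @Zorn_bigcup V Q.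
  split.
  - by right.
  - move=> a x y [[X FX Xx]|Px] [[Y FY Yy]|Py].
    + have [XY|YX] := Ftot _ _ FX FY.
        have [_ + _ _] := FQ _ FY => /(_ a x y (or_introl (XY _ Xx)) (or_introl Yy)).
        by case=> ?; [left; exists Y|right].
      have [_ + _ _] := FQ _ FX => /(_ a x y (or_introl Xx) (or_introl (YX _ Yy))).
      by case=> ?; [left; exists X|right].
    + have [_ + _ _] := FQ _ FX => /(_ a x y (or_introl Xx) (or_intror Py)).
      by case=> ?; [left; exists X|right].
    + have [_ + _ _] := FQ _ FY => /(_ a x y (or_intror Px) (or_introl Yy)).
      by case=> ?; [left; exists Y|right].
    + by right; apply: PD.
  - by case=> // -[X FX Xv]; have [_ _ + _] := FQ _ FX; apply; left.
  - by move=> x Px; right.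
pose N : set V := (M `|` P)%classic.
have [N0 ND nNv PN] : sub N by [].
have NZ a x : N x -> N (a *: x) by move=> Nx; have := ND a x 0 Nx N0; rewrite addr0.
have NB x y : N x -> N y -> N (x - y).
  by move=> Nx Ny; have := ND (-1) y x Ny Nx; rewrite scaleN1r addrC.
have dec x : exists a, N (x - a *: v).
  have [Nx|nNx] := pselect (N x); first by exists 0; rewrite scale0r subr0.
  pose N' : set V := fun y => exists a, N (y - a *: x).
  have N'D a y z : N' y -> N' z -> N' (a *: y + z).
    move=> [b Nb] [d Nd]; exists (a * b + d).
    by have := ND a _ _ Nb Nd; rewrite scalerBr addrACA -opprD scalerA -scalerDl.
  have sN' : (N `<=` N')%classic by move=> y Ny; exists 0; rewrite scale0r subr0.
  have N'x : N' x by exists 1; rewrite scale1r subrr.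
  have [a Na] : N' v.
    apply: contrapT => nv; apply: (maxM N'); last first.
      rewrite /Q (_ : (N' `|` P)%classic = N').
        by split; [exact: sN'|exact: N'D|exact: nv|by move=> y /PN/sN'].
      by apply/predeqP => y; split=> [[//|/PN/sN']|]; [|left].
    split=> [y My|]; first by apply: sN'; left.
    by move=> /(_ _ N'x) Mx; apply: nNx; left.
  have a0 : a != 0.
    by apply/eqP => a0; apply: nNv; move: Na; rewrite a0 scale0r subr0.
  exists a^-1; have := NZ (- a^-1) _ Na.
  by rewrite scalerBr scalerA mulNr mulVf // scaleN1r opprK scaleNr addrC.
have [f fE] := choice dec.
have funiq a x : N (x - a *: v) -> f x = a.
  move=> Na; apply: contrapT => /eqP fa; apply: nNv.
  have := NZ (a - f x)^-1 _ (NB _ _ (fE x) Na).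
  rewrite opprB [_ - _ *: v + _]addrC addrA subrK -scalerBl scalerA mulVf ?scale1r //.
  by rewrite subr_eq0 eq_sym.
exists f; split.
- move=> a x y; apply: funiq; have := ND a _ _ (fE x) (fE y).
  by rewrite scalerBr addrACA -opprD scalerA -scalerDl.
- by apply: funiq; rewrite scale1r subrr.
- by move=> x Px; apply: funiq; rewrite scale0r subr0; right.
Qed.

End FiniteBasis.

Section Trace.
Variables (K : fieldType) (V : lmodType K) (n : nat).
Variables (e : 'I_n -> V) (c : 'I_n -> V -> K^o).
Hypothesis B : is_basis e c.

Definition tr (f : V -> V) : K^o := \sum_i c i (f (e i)).

Lemma eq_tr f g : f =1 g -> tr f = tr g.
Proof. by move=> fg; apply: eq_bigr => i _; rewrite fg. Qed.

Lemma coord_lin i : linear (c i).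
Proof. by case: B. Qed.

Lemma coordE v : v = \sum_i c i v *: e i.
Proof. by case: B. Qed.

Lemma coord_app (W : lmodType K) (g : V -> W) v :
  linear g -> g v = \sum_i c i v *: g (e i).
Proof.
move=> gl; rewrite {1}(coordE v) (lin_bigsum _ _ _ gl).
by apply: eq_bigr => i _; rewrite linZ.
Qed.

Lemma coord_delta i j : c i (e j) = (i == j)%:R.
Proof. by case: B. Qed.

Lemma trB f g : tr (fun x => f x - g x) = tr f - tr g.
Proof. by rewrite -sumrB; apply: eq_bigr => i _; rewrite (linB _ _ (coord_lin i)). Qed.

Lemma trD f g : tr (fun x => f x + g x) = tr f + tr g.
Proof. by rewrite -big_split; apply: eq_bigr => i _; rewrite (linD _ _ (coord_lin i)). Qed.

Lemma trZ a f : tr (fun x => a *: f x) = a *: tr f.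
Proof. by rewrite scaler_sumr; apply: eq_bigr => i _; rewrite (linZ _ _ (coord_lin i)). Qed.

Lemma tr_sum I (r : seq I) (P : pred I) (f : I -> V -> V) :
  tr (fun x => \sum_(j <- r | P j) f j x) = \sum_(j <- r | P j) tr (f j).
Proof.
rewrite exchange_big; apply: eq_bigr => i _.
by rewrite (lin_bigsum _ _ _ (coord_lin i)).
Qed.

Lemma tr_id : tr id = n%:R.
Proof.
rewrite /tr (eq_bigr (fun => 1)) => [|i _]; last by rewrite coord_delta eqxx.
by rewrite sumr_const card_ord.
Qed.

Lemma lin_tr (U : lmodType K) (F : U -> V -> V) :
  (forall y, linear (fun x => F x y)) -> linear (fun x => tr (F x)).
Proof.
by move=> Fl; apply: lin_sum => i; apply: lin_comp => //; exact: coord_lin.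
Qed.

Lemma tr_rank1 (l : V -> K^o) w : linear l -> tr (fun x => l x *: w) = l w.
Proof.
move=> ll; rewrite [in RHS](coordE w) (lin_bigsum _ _ _ ll).
apply: eq_bigr => i _; rewrite (linZ _ _ (coord_lin i)) (linZ _ _ ll).
by rewrite /GRing.scale /= mulrC.
Qed.

(** [f] is the sum of the rank one maps [x |-> l_j x *: f (w_j)]. *)
Lemma tr_frame (I : finType) (w : I -> V) (l : I -> V -> K^o) f :
  (forall j, linear (l j)) -> linear f -> (forall x, x = \sum_j l j x *: w j) ->
  tr f = \sum_j l j (f (w j)).
Proof.
move=> ll fl wE; rewrite (eq_tr (g := fun x => \sum_j l j x *: f (w j))).
  by rewrite tr_sum; apply: eq_bigr => j _; rewrite tr_rank1.
by move=> x; rewrite {1}(wE x) (lin_bigsum _ _ _ fl); apply: eq_bigr => j _; rewrite linZ.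
Qed.

End Trace.

Lemma tr_comp (K : fieldType) (V W : lmodType K) n m (e : 'I_n -> V) c
    (e' : 'I_m -> W) c' (f : V -> W) (g : W -> V) :
  is_basis e c -> is_basis e' c' -> linear f -> linear g ->
  tr e c (fun x => g (f x)) = tr e' c' (fun x => f (g x)).
Proof.
move=> B B' fl gl.
have -> : tr e c (fun x => g (f x)) = \sum_i \sum_j c' j (f (e i)) * c i (g (e' j)).
  apply: eq_bigr => i _; rewrite {1}(coordE B' (f (e i))).
  rewrite (lin_bigsum _ _ _ gl) (lin_bigsum _ _ _ (coord_lin B i)).
  by apply: eq_bigr => j _; rewrite linZ // (linZ _ _ (coord_lin B i)).
rewrite exchange_big; apply: eq_bigr => j _; rewrite {2}(coordE B (g (e' j))).
rewrite (lin_bigsum _ _ _ fl) (lin_bigsum _ _ _ (coord_lin B' j)).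
apply: eq_bigr => i _; rewrite linZ // (linZ _ _ (coord_lin B' j)).
by rewrite /GRing.scale /= mulrC.
Qed.

(** * Tensor products *)

Section TensorWithH.
Variables (K : fieldType) (H : lmodType K) (n : nat).
Variables (e : 'I_n -> H) (c : 'I_n -> H -> K^o).
Hypothesis B : is_basis e c.

Section OneFactor.
Variable X : lmodType K.

(** The space [X (x) H] is modelled by [{ffun 'I_n -> X}]: the function [F] stands
    for the sum of the [F j (x) e j]. *)
Definition pure (x : X) (h : H) : {ffun 'I_n -> X} := [ffun j => c j h *: x].

Lemma pure_linl h : linear (fun x => pure x h).
Proof.
move=> a x y; apply/ffunP => j; rewrite !ffunE.
by rewrite scalerDr !scalerA mulrC.
Qed.

Lemma pure_linr x : linear (pure x).
Proof.
move=> a h k; apply/ffunP => j; rewrite !ffunE (coord_lin B j) scalerDl.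
by rewrite scalerA.
Qed.

Lemma pureE (F : {ffun 'I_n -> X}) : F = \sum_j pure (F j) (e j).
Proof.
apply/ffunP => i; rewrite sum_ffunE (bigD1 i) //= !ffunE (coord_delta B) eqxx scale1r.
rewrite big1 ?addr0 // => j ji.
by rewrite ffunE (coord_delta B) eq_sym (negPf ji) scale0r.
Qed.

(** The map on [X (x) H] induced by a bilinear map [G]. *)
Definition ext (W : lmodType K) (G : X -> H -> W) (F : {ffun 'I_n -> X}) : W :=
  \sum_j G (F j) (e j).

Lemma ext_lin (W : lmodType K) (G : X -> H -> W) :
  (forall h, linear (fun x => G x h)) -> linear (ext G).
Proof.
move=> Gl a F F'; rewrite scaler_sumr -big_split; apply: eq_bigr => j _.
by rewrite !ffunE Gl.
Qed.

Lemma ext_pure (W : lmodType K) (G : X -> H -> W) x h :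
  (forall h, linear (fun x => G x h)) -> (forall x, linear (fun h => G x h)) ->
  ext G (pure x h) = G x h.
Proof.
move=> Gl Gr; rewrite [RHS](coord_app B (g := G x)) //; apply: eq_bigr => j _.
rewrite ffunE; exact: (linZ (f := fun x => G x (e j))).
Qed.

Lemma lin_pure_ext (W : lmodType K) (f g : {ffun 'I_n -> X} -> W) :
  linear f -> linear g -> (forall x h, f (pure x h) = g (pure x h)) -> f =1 g.
Proof.
move=> fl gl fg F; rewrite (pureE F) (lin_bigsum _ _ _ fl) (lin_bigsum _ _ _ gl).
by apply: eq_bigr => j _; exact: fg.
Qed.

Lemma tensor_basis d (w : 'I_d -> X) l : is_basis w l ->
  exists m (w' : 'I_m -> {ffun 'I_n -> X}) l', is_basis w' l'.
Proof.
move=> Bw; apply: (@finite_basis _ _ _ (fun t : 'I_d * 'I_n => pure (w t.1) (e t.2))) => F.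
exists (fun t => l t.1 (F t.2)).
rewrite -(pair_bigA _ (fun i j => l i (F j) *: pure (w i) (e j))) exchange_big /=.
rewrite {1}(pureE F); apply: eq_bigr => j _.
exact: (coord_app Bw (g := fun x => pure x (e j)) (F j) (pure_linl _)).
Qed.

Lemma tr_tensor d (w : 'I_d -> X) l m (w' : 'I_m -> {ffun 'I_n -> X}) l' f :
  is_basis w l -> is_basis w' l' -> linear f ->
  tr w' l' f = \sum_i \sum_j l i (f (pure (w i) (e j)) j).
Proof.
move=> Bw Bw' fl.
rewrite (tr_frame Bw' (w := fun t : 'I_d * 'I_n => pure (w t.1) (e t.2))
  (l := fun t F => l t.1 (F t.2))) //.
- by rewrite [RHS]pair_bigA.
- by move=> t a u v; rewrite !ffunE (coord_lin Bw).
move=> F; rewrite -(pair_bigA _ (fun i j => l i (F j) *: pure (w i) (e j))) exchange_big /=.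
rewrite {1}(pureE F); apply: eq_bigr => j _.
exact: (coord_app Bw (g := fun x => pure x (e j)) (F j) (pure_linl _)).
Qed.

End OneFactor.

End TensorWithH.

Lemma lin_ext (K : fieldType) (H : lmodType K) n (e : 'I_n -> H) (U X W : lmodType K)
    (G : U -> X -> H -> W) (F : {ffun 'I_n -> X}) :
  (forall x h, linear (fun u : U => G u x h)) -> linear (fun u => ext e (G u) F).
Proof. by move=> Gl; apply: lin_sum => j; exact: Gl. Qed.

Lemma ext_comp (K : fieldType) (H : lmodType K) n (e : 'I_n -> H) (X W W' : lmodType K)
    (g : W -> W') (G : X -> H -> W) F : linear g ->
  g (ext e G F) = ext e (fun x h => g (G x h)) F.
Proof. exact: lin_bigsum. Qed.

Lemma eq_ext (K : fieldType) (H : lmodType K) n (e : 'I_n -> H) (X W : lmodType K)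
    (G G' : X -> H -> W) F : (forall x h, G x h = G' x h) -> ext e G F = ext e G' F.
Proof. by move=> GG; apply: eq_bigr. Qed.

(** * Hopf algebras in Sweedler notation *)

Section SwDef.
Variables (K : fieldType) (H : algType K) (D : H -> seq (H * H)).

(** The Sweedler sum of [F h_1 h_2], for [D h] a list of pairs of which the tensors
    add up to the coproduct of [h]. *)
Definition sw (W : lmodType K) (F : H -> H -> W) (h : H) : W :=
  \sum_(p <- D h) F p.1 p.2.

Lemma lin_sw_body (U W : lmodType K) (F : U -> H -> H -> W) h :
  (forall a b, linear (fun x => F x a b)) -> linear (fun x => sw (F x) h).
Proof. by move=> Fl; apply: lin_sum => p; exact: Fl. Qed.

End SwDef.

Lemma ext_sw (K : fieldType) (H : algType K) (D : H -> seq (H * H)) n (e : 'I_n -> H)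
    (X W : lmodType K) (G : X -> H -> H -> H -> W) (F : {ffun 'I_n -> X}) h :
  ext e (fun x y => sw D (G x y) h) F = sw D (fun a b => ext e (fun x y => G x y a b) F) h.
Proof. exact: exchange_big. Qed.

(** A Hopf algebra structure, of which the coproduct is seen through the values of
    bilinear maps only: all identities below are between such values, and no tensor
    square of [H] has to be formed. *)
Record hopf (K : fieldType) (H : algType K) := Hopf {
  dl : H -> seq (H * H);
  S : H -> H;
  eps : H -> K;
  S_lin : linear S;
  eps_lin : linear (eps : H -> K^o);
  eps1 : eps 1 = 1;
  epsM : {morph eps : a b / a * b};
  S1 : S 1 = 1;
  SM : forall a b, S (a * b) = S b * S a;
  lin_sw : forall (W : lmodType K) (F : H -> H -> W),
    (forall b, linear (F^~ b)) -> (forall a, linear (F a)) -> linear (sw dl F);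
  swA : forall (W : lmodType K) (F : H -> H -> H -> W) h,
    (forall b c, linear (fun a => F a b c)) ->
    (forall a c, linear (fun b => F a b c)) ->
    (forall a b, linear (fun c => F a b c)) ->
    sw dl (fun a c => sw dl (fun a1 a2 => F a1 a2 c) a) h =
    sw dl (fun a c => sw dl (fun c1 c2 => F a c1 c2) c) h;
  swM : forall (W : lmodType K) (F : H -> H -> W) a b,
    (forall y, linear (fun x => F x y)) -> (forall x, linear (fun y => F x y)) ->
    sw dl F (a * b) =
    sw dl (fun a1 a2 => sw dl (fun b1 b2 => F (a1 * b1) (a2 * b2)) b) a;
  sw1 : forall (W : lmodType K) (F : H -> H -> W),
    (forall y, linear (fun x => F x y)) -> (forall x, linear (fun y => F x y)) ->
    sw dl F 1 = F 1 1;
  counit_l : forall h, sw dl (fun a b => eps a *: b) h = h;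
  counit_r : forall h, sw dl (fun a b => eps b *: a) h = h;
  antipode_l : forall h, sw dl (fun a b => S a * b) h = eps h *: 1;
  antipode_r : forall h, sw dl (fun a b => a * S b) h = eps h *: 1
}.

Lemma lin_eps (K : fieldType) (H : algType K) (A : hopf H) (U : lmodType K) (f : U -> H) :
  linear f -> linear (fun x => eps A (f x) : K^o).
Proof. by move=> fl; apply: (lin_comp (eps_lin A)). Qed.

(** Every identity of Sweedler calculus has linearity side conditions; [lin] proves
    them by following the syntax of the expression. *)
Ltac lin :=
  lazymatch goal with
  | |- forall x, _ => intro; lin
  | |- linear _ => cbv beta; first [ lin_atom | lin_step ]
  end
with lin_step :=
  match goal with
  | |- linear (fun x => @eps _ _ _ (@?f x)) => refine (@lin_eps _ _ _ _ f _); lin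
  | |- linear (fun x => @GRing.mul ?A (@?f x) ?c) =>
      first [ refine (@lin_mull _ _ _ f c _); lin | refine (@lin_mulKl _ _ f c _); lin ]
  | |- linear (fun x => @GRing.mul ?A ?c (@?f x)) =>
      first [ refine (@lin_mulr _ _ _ f c _); lin | refine (@lin_mulKr _ _ f c _); lin ]
  | |- linear (fun x => @GRing.scale _ _ (@?f x) ?c) => refine (@lin_scalel _ _ _ f c _); lin
  | |- linear (fun x => @GRing.scale _ _ ?c (@?f x)) => refine (@lin_scaler _ _ _ f c _); lin
  | |- linear (fun x => @GRing.add _ (@?f x) (@?g x)) => refine (@lin_add _ _ _ f g _ _); lin
  | |- linear (fun x => @sw _ _ (dl ?A) _ ?F (@?f x)) =>
      refine (@lin_comp _ _ _ _ (sw _ F) f _ _); [ refine (@lin_sw _ _ A _ F _ _); lin | lin ]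
  | |- linear (fun x => @sw _ _ _ _ (@?F x) ?h) => refine (@lin_sw_body _ _ _ _ _ F h _); lin
  | |- linear (fun x => @ext _ _ _ ?e _ _ ?G (@?f x)) =>
      refine (@lin_comp _ _ _ _ (ext e G) f _ _); [ refine (@ext_lin _ _ _ e _ _ G _); lin | lin ]
  | |- linear (fun x => @ext _ _ _ ?e _ _ (@?G x) ?F) =>
      refine (@lin_ext _ _ _ e _ _ _ G F _); lin
  | |- linear (fun x => bigop _ _ _) => refine (@lin_sum _ _ _ _ _ _ _ _); lin
  | |- linear (fun x => ?g (@?f x)) =>
      refine (@lin_comp _ _ _ _ g f _ _); [ solve [ lin_atom ] | lin ]
  | |- linear (fun x => ?g (@?f x) ?c) =>
      refine (@lin_comp _ _ _ _ (fun y => g y c) f _ _); [ solve [ lin_atom ] | lin ]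
  | |- linear (fun x => ?g (@?f x) ?c ?d) =>
      refine (@lin_comp _ _ _ _ (fun y => g y c d) f _ _); [ solve [ lin_atom ] | lin ]
  | |- linear (@sw _ _ (dl ?A) _ ?F) => refine (@lin_sw _ _ A _ F _ _); lin
  | |- linear (@ext _ _ _ ?e _ _ ?G) => refine (@ext_lin _ _ _ e _ _ G _); lin
  end
with lin_atom :=
  first [ assumption
        | lazymatch goal with
          | |- linear (@GRing.Linear.sort _ _ _ _ _) => exact: linearP
          | |- linear (@S _ _ ?A) => exact (S_lin A)
          | |- linear (@eps _ _ ?A) => exact (eps_lin A)
          | |- linear (fun x => x) => exact: lin_id
          | |- linear (fun x => pure _ x _) => exact: pure_linl
          | Hyp : is_basis _ ?c |- linear (pure ?c _) => exact: (pure_linr Hyp _)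
          | Hyp : is_basis _ ?c |- linear (?c ?i) => exact (coord_lin Hyp i)
          | Hyp : is_basis ?e ?c |- linear (fun x => tr ?e ?c _) => apply: (lin_tr Hyp); lin
          end
        | match goal with Hyp : forall _, linear _ |- _ => exact (Hyp _) end
        | match goal with Hyp : forall _ _, linear _ |- _ => exact (Hyp _ _) end
        | match goal with Hyp : forall _ _ _, linear _ |- _ => exact (Hyp _ _ _) end ].

#[local] Hint Extern 0 (GRing.linear_for _ _) => lin : core.

Section Sweedler.
Variables (K : fieldType) (H : algType K) (A : hopf H).
Implicit Types (a b h : H) (W : lmodType K).

Local Notation S := (S A).
Local Notation eps := (eps A).
Local Notation sw := (sw (dl A)).
Local Notation "'\sw_' ( a , b <- h ) E" := (sw (fun a b => E) h)
  (at level 41, a name, b name, h at level 60, E at level 41, right associativity,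
   format "'\sw_' ( a ,  b  <-  h )  E").

Lemma epsZ k a : eps (k *: a) = k * eps a.
Proof. exact: (linZK _ _ (eps_lin A)). Qed.

Lemma eq_sw W (F G : H -> H -> W) h :
  (forall a b, F a b = G a b) -> sw F h = sw G h.
Proof. by move=> e; apply: eq_bigr. Qed.

Lemma sw_lin W W' (g : W -> W') (F : H -> H -> W) h :
  linear g -> g (sw F h) = sw (fun a b => g (F a b)) h.
Proof. exact: lin_bigsum. Qed.

Lemma sw_sum W I (r : seq I) (P : pred I) (F : I -> H -> H -> W) h :
  sw (fun a b => \sum_(i <- r | P i) F i a b) h = \sum_(i <- r | P i) sw (F i) h.
Proof. exact: exchange_big. Qed.

Lemma sw_exch W (F : H -> H -> H -> H -> W) h k :
  sw (fun a b => sw (fun c d => F a b c d) k) h =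
  sw (fun c d => sw (fun a b => F a b c d) h) k.
Proof. exact: exchange_big. Qed.

Lemma sw_eps1 W (G : H -> W) h :
  linear G -> sw (fun a b => eps a *: G b) h = G h.
Proof.
move=> Gl; rewrite -[in RHS](counit_l A h) sw_lin //.
by apply: eq_sw => a b; rewrite linZ.
Qed.

Lemma sw_eps2 W (G : H -> W) h :
  linear G -> sw (fun a b => eps b *: G a) h = G h.
Proof.
move=> Gl; rewrite -[in RHS](counit_r A h) sw_lin //.
by apply: eq_sw => a b; rewrite linZ.
Qed.

Lemma sw_Sl W (G : H -> W) h :
  linear G -> sw (fun a b => G (S a * b)) h = eps h *: G 1.
Proof.
move=> Gl; rewrite -(linZ _ _ Gl) -[_ *: 1]antipode_l sw_lin //.
Qed.

Lemma sw_Sr W (G : H -> W) h :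
  linear G -> sw (fun a b => G (a * S b)) h = eps h *: G 1.
Proof.
by move=> Gl; rewrite -(linZ _ _ Gl) -[_ *: 1]antipode_r sw_lin.
Qed.

(** [h_1 S(h_2) (x) h_3 = 1 (x) h], and similarly for the other adjacent legs. *)
Lemma sw_SrA W (G : H -> H -> W) h :
  (forall y, linear (fun x => G x y)) -> (forall x, linear (fun y => G x y)) ->
  \sw_(b, r <- h) \sw_(c, d <- r) G (b * S c) d = G 1 h.
Proof.
move=> G1 G2; rewrite -swA //.
under eq_sw => x d do rewrite (sw_Sr (G := fun y => G y d)) //.
by rewrite sw_eps1.
Qed.

Lemma sw_SlA W (G : H -> H -> W) h :
  (forall y, linear (fun x => G x y)) -> (forall x, linear (fun y => G x y)) ->
  \sw_(b, r <- h) \sw_(c, d <- r) G (S b * c) d = G 1 h.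
Proof.
move=> G1 G2; rewrite -swA //.
under eq_sw => x d do rewrite (sw_Sl (G := fun y => G y d)) //.
by rewrite sw_eps1.
Qed.

Lemma swA_Sl W (G : H -> H -> W) h :
  (forall y, linear (fun x => G x y)) -> (forall x, linear (fun y => G x y)) ->
  \sw_(a, r <- h) \sw_(b, c <- r) G a (S b * c) = G h 1.
Proof.
move=> G1 G2; under eq_sw => a r do rewrite (sw_Sl (G := fun y => G a y)) //.
by rewrite (sw_eps2 (G := fun x => G x 1)).
Qed.

Lemma eps_S h : eps (S h) = eps h.
Proof.
have e1 := @sw_eps2 K^o (fun x => eps (S x)) h.
have e2 := @sw_Sl K^o (fun x => eps x) h.
have {}e1 := e1 ltac:(lin); have {}e2 := e2 ltac:(lin).
transitivity (eps h *: (1 : K^o)); last by rewrite /GRing.scale /= mulr1.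
rewrite -[LHS]e1 -(eps1 A) -[RHS]e2.
by apply: eq_bigr => p _; rewrite epsM -[LHS]/(_ * _) mulrC.
Qed.

(** The maps [h |-> S(h)_1 (x) S(h)_2] and [h |-> S(h_2) (x) S(h_1)] are both convolution
    inverse to the coproduct; the computation multiplies out the triple
    convolution product. *)
Lemma swS W (F : H -> H -> W) h :
  (forall y, linear (fun x => F x y)) -> (forall x, linear (fun y => F x y)) ->
  \sw_(a, b <- S h) F a b = \sw_(a, b <- h) F (S b) (S a).
Proof.
move=> F1 F2.
transitivity (\sw_(p, q <- h) \sw_(a, q' <- q) \sw_(b, q'' <- q') \sw_(c, d <- q'')
  \sw_(s1, s2 <- S p) F (s1 * (a * S d)) (s2 * (b * S c))).
  rewrite -[in LHS](counit_r A h).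
  rewrite (sw_lin (g := S)) // (sw_lin (g := sw F)); last exact: lin_sw.
  apply: eq_sw => p q.
  under [RHS]eq_sw => a q'.
    rewrite (sw_SrA (G := fun x d => \sw_(s1, s2 <- S p) F (s1 * (a * S d)) (s2 * x))) //.
    over.
  rewrite (sw_Sr (G := fun x => \sw_(s1, s2 <- S p) F (s1 * x) (s2 * 1))) //.
  rewrite (linZ _ _ (S_lin A)) linZ //; congr (_ *: _).
  by apply: eq_sw => a b; rewrite !mulr1.
transitivity (\sw_(p, q <- h) \sw_(x, q'' <- q) \sw_(c, d <- q'')
  \sw_(u, v <- S p * x) F (u * S d) (v * S c)).
  apply: eq_sw => p q.
  rewrite -swA //; apply: eq_sw => x q''.
  under eq_sw => a b do rewrite sw_exch.
  under [RHS]eq_sw => c d do rewrite swM //.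
  rewrite sw_exch [RHS]sw_exch; apply: eq_sw => s1 s2; rewrite [RHS]sw_exch.
  by apply: eq_sw => a b; apply: eq_sw => c d; rewrite !mulrA.
rewrite (sw_SlA (G := fun y q => \sw_(c, d <- q) \sw_(u, v <- y) F (u * S d) (v * S c))) //.
by apply: eq_sw => c d; rewrite sw1 ?mul1r.
Qed.

End Sweedler.

(** When [S] is an involution, it is also an antipode for the opposite coproduct. *)
Section SwappedAntipode.
Variables (K : fieldType) (H : algType K) (A : hopf H).
Hypothesis SS : forall h, S A (S A h) = h.
Implicit Types (W : lmodType K).
Local Notation S := (S A).
Local Notation eps := (eps A).
Local Notation sw := (sw (dl A)).
Local Notation "'\sw_' ( a , b <- h ) E" := (sw (fun a b => E) h)
  (at level 41, a name, b name, h at level 60, E at level 41, right associativity,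
   format "'\sw_' ( a ,  b  <-  h )  E").

Lemma sw_Sl' W (G : H -> W) h :
  linear G -> \sw_(a, b <- h) G (S b * a) = eps h *: G 1.
Proof.
move=> Gl; have GSl : linear (fun x => G (S x)) by lin.
rewrite -(S1 A) -(sw_Sl A h GSl) //.
by apply: eq_sw => a b; rewrite SM SS.
Qed.

Lemma sw_SlA' W (G : H -> H -> W) h :
  (forall y, linear (fun x => G x y)) -> (forall x, linear (fun y => G x y)) ->
  \sw_(b, r <- h) \sw_(c, d <- r) G (S c * b) d = G 1 h.
Proof.
move=> G1 G2; rewrite -swA //.
under eq_sw => x d do rewrite (sw_Sl' (G := fun y => G y d)) //.
by rewrite sw_eps1.
Qed.

End SwappedAntipode.

Section HopfOf.
Variables (K : fieldType) (H : hopfAlgType K).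

Let D (h : H) := tensor_repr (comul h).

Let tlift_sum (W U V : lmodType K) (f : U -> V -> W) I (r : seq I)
    (F : I -> tensor U V) :
  bilinear_for *:%R *:%R f ->
  tlift f (\sum_(i <- r) F i) = \sum_(i <- r) tlift f (F i).
Proof. by move=> fb; apply: lin_bigsum; exact: tlift_linear. Qed.

Let lin_swD (W : lmodType K) (F : H -> H -> W) :
  (forall b, linear (F^~ b)) -> (forall a, linear (F a)) -> linear (sw D F).
Proof.
move=> Fl Fr; have Fb : bilinear_for *:%R *:%R F by split.
move=> a x y; rewrite /sw -!/(tlift F _) linearP.
exact: tlift_linear.
Qed.

Let swAD (W : lmodType K) (F : H -> H -> H -> W) h :
  (forall b c, linear (fun a => F a b c)) ->
  (forall a c, linear (fun b => F a b c)) ->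
  (forall a b, linear (fun c => F a b c)) ->
  sw D (fun a c => sw D (fun a1 a2 => F a1 a2 c) a) h =
  sw D (fun a c => sw D (fun c1 c2 => F a c1 c2) c) h.
Proof.
move=> F1 F2 F3.
have inner a : bilinear_for *:%R *:%R (F a) by split=> ?; [exact: F2|exact: F3].
have outer : bilinear_for *:%R *:%R (fun a => tlift (F a)).
  split=> z; last exact: tlift_linear.
  by apply: tlift_param_linear => b c; exact: F1.
have tl (U V : lmodType K) v : linear (tens^~ v : U -> tensor U V).
  exact: (tens_bilinear U V).1.
have tr (U V : lmodType K) u : linear (tens u : V -> tensor U V).
  exact: (tens_bilinear U V).2.
have assoc1 (w : H) : bilinear_for *:%R *:%R
    (fun u v : H => tens u (tens v w)).
  by split=> z k x y /=; rewrite ?tl ?tr.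
have assoc2 : bilinear_for *:%R *:%R
    (fun x (w : H) => tlift (fun u v : H => tens u (tens v w)) x).
  split=> z; first exact: tlift_linear.
  by apply: tlift_param_linear => u v k x y; rewrite !tr.
pose T := tlift (fun a => tlift (F a)).
transitivity (T (tassoc (tmap comul idfun (comul h)))).
  rewrite -[tmap _ _ _]/(sw D (fun a c => tens (comul a) c) h).
  rewrite /tassoc tlift_sum // /T tlift_sum //.
  apply: eq_bigr => p _; rewrite tliftE //.
  rewrite -[tlift _ (comul _)]/(sw D (fun q1 q2 => tens q1 (tens q2 p.2)) p.1).
  rewrite tlift_sum //.
  by apply: eq_bigr => q _; rewrite tliftE // tliftE.
rewrite comulA -[tmap _ _ _]/(sw D (fun a c => tens a (comul c)) h).
by rewrite /T tlift_sum //; apply: eq_bigr => p _; rewrite tliftE.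
Qed.

Let swMD (W : lmodType K) (F : H -> H -> W) a b :
  (forall y, linear (fun x => F x y)) -> (forall x, linear (fun y => F x y)) ->
  sw D F (a * b) =
  sw D (fun a1 a2 => sw D (fun b1 b2 => F (a1 * b1) (a2 * b2)) b) a.
Proof.
move=> F1 F2; have Fb : bilinear_for *:%R *:%R F by split.
rewrite -[LHS]/(tlift F (comul (a * b))).
have [_ ->] := @comul_monoid_morphism K H.
rewrite -[comul a * _]/(sw D (fun a1 a2 => sw D (fun b1 b2 =>
  tens (a1 * b1) (a2 * b2)) b) a) tlift_sum //.
apply: eq_bigr => p _; rewrite tlift_sum //.
by apply: eq_bigr => q _; rewrite tliftE.
Qed.

Let sw1D (W : lmodType K) (F : H -> H -> W) :
  (forall y, linear (fun x => F x y)) -> (forall x, linear (fun y => F x y)) ->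
  sw D F 1 = F 1 1.
Proof.
move=> F1 F2; rewrite -[LHS]/(tlift F (comul 1)).
by have [-> _] := @comul_monoid_morphism K H; rewrite tliftE.
Qed.

(** Representatives of the tensors [comul h] serve as the lists [dl h]. *)
Lemma hopf_of : {A : hopf H | S A =1 antipode & eps A =1 counit}.
Proof.
unshelve eexists (@Hopf K H D antipode counit _ _ _ _ _ _ (@lin_swD) (@swAD)
  (@swMD) (@sw1D) _ _ _ _) => //.
- exact: counit1.
- exact: counitM.
- exact: antipode1.
- exact: antipodeM.
- exact: counitl.
- exact: counitr.
- exact: antipodel.
- exact: antipoder.
Qed.

End HopfOf.

(** * Matrices, determinants and eigenspaces *)

Section Matrices.
Variables (K : fieldType) (V : lmodType K) (n : nat).
Variables (e : 'I_n -> V) (c : 'I_n -> V -> K^o).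
Hypothesis B : is_basis e c.

Definition crd v : 'rV[K]_n := \row_i c i v.
Definition vct (r : 'rV[K]_n) : V := \sum_i r 0 i *: e i.
Definition mat (f : V -> V) : 'M[K]_n := \matrix_(i, j) c j (f (e i)).

Lemma crdK v : vct (crd v) = v.
Proof. by rewrite [RHS](coordE B); apply: eq_bigr => i _; rewrite mxE. Qed.

Lemma vctK r : crd (vct r) = r.
Proof.
apply/rowP => j; rewrite mxE (lin_bigsum _ _ _ (coord_lin B j)) (bigD1 j) //= big1 => [|i ij].
  by rewrite (linZK _ _ (coord_lin B j)) (coord_delta B) eqxx mulr1 addr0.
by rewrite (linZK _ _ (coord_lin B j)) (coord_delta B) eq_sym (negPf ij) mulr0.
Qed.

Lemma crd_mat f v : linear f -> crd (f v) = crd v *m mat f.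
Proof.
move=> fl; apply/rowP => j; rewrite !mxE {1}(coordE B v) (lin_bigsum _ _ _ fl).
rewrite (lin_bigsum _ _ _ (coord_lin B j)); apply: eq_bigr => i _.
by rewrite (linZ _ _ fl) (linZK _ _ (coord_lin B j)) !mxE.
Qed.

Lemma lin_inj_surj (f : V -> V) : linear f -> (forall v, f v = 0 -> v = 0) ->
  forall y, exists x, f x = y.
Proof.
move=> fl f0 y.
have : row_free (mat f).
  have crd0 : crd 0 = 0 by apply/rowP => i; rewrite !mxE (lin0 (coord_lin B i)).
  apply/inj_row_free => r r0; rewrite -[r]vctK [vct r]f0 //.
  by rewrite -[f _]crdK crd_mat // vctK r0 -crd0 crdK.
rewrite row_free_unit => fu; exists (vct (crd y *m invmx (mat f))).
by rewrite -[LHS]crdK crd_mat // vctK mulmxKV // crdK.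
Qed.

Lemma tr_mat f : tr e c f = \tr (mat f).
Proof. by apply: eq_bigr => i _; rewrite mxE. Qed.

Lemma mat_comp f g : linear g -> mat (fun v => g (f v)) = mat f *m mat g.
Proof.
move=> gl; apply/row_matrixP => i; rewrite row_mul.
have rE h : row i (mat h) = crd (h (e i)) by apply/rowP => j; rewrite !mxE.
by rewrite !rE crd_mat.
Qed.

End Matrices.

Section Idempotents.
Variables (K : fieldType) (V : lmodType K) (n : nat).
Variables (e : 'I_n -> V) (c : 'I_n -> V -> K^o).
Hypothesis B : is_basis e c.

(** [r] is the rank of [p], which factors as a surjection onto [K^r] followed by an
    injection; the reverse composite is the identity. *)
Lemma tr_idem (p : V -> V) : linear p -> (forall x, p (p x) = p x) ->
  exists r : nat, [/\ tr e c p = r%:R, (r <= n)%N,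
    r = n -> forall x, p x = x,
    r = 0%N -> forall x, p x = 0 &
    r = 1%N -> exists w (l : V -> K), forall x, p x = l x *: w].
Proof.
move=> pl pp; pose M := mat e c p; exists (\rank M).
have MM : M *m M = M.
  rewrite -(mat_comp B) //; apply/matrixP => i j; rewrite !mxE; by rewrite pp.
have rc1 : row_base M *m col_base M = 1%:M.
  have CRCR : col_base M *m (row_base M *m col_base M *m row_base M) =
      col_base M *m (1%:M *m row_base M).
    by rewrite mul1mx mulmx_base mulmxA mulmxA mulmx_base -mulmxA mulmx_base.
  exact: row_free_inj (row_base_free M) _ _ (row_full_inj (col_base_full M) CRCR).
have pE x : p x = vct e (crd c x *m M) by rewrite -(crd_mat B) // (crdK B).
have vct0 : vct e 0 = 0 by apply: big1 => i _; rewrite mxE scale0r.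
split.
- by rewrite tr_mat -/M -[X in \tr X](mulmx_base M) mxtrace_mulC rc1 mxtrace1.
- exact: rank_leq_row.
- move=> rn x; have Mu : M \in unitmx by rewrite -row_free_unit /row_free rn.
  by rewrite pE; move/(canRL (mulKmx Mu)): MM => ->; rewrite mulVmx // mulmx1 (crdK B).
- by move=> /eqP; rewrite mxrank_eq0 => /eqP M0 x; rewrite pE M0 mulmx0.
move: rc1 (row_base M) (col_base M) (mulmx_base M) => _ + + + r1.
rewrite r1 => R C CR; exists (vct e R), (fun x => (crd c x *m C) 0 0) => x.
rewrite pE -CR mulmxA [crd c x *m C]mx11_scalar mul_scalar_mx [in RHS]mxE mulr1n.
rewrite /vct scaler_sumr; apply: eq_bigr => i _; by rewrite mxE scalerA.
Qed.

End Idempotents.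

Section Determinant.
Variables (K : fieldType) (Y : lmodType K) (N : nat) (w : 'I_N -> Y) (l : 'I_N -> Y -> K^o).
Hypothesis B : is_basis w l.

Definition dt (f : Y -> Y) : K := \det (mat w l f).

Lemma dt_comp f g : linear g -> dt (fun y => g (f y)) = dt f * dt g.
Proof. by move=> gl; rewrite /dt (mat_comp B) // det_mulmx. Qed.

Lemma eq_dt f g : f =1 g -> dt f = dt g.
Proof. by move=> fg; congr (\det _); apply/matrixP => i j; rewrite !mxE fg. Qed.

Lemma dt_id : dt id = 1.
Proof.
rewrite /dt -[RHS](det1 K N); congr (\det _); apply/matrixP => i j.
by rewrite !mxE (coord_delta B) eq_sym.
Qed.

Lemma dt_scale t f : dt (fun y => t *: f y) = t ^+ N * dt f.
Proof.
rewrite /dt -detZ; congr (\det _); apply/matrixP => i j.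
by rewrite !mxE (linZ _ _ (coord_lin B j)).
Qed.

Lemma dt_inv f g : linear g -> (forall y, g (f y) = y) -> dt f * dt g = 1.
Proof. by move=> gl gf; rewrite -dt_comp // -dt_id; apply: eq_dt. Qed.

Lemma dt_left_inv f g : linear g -> (forall y, g (f y) = y) -> dt f != 0.
Proof.
move=> gl /(dt_inv gl) fg; apply/eqP => f0; move/eqP: fg.
by rewrite f0 mul0r eq_sym oner_eq0.
Qed.

(** Conjugate maps have equal determinants, and that of [z12] cancels. *)
Lemma dt_conj z12 z13 v : linear z12 -> linear z13 -> linear v ->
  dt v != 0 -> dt z12 != 0 -> (forall y, v (z12 y) = z12 (z13 (v y))) -> dt z13 = 1.
Proof.
move=> zl1 zl2 vl v0 z0 vz; have := eq_dt vz.
rewrite (dt_comp z12 vl) (dt_comp (fun y => z13 (v y)) zl1) (dt_comp v zl2).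
rewrite [LHS]mulrC => /(mulIf z0); rewrite -[LHS]mulr1 => /(mulfI v0).
by [].
Qed.

Lemma dt_conj' z12 z13 v : linear z12 -> linear z13 -> linear v ->
  dt v != 0 -> dt z12 != 0 -> (forall y, z12 (v y) = v (z12 (z13 y))) -> dt z13 = 1.
Proof.
move=> zl1 zl2 vl v0 z0 vz; have := eq_dt vz.
rewrite (dt_comp v zl1) (dt_comp (fun y => z12 (z13 y)) vl) (dt_comp z13 zl1).
by rewrite [LHS]mulrC => /(mulIf v0); rewrite -[LHS]mul1r => /(mulIf z0).
Qed.

End Determinant.

Section Eigenspace.
Variables (K : fieldType) (M : lmodType K) (n : nat) (w : 'I_n -> M) (l : 'I_n -> M -> K^o).
Hypothesis B : is_basis w l.
Variables (f : M -> M) (t : K).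
Hypothesis fl : linear f.

(** The eigenspace of [f] for [t], as a vector space [U] with its inclusion [i]
    and a retraction [p]. *)
Lemma eigenspace_split : exists (U : lmodType K) (i : U -> M) (p : M -> U),
  [/\ linear i, linear p, cancel i p, forall u, f (i u) = t *: i u &
      forall m, f m = t *: m -> i (p m) = m].
Proof.
pose U0 := lker (linfun (mulmxr (mat w l f - t%:M) : 'rV[K]_n -> 'rV[K]_n)).
exists (subvs_of U0), (fun u => vct w (vsval u)), (fun m => vsproj U0 (crd l m)).
have vl : linear (vct w).
  by move=> a x y; rewrite scaler_sumr -big_split; apply: eq_bigr => k _;
    rewrite !mxE scalerDl scalerA.
have cl : linear (crd l).
  by move=> a x y; apply/rowP => k; rewrite !mxE (coord_lin B).
have inU r : (r \in U0) = (r *m mat w l f == t *: r).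
  by rewrite memv_ker lfunE /= mulmxBr mul_mx_scalar subr_eq0.
split.
- by move=> a x y; rewrite linearP vl.
- by move=> a x y; rewrite cl linearP.
- by move=> u; rewrite (vctK B) vsvalK.
- move=> u; have := subvsP u; rewrite inU => /eqP uE.
  by rewrite -[f _](crdK B) (crd_mat B) // (vctK B) uE (linZ _ _ vl).
move=> m fm; rewrite vsprojK ?(crdK B) // inU -(crd_mat B) // fm.
by rewrite (linZ _ _ cl).
Qed.

Lemma retract_basis (U : lmodType K) (i : U -> M) (p : M -> U) : linear i -> linear p ->
  cancel i p -> exists m (e : 'I_m -> U) c, is_basis e c.
Proof.
move=> il pl ip; apply: (@finite_basis _ _ _ (fun k => p (w k))) => u.
exists (fun k => l k (i u)); rewrite -[LHS]ip {1}(coordE B (i u)) (lin_bigsum _ _ _ pl).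
by apply: eq_bigr => k _; rewrite (linZ _ _ pl).
Qed.

End Eigenspace.

(** * The integral of a semisimple Hopf algebra *)

Section Integral.
Variables (K : fieldType) (H : algType K) (A : hopf H).
Implicit Types (a b h : H) (W : lmodType K).

Local Notation S := (S A).
Local Notation eps := (eps A).
Local Notation sw := (sw (dl A)).
Local Notation "'\sw_' ( a , b <- h ) E" := (sw (fun a b => E) h)
  (at level 41, a name, b name, h at level 60, E at level 41, right associativity,
   format "'\sw_' ( a ,  b  <-  h )  E").

(** A complement of the left ideal [ker eps] is a copy of the trivial module; [L] is the
    component of [1] in it. *)
Lemma semisimple_integral : semisimple_algebra H ->
  exists2 L, (forall h, h * L = eps h *: L) & eps L = 1.
Proof.
move=> ss; pose M : {pred H^o} := fun h => eps h == 0.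
have MP h : (h \in M) = (eps h == 0) by [].
have Mc : submod_closed M.
  split=> [|a u v]; rewrite !MP ?(lin0 (eps_lin A)) //.
  rewrite (linD _ _ (eps_lin A)) -[a *: u]/(a * u) epsM => /eqP-> /eqP->.
  by rewrite mulr0 addr0.
have [N [Nc MN0 MND]] := ss M Mc.
have [m [L [Mm NL E1]]] := MND 1.
have eL : eps L = 1.
  have := congr1 eps E1; rewrite (linD _ _ (eps_lin A)) eps1.
  by move: Mm; rewrite MP => /eqP->; rewrite add0r.
exists L => // h; apply/eqP; rewrite -subr_eq0; apply/eqP/MN0.
  by rewrite MP (linB _ _ (eps_lin A)) epsM epsZ subrr.
have [N0 ND] := Nc.
have NZ x u : u \in N -> x * u \in N.
  by move=> Nu; have := ND x u 0 Nu N0; rewrite addr0.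
rewrite addrC -scaleNr -mulr_algl; exact: ND (- eps h)%:A L (h * L) NL (NZ h L NL).
Qed.

(** Insert [S(h_2) h_3] behind the second factor, and use [h_1 L = eps (h_1) L]. *)
Lemma casimir L W (F : H -> H -> W) h : (forall h, h * L = eps h *: L) ->
  (forall y, linear (fun x => F x y)) -> (forall x, linear (fun y => F x y)) ->
  \sw_(a, b <- L) F (h * a) (S b) = \sw_(a, b <- L) F a (S b * h).
Proof.
move=> hL F1 F2.
transitivity (\sw_(x, r <- h) \sw_(y, z <- r) \sw_(a, b <- L)
    F (x * a) (S b * (S y * z))).
  rewrite (swA_Sl _ (G := fun x y => \sw_(a, b <- L) F (x * a) (S b * y))) //.
  by apply: eq_sw => a b; rewrite mulr1.
rewrite -swA //.
transitivity (\sw_(x, z <- h) \sw_(u, v <- x * L) F u (S v * z)).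
  apply: eq_sw => x z; rewrite swM //; apply: eq_sw => y1 y2; apply: eq_sw => a b.
  by rewrite SM mulrA.
under eq_sw => x z do rewrite hL linZ //.
by rewrite (sw_eps1 _ (G := fun z => \sw_(u, v <- L) F u (S v * z))).
Qed.

(** Like [L_1 (x) S(L_2)], let the sum of the [m] tensors [a_i (x) b_i] be a Casimir
    element with product [1], and let [m] be minimal.  Then the [b_i] are independent,
    so that there are functionals [f_j] dual to them.  By the Casimir property, [h a_j]
    is the combination of the [a_i] with coefficients [f_j (b_i h)], and multiplying by
    [b_j] and summing shows that the [m^2] products [a_i b_j] span [H]. *)
Lemma hopf_finite L : (forall h, h * L = eps h *: L) -> eps L = 1 ->
  exists n (e : 'I_n -> H) c, is_basis e c.
Proof.
move=> hL eL.
pose cas m (a b : 'I_m -> H) := \sum_i a i * b i = 1 /\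
  forall (f : H -> K^o) h, linear f ->
    \sum_i f (b i) *: (h * a i) = \sum_i f (b i * h) *: a i.
pose P m := `[< exists a b : 'I_m -> H, cas m a b >].
have exP : exists m, P m.
  exists (size (dl A L)); apply/asboolP; pose t := tnth (in_tuple (dl A L)).
  exists (fun i => (t i).1), (fun i => S (t i).2).
  have tE W (F : H -> H -> W) : \sw_(a, b <- L) F a b = \sum_i F (t i).1 (t i).2.
    by rewrite [LHS](big_tnth _ _ (dl A L)).
  split=> [|f h fl]; first by rewrite -(tE _ (fun a b => a * S b)) antipode_r eL scale1r.
  rewrite -(tE _ (fun a b => f (S b) *: (h * a))) -(tE _ (fun a b => f (S b * h) *: a)).
  by rewrite (casimir (F := fun x y => f y *: x)).
case: (ex_minnP exP) => m /asboolP[a [b [ab1 cab]]] mmin.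
have sep j : exists f : H -> K^o, [/\ linear f, f (b j) = 1 &
    forall i, i != j -> f (b i) = 0].
  pose U x := exists c : 'I_m -> K, x = \sum_(i | i != j) c i *: b i.
  have [|||f [fl f1 f0]] := @functional_sep K H U (b j).
  - by exists (fun => 0); rewrite big1 // => i _; rewrite scale0r.
  - move=> k x y [c ->] [d ->]; exists (fun i => k * c i + d i).
    under [RHS]eq_bigr do rewrite scalerDl -scalerA.
    by rewrite big_split scaler_sumr.
  - case=> c bj; case: m => [|m] in a b ab1 cab mmin j U c bj *; first by case: j {U bj}.
    suff /mmin : P m by rewrite ltnn.
    apply/asboolP; exists (fun i => a (lift j i) + c (lift j i) *: a j).
    exists (fun i => b (lift j i)).
    have bjE : b j = \sum_i c (lift j i) *: b (lift j i).
      rewrite {1}bj big_mkcond (bigD1_ord j) //= eqxx add0r.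
      by apply: eq_bigr => i _; rewrite eq_sym neq_lift.
    split=> [|f h fl].
      under eq_bigr do rewrite mulrDl -scalerAl scalerAr.
      rewrite big_split -mulr_sumr -bjE -ab1 [RHS](bigD1_ord j) //= addrC.
      by congr (_ + _).
    under eq_bigr do rewrite mulrDr scalerDr -scalerAr scalerA.
    under [RHS]eq_bigr do rewrite scalerDr scalerA.
    rewrite !big_split -!scaler_suml /=.
    have fb x : \sum_i f (b (lift j i) * x) * c (lift j i) = f (b j * x).
      rewrite bjE mulr_suml (lin_bigsum _ _ _ fl); apply: eq_bigr => i _.
      by rewrite -scalerAl linZK // mulrC.
    have fb1 : \sum_i f (b (lift j i)) * c (lift j i) = f (b j).
      by rewrite -[b j]mulr1 -fb; apply: eq_bigr => i _; rewrite mulr1.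
    have := cab f h fl; rewrite !(bigD1_ord j) //= => cb.
    by rewrite fb fb1 addrC [RHS]addrC; exact: cb.
  - by exists f; split=> // i ij; apply: f0; exists (fun k => (k == i)%:R);
      rewrite (bigD1 i) //= eqxx scale1r big1 ?addr0 // => k /andP[_ /negPf->];
      rewrite scale0r.
have [f /all_and3[fl f1 f0]] := choice sep.
apply: (@finite_basis _ _ _ (fun k : 'I_m * 'I_m => a k.1 * b k.2)) => h.
exists (fun k => f k.2 (b k.1 * h)); rewrite -(pair_bigA _ (fun i j => f j (b i * h) *: (a i * b j))).
rewrite exchange_big /= -[LHS]mulr1 -ab1 mulr_sumr; apply: eq_bigr => j _.
under eq_bigr do rewrite scalerAl; rewrite -mulr_suml -cab // (bigD1 j) //= f1 scale1r.
rewrite big1 ?addr0 ?mulrA // => i ij; by rewrite f0 // scale0r.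
Qed.

End Integral.

(** * The trace form and the square of the antipode *)

Section Frobenius.
Variables (K : fieldType) (H : algType K) (A : hopf H).
Implicit Types (a b h : H) (W : lmodType K).

Local Notation S := (S A).
Local Notation eps := (eps A).
Local Notation sw := (sw (dl A)).
Local Notation "'\sw_' ( a , b <- h ) E" := (sw (fun a b => E) h)
  (at level 41, a name, b name, h at level 60, E at level 41, right associativity,
   format "'\sw_' ( a ,  b  <-  h )  E").

Variables (n : nat) (e : 'I_n -> H) (c : 'I_n -> H -> K^o).
Hypothesis B : is_basis e c.
Variable L : H.
Hypothesis hL : forall h, h * L = eps h *: L.
Hypothesis eL : eps L = 1.

Local Notation phi h := (S (S h)).
Local Notation tr := (tr e c).

Lemma eps_phi h : eps (phi h) = eps h.
Proof. by rewrite !eps_S. Qed.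

Lemma phi_lin : linear (fun h => phi h).
Proof. by []. Qed.

Lemma phiM a b : phi (a * b) = phi a * phi b.
Proof. by rewrite !SM. Qed.

(** For [phi = id] this is the trace form of the regular representation. *)
Definition lam h : K^o := tr (fun y => phi y * h).

Lemma lam_lin : linear lam.
Proof. by rewrite /lam; lin. Qed.

Lemma eq_functional (V : lmodType K) m (w : 'I_m -> V) d u v :
  is_basis w d -> (forall f : V -> K^o, linear f -> f u = f v) -> u = v.
Proof.
move=> Bw fE; rewrite (coordE Bw u) (coordE Bw v).
by apply: eq_bigr => i _; rewrite (fE (d i)) //; exact: coord_lin Bw i.
Qed.

(** Paired with a functional [f], the left-hand side is the trace of
    [y |-> f (h_2) phi(y) h_1], and [phi(y) h_1 (x) h_2] equals
    [(phi(y_1) h)_1 (x) S(y_2) (phi(y_1) h)_2].  Expanding [y_2] in the basis presents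
    this map as a sum of composites [N_j \o (fun y => phi (G_j y) * h)], and the sum of
    the [G_j \o N_j] is [f 1] times the identity; so the claim is the cyclicity of the
    trace. *)
Lemma lam_integral h : \sw_(a, b <- h) lam a *: b = lam h *: 1.
Proof.
apply: (eq_functional B) => f fl; rewrite sw_lin // linZ //.
under eq_sw => a b do rewrite linZ //.
have cl i : linear (c i) := coord_lin B i.
transitivity (tr (fun y => \sw_(a, b <- h) f b *: (phi y * a))).
  rewrite /lam tr_sum //; apply: eq_bigr => p _.
  by rewrite trZ // -[LHS]/(_ * _) mulrC.
pose G j y := \sw_(a, b <- y) c j b *: a.
pose N j z := \sw_(a, b <- z) f (S (e j) * b) *: a.
have GNl j : linear (G j) /\ linear (N j) by split; rewrite /G /N; lin.
transitivity (\sum_j tr (fun y => N j (phi (G j y) * h))).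
  rewrite -tr_sum //; apply: eq_tr => y.
  transitivity (\sw_(y1, y2 <- y) \sw_(a, b <- phi y1 * h) f (S y2 * b) *: a).
    under [RHS]eq_sw => y1 y2 do rewrite swM // swS // swS //.
    rewrite swA //.
    transitivity (\sw_(u, r <- y) \sw_(v, w <- r) \sw_(a, b <- h)
        f (S (S v * w) * b) *: (phi u * a)).
      rewrite (swA_Sl _ (G := fun u z => \sw_(a, b <- h) f (S z * b) *: (phi u * a))) //.
      by apply: eq_sw => a b; rewrite S1 mul1r.
    apply: eq_sw => u r; apply: eq_sw => v w; apply: eq_sw => a b.
    by rewrite SM mulrA.
  rewrite /N /G.
  transitivity (\sw_(y1, y2 <- y) \sum_j c j y2 *: \sw_(a, b <- phi y1 * h) f (S (e j) * b) *: a).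
    apply: eq_sw => y1 y2.
    by rewrite (coord_app B (g := fun z => \sw_(a, b <- phi y1 * h) f (S z * b) *: a)).
  rewrite sw_sum; apply: eq_bigr => j _.
  set gg := fun z => \sw_(a, b <- phi z * h) f (S (e j) * b) *: a.
  have ggl : linear gg by rewrite /gg; lin.
  rewrite -[RHS]/(gg (\sw_(a, b <- y) c j b *: a)) (sw_lin A (g := gg)) //.
  by apply: eq_sw => a b; rewrite (linZ (f := gg)).
transitivity (\sum_j tr (fun z => phi (G j (N j z)) * h)).
  apply: eq_bigr => j _; have [Gl Nl] := GNl j.
  by rewrite (tr_comp (f := fun y => phi (G j y) * h) (g := N j) B B).
have GN z : \sum_j G j (N j z) = f 1 *: z.
  transitivity (\sw_(a, b <- z) \sw_(a1, a2 <- a) f (S a2 * b) *: a1); last first.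
    by rewrite swA // (swA_Sl _ (G := fun x y => f y *: x)).
  transitivity (\sum_j \sw_(a, b <- z) \sw_(a1, a2 <- a) (c j a2 *: (f (S (e j) * b) *: a1))).
    apply: eq_bigr => j _; have [Gl Nl] := GNl j.
    rewrite -[LHS]/(G j (\sw_(a, b <- z) f (S (e j) * b) *: a)) (sw_lin A (g := G j)) //.
    apply: eq_sw => a b; rewrite (linZ (f := G j)) // /G.
    rewrite (sw_lin A (g := fun x => f (S (e j) * b) *: x)) //.
    by apply: eq_sw => a1 a2; rewrite !scalerA mulrC.
  rewrite -sw_sum; apply: eq_sw => a b; rewrite -sw_sum; apply: eq_sw => a1 a2.
  by rewrite [RHS](coord_app B (g := fun x => f (S x * b) *: a1)).
rewrite -tr_sum // /lam -[RHS]/(_ * _) [RHS]mulrC -[RHS]/(f 1 *: _) -trZ //.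
apply: eq_tr => z; rewrite -mulr_suml -!(lin_bigsum _ _ _ (S_lin A)) GN.
by rewrite !(linZ _ _ (S_lin A)) scalerAl.
Qed.
Lemma lamM a b : lam (a * b) = lam (phi b * a).
Proof.
rewrite /lam; transitivity (tr (fun y => (phi y * a) * b)).
  by apply: eq_tr => y; rewrite mulrA.
apply: etrans (tr_comp (f := fun y => phi y * a) (g := fun y => y * b) B B _ _) _ => //.
by apply: eq_tr => y; rewrite phiM mulrA.
Qed.

Lemma lamL : lam L = 1.
Proof.
transitivity (tr (fun y => eps y *: L)); last by rewrite (tr_rank1 B).
by apply: eq_tr => y; rewrite hL eps_phi.
Qed.

Lemma integral_S W (F : H -> H -> W) h :
  (forall y, linear (fun x => F x y)) -> (forall x, linear (fun y => F x y)) ->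
  \sw_(a, b <- L) F (S h * a) b = \sw_(a, b <- L) F a (h * b).
Proof.
move=> F1 F2.
transitivity (\sw_(x, r <- h) \sw_(y, z <- r) \sw_(a, b <- L) F (S x * (y * a)) (z * b)).
  transitivity (\sw_(x, r <- h) \sw_(a, b <- r * L) F (S x * a) b).
    under [RHS]eq_sw => x r do rewrite hL linZ //.
    by rewrite (sw_eps2 _ (G := fun x => \sw_(a, b <- L) F (S x * a) b)).
  apply: eq_sw => x r; rewrite swM //.
transitivity (\sw_(x, r <- h) \sw_(y, z <- r) \sw_(a, b <- L) F ((S x * y) * a) (z * b)).
  by do 3!(apply: eq_sw => ? ?); rewrite mulrA.
rewrite (sw_SlA _ (G := fun u z => \sw_(a, b <- L) F (u * a) (z * b))) //.
by apply: eq_sw => a b; rewrite mul1r.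
Qed.

(** [L] and [lam] are dual to each other: this identity exhibits [H] as a Frobenius
    algebra and makes [S] injective. *)
Lemma lam_reproduce h : \sw_(a, b <- L) lam (S h * a) *: b = h.
Proof.
have ll := lam_lin.
transitivity (h * \sw_(a, b <- L) lam a *: b).
  rewrite (integral_S (F := fun a b => lam a *: b)) // (sw_lin A (g := fun x => h * x)) //.
  by apply: eq_sw => a b; rewrite scalerAr.
by rewrite lam_integral lamL scale1r mulr1.
Qed.

Lemma S_inj h : S h = 0 -> h = 0.
Proof.
move=> S0; rewrite -[h]lam_reproduce S0; apply: big1 => p _.
by rewrite mul0r (lin0 lam_lin) scale0r.
Qed.

Lemma S_surj h : exists k, S k = h.
Proof. by apply: (lin_inj_surj B) => // v; exact: S_inj. Qed.

Lemma S_injective a b : S a = S b -> a = b.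
Proof.
by move=> ab; apply/eqP; rewrite -subr_eq0; apply/eqP/S_inj;
  rewrite (linB _ _ (S_lin A)) ab subrr.
Qed.

Lemma lam_nondegl z : (forall y, lam (z * y) = 0) -> z = 0.
Proof.
move=> z0; have [h hz] := S_surj z; rewrite -hz -[h]lam_reproduce.
rewrite [X in S X]big1 ?(lin0 (S_lin A)) // => p _; by rewrite hz z0 scale0r.
Qed.

Lemma lam_nondegr z : (forall y, lam (y * z) = 0) -> z = 0.
Proof.
move=> z0; do 2 apply: S_inj; apply: lam_nondegl => y.
by rewrite -lamM z0.
Qed.

Lemma integral_fixS : S L = L.
Proof.
have SLh h : S L * h = eps h *: S L.
  have [k <-] := S_surj h; rewrite -SM hL (linZ _ _ (S_lin A)).
  by rewrite eps_S.
by have := SLh L; rewrite hL eL scale1r => <-; rewrite eps_S eL scale1r.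
Qed.

Lemma integralr h : L * h = eps h *: L.
Proof.
rewrite -{1}integral_fixS; have [k <-] := S_surj h.
by rewrite -SM hL (linZ _ _ (S_lin A)) integral_fixS eps_S.
Qed.

Lemma lam_dual y : \sw_(a, b <- L) lam (S b * y) *: a = y.
Proof.
have ll := lam_lin.
apply/eqP; rewrite -subr_eq0; apply/eqP/lam_nondegr => z.
have [h <-] := S_surj z.
rewrite mulrBr (linB _ _ ll); apply/eqP; rewrite subr_eq0; apply/eqP.
rewrite (sw_lin A (g := fun x => lam (S h * x))) //.
rewrite -[in RHS](lam_reproduce h) (sw_lin A (g := fun x => lam (S x * y))) //.
apply: eq_sw => a b; rewrite (linZ _ _ (S_lin A)) -scalerAr -scalerAl.
by rewrite !(linZ _ _ ll) -[LHS]/(_ * _) mulrC.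
Qed.

(** Applying [k] to [lam_dual] turns the sum into [lam (S (k(L_1) L_2) y)]. *)
Lemma right_integral_uniq (k : H -> K^o) : linear k ->
  (forall h, \sw_(a, b <- h) k a *: b = k h *: 1) -> forall y, k y = k L * lam y.
Proof.
move=> kl kI y; have ll := lam_lin.
rewrite -[in LHS](lam_dual y) (sw_lin A (g := k)) //.
rewrite -[in RHS](mul1r y) -[RHS]/(k L *: lam (1 * y)).
rewrite -(linZ _ _ ll) scalerAl -[1](S1 A) -(linZ _ _ (S_lin A)) -kI.
rewrite (sw_lin A (g := fun x => lam (S x * y))) //; apply: eq_sw => a b.
by rewrite linZ // (linZ _ _ (S_lin A)) -scalerAl (linZ _ _ ll) -[LHS]/(_ * _) mulrC.
Qed.

(** The distinguished grouplike element: [lam] is a left integral up to it, by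
    [lam_dgl]. *)
Definition dgl : H := \sw_(a, b <- L) lam b *: a.

(** For every functional [f], the map [h |-> f(h_1) lam(h_2)] is an integral, hence a
    multiple of [lam]. *)
Lemma lam_dgl h : \sw_(a, b <- h) lam b *: a = lam h *: dgl.
Proof.
have ll := lam_lin; apply: (eq_functional B) => f fl; rewrite sw_lin // linZ //.
pose k h : K^o := \sw_(a, b <- h) f a * lam b.
have kl : linear k by rewrite /k; lin.
have kI x : \sw_(a, b <- x) k a *: b = k x *: 1.
  transitivity (\sw_(a, r <- x) \sw_(u, v <- r) (f a *: lam u) *: v).
    rewrite -swA //; apply: eq_sw => a b; rewrite /k.
    by rewrite (sw_lin A (g := fun z : K^o => z *: b)).
  under eq_sw => a r.
    under eq_sw => u v do rewrite -scalerA.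
    rewrite -(sw_lin A (g := fun z => f a *: z)) // lam_integral scalerA; over.
  by rewrite -(sw_lin A (g := fun z : K^o => z *: (1 : H))).
transitivity (k h); first by apply: eq_sw => a b; rewrite linZ // -[LHS]/(_ * _) mulrC.
rewrite (right_integral_uniq kl kI) mulrC -[LHS]/(lam h *: k L); congr (_ *: _).
rewrite /dgl (sw_lin A (g := f)) //; apply: eq_sw => a b.
by rewrite linZ // -[RHS]/(_ * _) mulrC.
Qed.

Lemma dgl_grouplike W (F : H -> H -> W) :
  (forall y, linear (fun x => F x y)) -> (forall x, linear (fun y => F x y)) ->
  sw F dgl = F dgl dgl.
Proof.
move=> F1 F2; have ll := lam_lin.
transitivity (\sw_(x, r <- L) \sw_(y, z <- r) lam z *: F x y).
  rewrite -swA // {1}/dgl (sw_lin A (g := sw F)) //; apply: eq_sw => a b.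
  by rewrite linZ // -(sw_lin A (g := fun x => lam b *: x)).
transitivity (\sw_(x, r <- L) F x (lam r *: dgl)).
  apply: eq_sw => x r; rewrite -lam_dgl (sw_lin A (g := F x)) //.
  by apply: eq_sw => a b; rewrite linZ.
rewrite [in RHS]/dgl (sw_lin A (g := fun x => F x dgl)) //.
by apply: eq_sw => a b; rewrite (linZ _ _ (F2 a)) (linZ _ _ (F1 dgl)).
Qed.

Lemma eps_dgl : eps dgl = 1.
Proof.
have ll := lam_lin; rewrite /dgl (sw_lin A (g := eps : H -> K^o)) //.
rewrite -[RHS]lamL -[in RHS](sw_eps1 A (G := lam)) //.
apply: eq_bigr => p _; by rewrite epsZ -[RHS]/(_ * _) mulrC.
Qed.

Lemma dgl_invl : S dgl * dgl = 1.
Proof.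
rewrite -(dgl_grouplike (F := fun a b => S a * b)) // antipode_l eps_dgl.
by rewrite scale1r.
Qed.

(** Both [lam (dgl * S x)] and [lam (phi x)] are integrals in [x] with value [1] at [L],
    hence equal; substitute [x] for a preimage of [h] under [S]. *)
Lemma lam_S h : lam (S h) = lam (dgl * h).
Proof.
have ll := lam_lin.
pose nu x : K^o := lam (dgl * S x); pose mu x : K^o := lam (phi x).
have nul : linear nu by rewrite /nu; lin.
have mul : linear mu by rewrite /mu; lin.
have nuI x : \sw_(a, b <- x) nu a *: b = nu x *: 1.
  apply: S_injective; rewrite (sw_lin A (g := S)) // (linZ _ _ (S_lin A)) S1.
  transitivity (S dgl * (nu x *: dgl)); last by rewrite -scalerAr dgl_invl.
  rewrite /nu -lam_dgl swM // dgl_grouplike //.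
  rewrite swS // (sw_lin A (g := fun y => S dgl * y)) //; apply: eq_sw => a b.
  by rewrite -scalerAr mulrA dgl_invl mul1r (linZ _ _ (S_lin A)).
have muI x : \sw_(a, b <- x) mu a *: b = mu x *: 1.
  do 2 apply: S_injective.
  rewrite !(sw_lin A (g := S)) // !(linZ _ _ (S_lin A)) !S1 -lam_integral !swS //.
  by apply: eq_sw => a b; rewrite !(linZ _ _ (S_lin A)).
have [k <-] := S_surj h.
rewrite -[LHS]/(mu k) -[RHS]/(nu k).
rewrite (right_integral_uniq mul muI) (right_integral_uniq nul nuI) /mu /nu.
by rewrite !integral_fixS lamL hL eps_dgl scale1r lamL.
Qed.

(** Test against [lam], using [lam_S] twice and the twisted symmetry [lamM]. *)
Lemma phi_phi a : phi (phi a) * dgl = dgl * a.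
Proof.
apply/eqP; rewrite -subr_eq0; apply/eqP/lam_nondegl => b; have ll := lam_lin.
rewrite mulrBl (linB _ _ ll); apply/eqP; rewrite subr_eq0; apply/eqP.
rewrite -[RHS](congr1 lam (mulrA _ _ _)) -lam_S SM lamM -SM lam_S.
by rewrite mulrA lamM mulrA.
Qed.

(** Evaluating [lam_dgl] at [1] shows that the distinguished grouplike is [1]. *)
Lemma phi_invol : lam 1 != 0 -> forall a, phi (phi a) = a.
Proof.
move=> l1 a; have ll := lam_lin.
have d1 : dgl = 1.
  have := lam_dgl 1; rewrite sw1 // => /(congr1 (fun x => (lam 1)^-1 *: x)).
  by rewrite !scalerA mulVf // !scale1r.
by have := phi_phi a; rewrite d1 mulr1 mul1r.
Qed.

Lemma lam1 : lam 1 = tr (fun y => phi y).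
Proof. by apply: eq_tr => y; rewrite mulr1. Qed.

End Frobenius.

(** * Grouplike elements *)

Section Grouplike.
Variables (K : fieldType) (H : algType K) (A : hopf H).
Implicit Types (a b h : H) (W : lmodType K).

Local Notation S := (S A).
Local Notation eps := (eps A).
Local Notation sw := (sw (dl A)).
Local Notation "'\sw_' ( a , b <- h ) E" := (sw (fun a b => E) h)
  (at level 41, a name, b name, h at level 60, E at level 41, right associativity,
   format "'\sw_' ( a ,  b  <-  h )  E").

Variables (n : nat) (e : 'I_n -> H) (c : 'I_n -> H -> K^o).
Hypothesis B : is_basis e c.

Lemma grouplike_exp (g : H) k :
  (forall W (F : H -> H -> W), (forall y, linear (fun x => F x y)) ->
     (forall x, linear (fun y => F x y)) -> sw F g = F g g) ->
  forall W (F : H -> H -> W), (forall y, linear (fun x => F x y)) ->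
     (forall x, linear (fun y => F x y)) -> sw F (g ^+ k) = F (g ^+ k) (g ^+ k).
Proof.
move=> gg; elim: k => [|k IHk] W F F1 F2; first by rewrite expr0 sw1.
by rewrite exprS swM // gg // IHk.
Qed.

Let dep (g : H) m := `[< exists a : nat -> K, g ^+ m = \sum_(i < m) a i *: g ^+ i >].

Let relation_dep g m (a : nat -> K) :
  \sum_(i < m) a i *: g ^+ i = 0 -> (forall j, (j < m)%N -> ~~ dep g j) ->
  forall i, (i < m)%N -> a i = 0.
Proof.
elim: m => // m IHm; rewrite big_ord_recr /= => a0 nd.
have am : a m = 0.
  apply/eqP/negPn/negP => am; have /negP := nd m (ltnSn m); apply; apply/asboolP.
  exists (fun i => - (a m)^-1 * a i).
  under eq_bigr do rewrite -scalerA.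
  rewrite -scaler_sumr; move/eqP: a0; rewrite addr_eq0 => /eqP->.
  by rewrite scaleNr scalerN opprK scalerA mulVf ?scale1r.
move=> i; rewrite ltnS leq_eqVlt => /orP[/eqP->//|im].
apply: IHm im => [|j jm]; first by move: a0; rewrite am scale0r addr0.
by apply: nd; rewrite ltnS ltnW.
Qed.

(** Let [g ^+ m] be the first power depending linearly on the previous ones.  Its
    coefficients satisfy [a_i a_j = (i == j) a_i] since it is grouplike, so it equals
    one of the previous powers, and [g] is invertible. *)
Lemma grouplike_order (g g' : H) : g' * g = 1 ->
  (forall W (F : H -> H -> W), (forall y, linear (fun x => F x y)) ->
     (forall x, linear (fun y => F x y)) -> sw F g = F g g) ->
  exists2 m, (0 < m)%N & g ^+ m = 1.
Proof.
move=> g'g gg.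
have gcan k : g' ^+ k * g ^+ k = 1.
  by elim: k => [|k IHk]; rewrite ?mul1r // exprSr exprS mulrA -(mulrA (g' ^+ k)) g'g mulr1.
have exdep : exists m, dep g m.
  apply: contrapT => nex; have nd j : ~~ dep g j by apply/negP => dj; apply: nex; exists j.
  pose M := \matrix_(i < n.+1) crd c (g ^+ i).
  have : (0 < \rank (kermx M))%N by rewrite mxrank_ker subn_gt0 ltnS rank_leq_col.
  rewrite lt0n mxrank_eq0 => /rowV0Pn[r /sub_kermxP rM /eqP[]].
  apply/rowP => i; rewrite mxE.
  have r0 : \sum_(j < n.+1) r 0 (inord j) *: g ^+ j = 0.
    rewrite (coordE B (\sum_(j < n.+1) _)) big1 // => k _.
    rewrite (lin_bigsum _ _ _ (coord_lin B k)).
    have := congr1 (fun N : 'rV_n => N 0 k) rM; rewrite !mxE => rMk.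
    rewrite -[X in X *: _]/(_ : K) (_ : \sum_(i < n.+1) _ = 0) ?scale0r // -[RHS]rMk.
    apply: eq_bigr => j _; rewrite (linZK _ _ (coord_lin B k)) !mxE inord_val.
    by rewrite mulrC.
  have := @relation_dep g n.+1 (fun j => r 0 (inord j)) r0 (fun j _ => nd j) i (ltn_ord i).
  by rewrite inord_val.
case: (ex_minnP exdep) => m /asboolP[a aE] mmin.
have nd j : (j < m)%N -> ~~ dep g j.
  by move=> jm; apply/negP => /mmin; rewrite leqNgt jm.
have sep (j : 'I_m) : exists f : H -> K^o, [/\ linear f, f (g ^+ j) = 1 &
    forall i : 'I_m, i != j -> f (g ^+ i) = 0].
  pose U x := exists c : 'I_m -> K, x = \sum_(i | i != j) c i *: g ^+ i.
  have [|||f [fl f1 f0]] := @functional_sep K H U (g ^+ j).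
  - by exists (fun => 0); rewrite big1 // => i _; rewrite scale0r.
  - move=> k x y [b ->] [d ->]; exists (fun i => k * b i + d i).
    under [RHS]eq_bigr do rewrite scalerDl -scalerA.
    by rewrite big_split scaler_sumr.
  - case=> b bj; pose b' k := if k == j :> nat then -1 else oapp b 0 (insub k).
    have b'0 : \sum_(i < m) b' i *: g ^+ i = 0.
      rewrite (bigD1 j) //= {1}/b' eqxx scaleN1r {1}bj addrC; apply/eqP.
      rewrite subr_eq0; apply/eqP; apply: eq_bigr => i ij.
      by rewrite /b' (negPf ij : (i == j :> nat) = false) valK.
    have /eqP := relation_dep b'0 nd (ltn_ord j).
    by rewrite /b' eqxx oppr_eq0 oner_eq0.
  - exists f; split=> // i ij; apply: f0; exists (fun k => (k == i)%:R).
    rewrite (bigD1 i) //= eqxx scale1r big1 ?addr0 // => k /andP[_ /negPf->].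
    by rewrite scale0r.
have [f /all_and3[fl f1 f0]] := choice sep.
have fE (i k : 'I_m) : f i (g ^+ k) = (k == i)%:R.
  by case: eqVneq => [->|/f0]; [exact: f1|].
have fm i : f i (g ^+ m) = a i.
  rewrite aE (lin_bigsum _ _ _ (fl i)) (bigD1 i) //= big1 => [|k ki].
    by rewrite (linZK _ _ (fl i)) fE eqxx mulr1 addr0.
  by rewrite (linZK _ _ (fl i)) fE (negPf ki) mulr0.
have aij (i j : 'I_m) : a i * a j = (i == j)%:R * a i.
  have /= := @grouplike_exp g m gg K^o (fun x y => f i x * f j y).
  rewrite !fm => <- //.
  have sl : linear (sw (fun x y => f i x * f j y : K^o)) by lin.
  rewrite {1}aE (lin_bigsum _ _ _ sl) (bigD1 i) //= big1 => [|k ki].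
    by rewrite (linZK _ _ sl) grouplike_exp // !fE eqxx mul1r addr0 mulrC.
  by rewrite (linZK _ _ sl) grouplike_exp // !fE (negPf ki) mul0r mulr0.
have [i ai] : exists i : 'I_m, a i != 0.
  apply: contrapT => na; have gm0 : g ^+ m = 0.
    rewrite aE big1 // => i _; suff -> : a i = 0 by rewrite scale0r.
    by apply/eqP/negPn/negP => ai; apply: na; exists i.
  by have /eqP := gcan m; rewrite gm0 mulr0 eq_sym oner_eq0.
have ai1 : a i = 1 by apply: (mulfI ai); rewrite aij eqxx mul1r mulr1.
have gmi : g ^+ m = g ^+ i.
  rewrite aE (bigD1 i) //= ai1 scale1r big1 ?addr0 // => k ki.
  have := aij i k; rewrite ai1 mul1r eq_sym (negPf ki) mul0r => ->.
  by rewrite scale0r.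
exists (m - i)%N; first by rewrite subn_gt0.
by rewrite -[LHS]mul1r -(gcan i) -mulrA -exprD subnKC ?gmi // ltnW.
Qed.

End Grouplike.

(** * Traces of automorphisms of finite order *)

Section Cyclotomic.
Import Order.TTheory Num.Theory.

(** The form is the sum over the classes of [R] of the squared modulus of the sum of
    [w] over the class; the class of [u0] is a singleton and contributes a positive
    term.  A sum over classes is written as a sum over all elements weighted by the
    inverse size [k u] of their class. *)
Lemma equivalence_form (T : finType) (R : rel T) (w : T -> algC) (u0 : T) :
  reflexive R -> symmetric R -> transitive R ->
  (forall s, R s u0 -> s = u0) -> w u0 != 0 ->
  \sum_s \sum_t (R s t)%:R * (w s * (w t)^*) != 0.
Proof.
move=> Rr Rs Rt Ru0 wu0.
pose k u := #|[pred s | R s u]|%:R : algC.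
have k0 u : k u != 0.
  by rewrite pnatr_eq0 -lt0n; apply/card_gt0P; exists u; rewrite inE.
have kE u v : R u v -> k u = k v.
  move=> uv; congr (_%:R); apply: eq_card => s; rewrite !inE.
  by apply/idP/idP => [/Rt->|/Rt->] //; rewrite Rs.
have -> : \sum_s \sum_t (R s t)%:R * (w s * (w t)^*) =
    \sum_u (k u)^-1 * `|\sum_(s | R s u) w s| ^+ 2.
  have rE u : (k u)^-1 * `|\sum_(s | R s u) w s| ^+ 2 =
      \sum_s \sum_t (R s u && R t u)%:R * ((k u)^-1 * (w s * (w t)^*)).
    rewrite normCK rmorph_sum big_distrlr mulr_sumr [LHS]big_mkcond.
    apply: eq_bigr => s _; case: (R s u); last by rewrite big1 // => t _; rewrite mul0r.
    rewrite mulr_sumr big_mkcond; apply: eq_bigr => t _.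
    by case: (R t u); rewrite ?mul1r ?mul0r.
  rewrite (eq_bigr _ (fun u _ => rE u)) [RHS]exchange_big; apply: eq_bigr => s _ /=.
  rewrite [RHS]exchange_big; apply: eq_bigr => t _ /=.
  transitivity (\sum_(u | R s u && R t u) (k u)^-1 * (w s * (w t)^*)); last first.
    by rewrite big_mkcond; apply: eq_bigr => u _; case: (_ && _); rewrite ?mul1r ?mul0r.
  rewrite -mulr_suml; congr (_ * _).
  have [st|nst] := boolP (R s t); last first.
    rewrite big_pred0 // => u; apply/negP => /andP[su tu]; move/negP: nst; apply.
    by apply: Rt su _; rewrite Rs.
  rewrite (eq_bigr (fun => (k s)^-1)) => [|u /andP[su _]]; last by rewrite (kE _ _ su).
  rewrite sumr_const -[LHS](mulVf (k0 s)) mulr_natr; congr (_ *+ _).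
  apply: eq_card => u; rewrite !inE; apply/idP/andP => [us|[]]; rewrite Rs //.
  by split=> //; rewrite Rs; apply: Rt us st.
rewrite gt_eqF // (bigD1 u0) //= ltr_pwDl //.
  rewrite (eq_bigl (pred1 u0)) ?big_pred1_eq => [|s]; last first.
    by apply/idP/eqP => [Rsu|->//]; exact: Ru0.
  by rewrite mulr_gt0 ?exprn_gt0 ?normr_gt0 // invr_gt0 lt_def k0 ler0n.
by apply: sumr_ge0 => u _; rewrite mulr_ge0 ?exprn_ge0 // invr_ge0 ler0n.
Qed.

(** If [q] were prime to ['X^N - 1] over the rationals, a Bezout relation with
    denominators cleared would contradict the common root in [K]; so there is a
    common factor, which has a root in [algC]. *)
Lemma root_of_unity_transfer (K : fieldType) (zeta : K) N (q : {poly int}) :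
  [pchar K] =i pred0 -> (0 < N)%N -> zeta ^+ N = 1 ->
  root (map_poly intr q) zeta ->
  exists2 z : algC, z ^+ N = 1 & root (map_poly intr q) z.
Proof.
move=> K0 N0 zN qz.
pose r : {poly int} := 'X^N - 1.
pose toQ (p : {poly int}) : {poly rat} := map_poly intr p.
have [cop|ncop] := boolP (coprimep (toQ q) (toQ r)).
  have /Bezout_eq1_coprimepP[[u v] /= uv] := cop.
  have [u' [a a0 uE]] := rat_poly_scale u.
  have [v' [b b0 vE]] := rat_poly_scale v.
  have uv' : (b *: u') * q + (a *: v') * r = (a * b)%:P.
    apply: (map_inj_poly (f := intr : int -> rat)) => //; first exact: intr_inj.
    rewrite rmorphD !rmorphM /= !map_polyZ -!/(toQ _) -/(toQ r).
    have uE' : toQ u' = a%:~R *: u by rewrite uE scalerA mulfV ?scale1r // intr_eq0.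
    have vE' : toQ v' = b%:~R *: v by rewrite vE scalerA mulfV ?scale1r // intr_eq0.
    rewrite uE' vE' !scalerA [b%:~R * _]mulrC -!scalerAl -scalerDr uv /toQ.
    by rewrite !map_polyC alg_polyC polyCM.
  have /(congr1 (fun p => (map_poly (intr : int -> K) p).[zeta])) := uv'.
  rewrite rmorphD !rmorphM /= hornerD !hornerM (rootP qz) mulr0 add0r.
  rewrite [X in _ * X.[_]](_ : _ = 'X^N - 1); last first.
    by rewrite rmorphB /= map_polyXn rmorph1.
  rewrite !map_polyC /= !hornerE zN subrr mulr0 => /esym/eqP.
  have intK0 (m : int) : m != 0 -> m%:~R != 0 :> K.
    have nK := (pcharf0P K).1 K0.
    case: m => m m0; first by rewrite -[m%:~R]/(m%:R) nK.
    by rewrite NegzE mulrNz oppr_eq0 -pmulrn nK.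
  by rewrite mulf_eq0 !(negPf (intK0 _ _)).
pose g := gcdp (toQ q) (toQ r).
have : size (map_poly (ratr : rat -> algC) g) != 1%N by rewrite size_map_poly.
case/closed_rootP => z; rewrite gcdp_map root_gcd => /andP[z1 z2].
have toC p : map_poly (ratr : rat -> algC) (toQ p) = map_poly intr p.
  by rewrite /toQ -map_poly_comp; apply: eq_map_poly => m /=; rewrite ratr_int.
exists z; last by rewrite -toC.
move: z2; rewrite toC rmorphB /= map_polyXn rmorph1 => /rootP.
by rewrite !hornerE => /eqP; rewrite subr_eq0 => /eqP.
Qed.

End Cyclotomic.

Section TwistedTrace.
Import Order.TTheory Num.Theory.
Variables (K : closedFieldType) (H : algType K).
Hypothesis K0 : [pchar K] =i pred0.
Variables (n : nat) (e : 'I_n -> H) (c : 'I_n -> H -> K^o).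
Hypothesis B : is_basis e c.
Hypothesis ss : semisimple_algebra H.
Variables (phi : H -> H) (N : nat).
Hypothesis phi_lin : linear phi.
Hypothesis phiM : {morph phi : a b / a * b}.
Hypothesis phi1 : phi 1 = 1.
Hypothesis N_gt0 : (0 < N)%N.
Hypothesis phiN : forall h, iter N phi h = h.

Let nK k : (k%:R == 0 :> K) = (k == 0)%N := (pcharf0P K).1 K0 k.

Let itM k : {morph iter k phi : a b / a * b}.
Proof. by elim: k => // k IHk a b; rewrite !iterS IHk phiM. Qed.

Let itl k : linear (iter k phi).
Proof. by elim: k => // k IHk a x y; rewrite !iterS IHk phi_lin. Qed.

Let it_fix k h : phi h = h -> iter k phi h = h.
Proof. by move=> hh; elim: k => //= k ->. Qed.

Let itZ k x a : phi x = a *: x -> iter k phi x = a ^+ k *: x.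
Proof.
move=> px; elim: k => [|k IHk]; first by rewrite expr0 scale1r.
by rewrite iterS IHk (linZ _ _ phi_lin) px scalerA exprSr.
Qed.

(** Up to inversion of [a], the projection to an eigenspace of [phi]. *)
Let avg a h := N%:R^-1 *: \sum_(k < N) a ^+ k *: iter k phi h.

Let avg_shift a h : a ^+ N = 1 -> a *: phi (avg a h) = avg a h.
Proof.
move=> aN; rewrite /avg (linZ _ _ phi_lin) scalerA mulrC -scalerA; congr (_ *: _).
rewrite (lin_bigsum _ _ _ phi_lin) scaler_sumr.
have -> : \sum_(k < N) a *: phi (a ^+ k *: iter k phi h) =
    \sum_(k < N) a ^+ k.+1 *: iter k.+1 phi h.
  by apply: eq_bigr => k _; rewrite (linZ _ _ phi_lin) scalerA exprS.
case: N N_gt0 aN phiN => // m _ aN phiN'.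
by rewrite big_ord_recr [RHS]big_ord_recl /= addrC -iterS phiN' aN expr0.
Qed.

Let avg_const a h x : (forall k, a ^+ k *: iter k phi h = x) -> avg a h = x.
Proof.
move=> hx; rewrite /avg (eq_bigr (fun => x)) // sumr_const card_ord -scaler_nat.
by rewrite scalerA mulVf ?scale1r // nK -lt0n.
Qed.

(** A semisimple complement provides an idempotent generator of the left ideal [M];
    its average over the powers of [phi] is still one. *)
Lemma fixed_idempotent (M : {pred H}) :
  0 \in M -> (forall a x y, x \in M -> y \in M -> a * x + y \in M) ->
  (forall x, x \in M -> phi x \in M) ->
  exists q, [/\ q \in M, phi q = q & forall y, y \in M -> y * q = y].
Proof.
move=> M0 MD Mphi; have [M' [[M'0 M'D] MM0 MMD]] := @ss M (conj M0 MD).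
have [p [p' [Mp Mp' E1]]] := MMD 1.
have Mmul x y : y \in M -> x * y \in M.
  by move=> My; rewrite -[x * y]addr0; exact: MD.
have yp y : y \in M -> y * p = y.
  move=> My; have : y - y * p = 0.
    apply: MM0; first by rewrite addrC -mulNr; apply: MD.
    rewrite -[y in y - _]mulr1 -mulrBr E1 addrC addKr -[_ * _]addr0.
    exact: M'D.
  by move/eqP; rewrite subr_eq0 => /eqP<-.
have Mit k x : x \in M -> iter k phi x \in M.
  by move=> Mx; elim: k => //= k; exact: Mphi.
have Mavg x : x \in M -> avg 1 x \in M.
  move=> Mx; rewrite /avg -mulr_algl; apply: Mmul.
  by elim/big_rec: _ => // k y _ My; rewrite -mulr_algl; apply: MD => //; exact: Mit.
exists (avg 1 p); split; first exact: Mavg.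
  by rewrite -[LHS]scale1r; apply: avg_shift; rewrite expr1n.
move=> y My; rewrite /avg -scalerAr mulr_sumr.
rewrite (eq_bigr (fun => y)) => [|k _].
  by rewrite sumr_const card_ord -scaler_nat scalerA mulVf ?scale1r // nK -lt0n.
have <- : iter k phi (iter (N - k) phi y) = y by rewrite -iterD subnKC ?phiN // ltnW.
by rewrite expr1n scale1r -itM yp // Mit.
Qed.

Let orth_idem r (p : 'I_r -> H) :=
  [/\ forall i, p i != 0, forall i, phi (p i) = p i,
      forall i j, p i * p j = (i == j)%:R *: p i & \sum_i p i = 1].

Let orth_bound r (p : 'I_r -> H) : orth_idem p -> (r <= n)%N.
Proof.
case=> p0 _ pp _; pose M := \matrix_(i < r) crd c (p i).
suff : row_free M by rewrite -row_leq_rank => /leq_trans; apply; exact: rank_leq_col.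
apply/inj_row_free => v vM; apply/rowP => j; rewrite mxE.
have v0 : \sum_i v 0 i *: p i = 0.
  rewrite (coordE B (\sum_i _)) big1 // => k _.
  suff -> : c k (\sum_i v 0 i *: p i) = 0 by rewrite scale0r.
  have := congr1 (fun u : 'rV_n => u 0 k) vM; rewrite !mxE => <-.
  rewrite (lin_bigsum _ _ _ (coord_lin B k)); apply: eq_bigr => i _.
  by rewrite (linZK _ _ (coord_lin B k)) !mxE.
have := congr1 (fun x => x * p j) v0; rewrite mul0r mulr_suml (bigD1 j) //= big1.
  rewrite addr0 -scalerAl pp eqxx scale1r => /eqP.
  by rewrite scaler_eq0 (negPf (p0 j)) orbF => /eqP.
by move=> i ij; rewrite -scalerAl pp (negPf ij) scale0r scaler0.
Qed.

(** Take a decomposition of [1] with the greatest number of terms. *)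
Lemma primitive_decomposition : exists r (p : 'I_r -> H), orth_idem p /\
  forall i q, phi q = q -> q * q = q -> p i * q = q -> q * p i = q ->
  q = 0 \/ q = p i.
Proof.
pose P r := `[< exists p : 'I_r -> H, orth_idem p >].
have exP : exists r, P r.
  exists 1%N; apply/asboolP; exists (fun => 1); split=> //.
  - by move=> _; exact: oner_neq0.
  - by move=> i j; rewrite !ord1 eqxx scale1r mulr1.
  - by rewrite big_ord1.
have Pb r : P r -> (r <= n)%N by move=> /asboolP[p]; exact: orth_bound.
case: (ex_maxnP exP Pb) => r /asboolP[p [p0 pphi pp psum]] rmax.
exists r, p; split=> // i q qphi qq piq qpi.
apply: contrapT => /not_orP[/eqP q0 /eqP qp].
have pq j : j != i -> p j * q = 0 /\ q * p j = 0.
  move=> ji; rewrite -piq mulrA pp (negPf ji) scale0r mul0r; split=> //.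
  by rewrite piq -qpi -mulrA pp eq_sym (negPf ji) scale0r mulr0.
suff : P r.+1 by move/rmax; rewrite ltnn.
apply/asboolP; pose p' (k : 'I_r.+1) :=
  if unlift ord_max k is Some j then if j == i then q else p j else p i - q.
have p'l (j : 'I_r) : p' (lift ord_max j) = if j == i then q else p j.
  by rewrite /p' liftK.
have p'm : p' ord_max = p i - q by rewrite /p' unlift_none.
have pii : p i * p i = p i by rewrite pp eqxx scale1r.
exists p'; split=> [k|k|k l|].
- case: (unliftP ord_max k) => [j ->|->]; rewrite ?p'l ?p'm.
    by case: ifP.
  by rewrite subr_eq0 eq_sym.
- case: (unliftP ord_max k) => [j ->|->]; rewrite ?p'l ?p'm.
    by case: ifP.
  by rewrite (linB _ _ phi_lin) pphi qphi.
- case: (unliftP ord_max k) => [j ->|->]; case: (unliftP ord_max l) => [j' ->|->];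
    rewrite ?p'l ?p'm ?(inj_eq (@lift_inj _ _)) ?(negPf (neq_lift _ _)) ?[lift _ _ == _]eq_sym
      ?(negPf (neq_lift _ _)) ?eqxx ?scale0r ?scale1r.
  + have [jE|ji] := eqVneq j i; have [j'E|j'i] := eqVneq j' i.
    * by rewrite jE j'E eqxx scale1r.
    * by rewrite jE eq_sym (negPf j'i) scale0r; case: (pq _ j'i).
    * by rewrite j'E (negPf ji) scale0r; case: (pq _ ji).
    * exact: pp.
  + have [_|ji] := eqVneq j i; first by rewrite mulrBr qpi qq subrr.
    by rewrite mulrBr pp (negPf ji) scale0r (pq _ ji).1 subrr.
  + have [_|ji] := eqVneq j' i; first by rewrite mulrBl piq qq subrr.
    by rewrite mulrBl pp eq_sym (negPf ji) scale0r (pq _ ji).2 subrr.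
  + by rewrite mulrBl !mulrBr pii piq qpi qq subrr subr0.
- rewrite big_ord_recr /= -/(ord_max) p'm -[RHS]psum.
  have -> : \sum_(k < r) p' (widen_ord (leqnSn r) k) = \sum_k (if k == i then q else p k).
    apply: eq_bigr => k _; rewrite -p'l; congr (p' _); apply: val_inj => /=.
    by rewrite /bump leqNgt ltn_ord.
  rewrite (bigD1 i) //= eqxx [RHS](bigD1 i) //= addrAC addrCA subrr addr0.
  by congr (_ + _); apply: eq_bigr => k /negPf->.
Qed.

Section Blocks.
Variables (r : nat) (p : 'I_r -> H).
Hypothesis p_orth : orth_idem p.
Hypothesis p_prim : forall i q, phi q = q -> q * q = q -> p i * q = q ->
  q * p i = q -> q = 0 \/ q = p i.

Let p0 i : p i != 0. Proof. by have [] := p_orth. Qed.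
Let pphi i : phi (p i) = p i. Proof. by have [] := p_orth. Qed.
Let pii i : p i * p i = p i. Proof. by have [_ _ -> _] := p_orth; rewrite eqxx scale1r. Qed.

(** Schur's lemma for the Peirce components: the left ideal generated by [x] has a
    [phi]-fixed idempotent generator, which primitivity of [p j] controls. *)
Lemma peirce_inv i j x a : p i * x * p j = x -> phi x = a *: x -> x != 0 ->
  exists y, [/\ p j * y * p i = y, a *: phi y = y, x * y = p i & y * x = p j].
Proof.
move=> pxp px x0.
have pix : p i * x = x by rewrite -pxp !mulrA pii.
have xpj : x * p j = x by rewrite -pxp -!mulrA pii.
have aN : a ^+ N = 1.
  have := itZ N px; rewrite phiN => /eqP; rewrite -[x in x == _]scale1r -subr_eq0 -scalerBl.
  by rewrite scaler_eq0 (negPf x0) orbF subr_eq0 eq_sym => /eqP.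
pose M : {pred H} := fun h => `[< exists z, h = z * x >].
have [|b u v /asboolP[z ->] /asboolP[w ->]|u /asboolP[z ->]|q [/asboolP[z qz] qphi qM]] :=
    @fixed_idempotent M.
- by apply/asboolP; exists 0; rewrite mul0r.
- by apply/asboolP; exists (b * z + w); rewrite mulrDl mulrA.
- by apply/asboolP; exists (a *: phi z); rewrite phiM px -scalerAr -scalerAl.
have Mx : x \in M by apply/asboolP; exists 1; rewrite mul1r.
have qq : q * q = q by apply: qM; apply/asboolP; exists z.
have qpj : q * p j = q by rewrite qz -mulrA xpj.
have [||||q0|pjq] := p_prim (i := j) (q := p j * q).
- by rewrite phiM pphi qphi.
- by rewrite mulrA -(mulrA (p j)) qpj -mulrA qq.
- by rewrite mulrA pii.
- by rewrite -mulrA qpj.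
- by case/eqP: x0; rewrite -(qM x Mx) -xpj -mulrA q0 mulr0.
pose y0 := p j * z * p i.
have y0x : y0 * x = p j by rewrite /y0 -!mulrA pix -qz pjq.
have aphi k : a ^+ k *: iter k phi y0 * x = p j.
  by rewrite -scalerAl scalerAr -itZ // -itM y0x it_fix.
pose y := avg a y0.
have yx : y * x = p j.
  rewrite /y /avg -scalerAl mulr_suml (eq_bigr (fun => p j)) // sumr_const card_ord.
  by rewrite -scaler_nat scalerA mulVf ?scale1r // nK -lt0n.
have pyp : p j * y * p i = y.
  rewrite /y /avg -scalerAr -scalerAl mulr_sumr mulr_suml; congr (_ *: _).
  apply: eq_bigr => k _; rewrite -scalerAr -scalerAl; congr (_ *: _).
  rewrite -(it_fix k (pphi j)) -(it_fix k (pphi i)) -!itM /y0 !mulrA pii.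
  by rewrite -!mulrA pii.
have ay : a *: phi y = y by exact: avg_shift.
exists y; split=> //.
have piy : y * p i = y by rewrite -pyp -!mulrA pii.
have [||||xy0|//] := p_prim (i := i) (q := x * y).
- by rewrite phiM px -scalerAl scalerAr ay.
- by rewrite mulrA -(mulrA x) yx xpj.
- by rewrite mulrA pix.
- by rewrite -mulrA piy.
- by case/eqP: x0; rewrite -xpj -yx mulrA xy0 mul0r.
Qed.

(** A polynomial killing [z] splits over [K], and by [peirce_inv] each factor [z - a] is
    invertible in the component unless [z = a *: p i]. *)
Lemma peirce_scalar i z : p i * z * p i = z -> phi z = z -> exists a, z = a *: p i.
Proof.
move=> pzp pz.
have piz : p i * z = z by rewrite -pzp !mulrA pii.
have zpi : z * p i = z by rewrite -pzp -!mulrA pii.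
pose M := \matrix_(k < n.+1) crd c (z ^+ k).
have : (0 < \rank (kermx M))%N by rewrite mxrank_ker subn_gt0 ltnS rank_leq_col.
rewrite lt0n mxrank_eq0 => /rowV0Pn[v /sub_kermxP vM v0].
pose P : {poly K} := \poly_(k < n.+1) v 0 (inord k).
have hv : horner_alg z P = 0.
  rewrite /P poly_def rmorph_sum /= (coordE B (\sum_(k < _) _)) big1 // => k _.
  rewrite (lin_bigsum _ _ _ (coord_lin B k)).
  have := congr1 (fun u : 'rV_n => u 0 k) vM; rewrite !mxE => vMk.
  rewrite (_ : \sum_(i < _) _ = 0) ?scale0r // -[RHS]vMk; apply: eq_bigr => j _.
  rewrite linearZ /= rmorphXn /= horner_algX inord_val mulr_algl.
  by rewrite (linZK _ _ (coord_lin B k)) !mxE.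
have rv0 : P != 0.
  apply: contraNneq v0 => P0; apply/eqP/rowP => j; rewrite mxE.
  by have := coef_poly n.+1 (fun k => v 0 (inord k)) j; rewrite -/P P0 coef0 ltn_ord inord_val.
have [s sE] := closed_field_poly_normal P.
move: hv; rewrite sE linearZ /= rmorph_prod mulr_algl => /eqP.
rewrite scaler_eq0 lead_coef_eq0 (negPf rv0) /= => /eqP hs.
apply: contrapT => nz.
have step a u : p i * u = u -> (z - a%:A) * u = 0 -> u = 0.
  move=> piu zu; have za0 : z - a *: p i != 0.
    by apply/eqP => za; apply: nz; exists a; apply/eqP; rewrite -subr_eq0 za.
  have [|||y [_ _ _ yz]] := @peirce_inv i i (z - a *: p i) 1.
  - by rewrite mulrBr mulrBl pzp -scalerAr -scalerAl !pii.
  - by rewrite (linB _ _ phi_lin) (linZ _ _ phi_lin) pz pphi scale1r.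
  - by [].
  rewrite -piu -yz -mulrA -[u in X in _ * X]piu.
  rewrite (_ : (z - a *: p i) * (p i * u) = (z - a%:A) * u); first by rewrite zu mulr0.
  by rewrite mulrBl mulrA zpi -scalerAl mulrA pii piu mulrBl mulr_algl.
have {}hs : \prod_(a <- s) (z - a%:A) = 0.
  by rewrite -hs; apply: eq_bigr => a _; rewrite rmorphB /= horner_algX horner_algC.
have pc s' : p i * (\prod_(a <- s') (z - a%:A) * p i) = \prod_(a <- s') (z - a%:A) * p i.
  elim: s' => [|a s' IHs]; first by rewrite big_nil mul1r pii.
  rewrite big_cons -mulrA mulrA mulrBr piz -{1}zpi mulr_algr -[a *: p i]mulr_algl -mulrBl.
  by rewrite -mulrA IHs.
have : \prod_(a <- s) (z - a%:A) * p i = 0 by rewrite hs mul0r.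
elim: s {sE hs} => [|a s IHs]; first by rewrite big_nil mul1r; apply/eqP.
by rewrite big_cons -mulrA => /step; rewrite pc => /(_ erefl)/IHs.
Qed.

Lemma peirce_unique i j x x' a : p i * x * p j = x -> phi x = a *: x -> x != 0 ->
  p i * x' * p j = x' -> phi x' = a *: x' -> exists b, x' = b *: x.
Proof.
move=> pxp px x0 pxp' px'; have [y [pyp ay xy yx]] := peirce_inv pxp px x0.
have pix' : p i * x' = x' by rewrite -pxp' !mulrA pii.
have ypi : y * p i = y by rewrite -pyp -!mulrA pii.
have [||b bE] := @peirce_scalar i (x' * y).
- by rewrite mulrA pix' -mulrA ypi.
- by rewrite phiM px' -scalerAl scalerAr ay.
exists b; rewrite -(_ : x' * p j = x'); last by rewrite -pxp' -!mulrA pii.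
rewrite -yx mulrA bE -scalerAl; congr (_ *: _).
by rewrite -pxp !mulrA pii.
Qed.

Variable zeta : K.
Hypothesis zeta_prim : N.-primitive_root zeta.

Let zN : zeta ^+ N = 1. Proof. exact: prim_expr_order. Qed.
Let zi := zeta ^+ N.-1.
Let ziz k : zi ^+ k * zeta ^+ k = 1.
Proof. by rewrite -exprMn /zi -exprSr prednK // zN expr1n. Qed.

Let ziN : zi ^+ N = 1. Proof. by rewrite /zi exprAC zN expr1n. Qed.

Definition peirce_eigen i j k (x : H) :=
  [/\ x != 0, p i * x * p j = x & phi x = zeta ^+ k *: x].
(** Whether [zeta ^+ k] is an eigenvalue of [phi] on the component [p i * H * p j]; by
    [peirce_unique] its multiplicity is then [1]. *)
Definition pE i j k : bool := `[< exists x, peirce_eigen i j k x >].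

Let proj i j k h := avg (zi ^+ k) (p i * h * p j).

Let proj_sum h : \sum_i \sum_j \sum_(k < N) proj i j k h = h.
Proof.
have geom x : \sum_(k < N) avg (zi ^+ k) x = x.
  rewrite /avg -scaler_sumr exchange_big /=.
  transitivity (N%:R^-1 *: (N%:R *: x)); last by rewrite scalerA mulVf ?scale1r // nK -lt0n.
  congr (_ *: _); rewrite (bigD1 (Ordinal N_gt0)) //= (eq_bigr (fun => x)) => [|k _]; last first.
    by rewrite expr0 scale1r.
  rewrite sumr_const card_ord -scaler_nat big1 ?addr0 // => l l0.
  rewrite -scaler_suml (_ : \sum_(k < _) _ = 0) ?scale0r //.
  have w1 : zi ^+ l - 1 != 0.
    rewrite subr_eq0; apply/eqP => w1; have := ziz l; rewrite w1 mul1r => /eqP.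
    rewrite -(prim_order_dvd zeta_prim) => /dvdn_leq; rewrite lt0n => /(_ l0).
    by rewrite leqNgt ltn_ord.
  apply: (mulfI w1); rewrite mulr0.
  rewrite (eq_bigr (fun k : 'I_N => (zi ^+ l) ^+ k)) => [|k _]; last exact: exprAC.
  by rewrite -subrX1 exprAC ziN expr1n subrr.
have [_ _ _ ps] := p_orth.
under eq_bigr do under eq_bigr do rewrite geom -mulrA.
under eq_bigr do rewrite -mulr_sumr -mulr_sumr ps mulr1.
by rewrite -mulr_suml ps mul1r.
Qed.

Let proj_lin i j k : linear (proj i j k).
Proof.
rewrite /proj /avg; apply: lin_scaler; apply: lin_sum => l; apply: lin_scaler.
by apply: lin_comp => //; lin.
Qed.

Let projP i j k h : p i * proj i j k h * p j = proj i j k h /\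
  phi (proj i j k h) = zeta ^+ k *: proj i j k h.
Proof.
split.
  rewrite /proj /avg -scalerAr -scalerAl mulr_sumr mulr_suml; congr (_ *: _).
  apply: eq_bigr => l _; rewrite -scalerAr -scalerAl; congr (_ *: _).
  rewrite -{1}(it_fix l (pphi i)) -{2}(it_fix l (pphi j)) -!itM !mulrA pii.
  by rewrite -!mulrA pii.
have aN : (zi ^+ k) ^+ N = 1 by rewrite exprAC ziN expr1n.
by rewrite /proj -{2}(avg_shift _ aN) scalerA mulrC ziz scale1r.
Qed.

Let proj_id i j k x : peirce_eigen i j k x -> proj i j k x = x.
Proof.
case=> x0 pxp px; rewrite /proj pxp; apply: avg_const => l.
by rewrite (itZ l px) scalerA -exprMn ziz expr1n scale1r.
Qed.

(** [H] is the direct sum of the eigenspaces of [phi] on the Peirce components, each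
    of dimension at most [1]. *)
Lemma trace_phi : tr e c phi = \sum_i \sum_j \sum_(k < N) (pE i j k)%:R * zeta ^+ k.
Proof.
have data (t : 'I_r * 'I_r * 'I_N) : exists wl : H * (H -> K^o),
    [/\ linear wl.2, forall h, proj t.1.1 t.1.2 t.2 h = wl.2 h *: wl.1 &
      wl.2 (phi wl.1) = (pE t.1.1 t.1.2 t.2)%:R * zeta ^+ t.2].
  case: t => [[i j] k] /=; rewrite /pE; case: asboolP => [[x Ex]|nE]; last first.
    exists (0, fun => 0); split=> [a u v|h|] /=; rewrite ?mul0r ?scaler0 ?addr0 //.
    apply/eqP/negPn/negP => ph0; apply: nE; exists (proj i j k h).
    by have [? ?] := projP i j k h.
  have [x0 pxp px] := Ex.
  have [i0 ci0] : exists i0, c i0 x != 0.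
    apply: contrapT => nc; case/eqP: x0; rewrite (coordE B x) big1 // => m _.
    by have [->|cm] := eqVneq (c m x) 0; [rewrite scale0r|case: nc; exists m].
  exists (x, fun h => (c i0 x)^-1 *: c i0 (proj i j k h)); split => /=.
  - have pl := proj_lin i j k; have cl := coord_lin B i0; lin.
  - move=> h; have [pp ph] := projP i j k h.
    have [b bE] := peirce_unique pxp px x0 pp ph.
    rewrite bE (linZ _ _ (coord_lin B i0)) -[_ *: (_ *: _)]/(_ * (_ * _)).
    by rewrite mulrCA mulVf ?mulr1.
  - rewrite px (linZ _ _ (proj_lin i j k)) (proj_id Ex) (linZ _ _ (coord_lin B i0)).
    by rewrite -[LHS]/(_ * (_ * _)) mulrCA mulVf // mulr1 mul1r.
have [wl /all_and3[ll lE lw]] := choice data.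
rewrite (tr_frame B (w := fun t => (wl t).1) (l := fun t => (wl t).2)) //.
  rewrite (eq_bigr _ (fun t _ => lw t)) -(pair_bigA _ (fun (ij : 'I_r * 'I_r) (k : 'I_N) => (pE ij.1 ij.2 k)%:R * zeta ^+ k)).
  by rewrite -(pair_bigA _ (fun i j => \sum_(k < N) (pE i j k)%:R * zeta ^+ k)).
move=> h; rewrite -[LHS]proj_sum [RHS](eq_bigr _ (fun t _ => esym (lE t h))).
rewrite -(pair_bigA _ (fun (ij : 'I_r * 'I_r) (k : 'I_N) => proj ij.1 ij.2 k h)) /=.
by rewrite -(pair_bigA _ (fun i j => \sum_(k < N) proj i j k h)).
Qed.
Let pE_per i j k : pE i j (k + N) = pE i j k.
Proof. by rewrite /pE /peirce_eigen exprD zN mulr1. Qed.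

(** [(i, k)] and [(j, l)] are related when [zeta ^+ (k - l)] is an eigenvalue of [phi] on
    [p i * H * p j].  This is an equivalence relation because nonzero Peirce
    eigenvectors are invertible. *)
Let R (s t : 'I_r * 'I_N) := pE s.1 t.1 (s.2 + (N - t.2)).

Let R_refl : reflexive R.
Proof.
case=> i k; apply/asboolP; exists (p i); split; rewrite ?pii //=.
by rewrite subnKC 1?ltnW // zN scale1r pphi.
Qed.

Let R_sym : symmetric R.
Proof.
suff Rs s t : R s t -> R t s by move=> s t; apply/idP/idP; exact: Rs.
case: s t => [i k] [j l] /asboolP[x [x0 pxp px]].
have [y [pyp ay xy yx]] := peirce_inv pxp px x0.
apply/asboolP; exists y; split=> //=.
  by apply: contraNneq (p0 i) => y0; rewrite -xy y0 mulr0.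
rewrite -{2}ay scalerA -exprD /= (_ : (_ + _)%N = N + N)%N ?exprD ?zN ?mul1r ?scale1r //.
rewrite addnACA [(l + _)%N]addnC.
by rewrite addnACA !subnKC // ltnW.
Qed.

Let R_trans : transitive R.
Proof.
move=> [j l] [i k] [j' m] /asboolP[x [x0 pxp px]] /asboolP[x' [x'0 pxp' px']].
rewrite /= in pxp px pxp' px'.
have [y [_ _ _ yx]] := peirce_inv pxp px x0.
have pix : p i * x = x by rewrite -pxp !mulrA pii.
have x'p : x' * p j' = x' by rewrite -pxp' -!mulrA pii.
have jx' : p j * x' = x' by rewrite -pxp' !mulrA pii.
apply/asboolP; exists (x * x'); split => /=.
- by apply: contraNneq x'0 => xx0; rewrite -jx' -yx -mulrA xx0 mulr0.
- by rewrite mulrA pix -mulrA x'p.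
- rewrite phiM px px' -scalerAl -scalerAr scalerA -exprD; congr (_ *: _).
  rewrite (_ : (_ + _)%N = (k + (N - m)) + (N - l + l))%N.
    by rewrite exprD subnK ?zN ?mulr1 // ltnW.
  by rewrite [(l + _)%N]addnC addnACA.
Qed.

Variables (ep : H -> K) (L : H).
Hypothesis ep_lin : linear (ep : H -> K^o).
Hypothesis ep1 : ep 1 = 1.
Hypothesis epM : {morph ep : a b / a * b}.
Hypothesis ep_phi : forall h, ep (phi h) = ep h.
Hypothesis hL : forall h, h * L = ep h *: L.
Hypothesis Lh : forall h, L * h = ep h *: L.
Hypothesis epL : ep L = 1.

Let L0 : L != 0.
Proof.
apply/eqP => L0; have := epL; rewrite L0 (lin0 ep_lin) => /eqP.
by rewrite eq_sym oner_eq0.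
Qed.

Let phiL : phi L = L.
Proof.
have <- : phi L * L = phi L.
  have phiLh h : phi L * phi h = ep (phi h) *: phi L.
    by rewrite -phiM Lh (linZ _ _ phi_lin) ep_phi.
  have := phiLh (iter N.-1 phi L); rewrite -iterS prednK // phiN epL scale1r //.
by rewrite hL ep_phi epL scale1r.
Qed.

(** The block of the integral is one-dimensional, so its class in [R] is a singleton. *)
Let L_block : exists i, p i = L.
Proof.
have [_ _ _ ps] := p_orth.
have [i epi] : exists i, ep (p i) != 0.
  apply: contrapT => nep; have /eqP := ep1.
  rewrite -ps (lin_bigsum _ _ _ ep_lin) big1 ?(eq_sym 0) ?oner_eq0 // => i _.
  by apply/eqP/negPn/negP => epi; apply: nep; exists i.
have epi1 : ep (p i) = 1 by apply: (mulfI epi); rewrite -epM pii mulr1.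
exists i; have [|||| Lz|->//] := p_prim (i := i) (q := L) => //.
- by rewrite hL epL scale1r.
- by rewrite hL epi1 scale1r.
- by rewrite Lh epi1 scale1r.
- by case/eqP: L0.
Qed.

Let R_L i0 s : p i0 = L -> R s (i0, Ordinal N_gt0) -> s = (i0, Ordinal N_gt0).
Proof.
move=> pi0; case: s => [i k] /asboolP[x /= [x0 pxp]].
have xE : x = ep (p i * x) *: L by rewrite -hL -pi0.
have eip : p i = p i0.
  have [_ _ pp _] := p_orth.
  have := pp i i0; case: eqVneq => [->//|_]; rewrite scale0r pi0 hL => /eqP.
  rewrite scaler_eq0 (negPf L0) orbF => /eqP epi0.
  by case/eqP: x0; rewrite xE epM epi0 mul0r scale0r.
have ii0 : i = i0.
  apply/eqP; apply: contraNT (p0 i) => ii0; have [_ _ pp _] := p_orth.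
  by rewrite -(pii i) {2}eip pp (negPf ii0) scale0r.
rewrite xE (linZ _ _ phi_lin) phiL -xE subn0 exprD zN mulr1 => /eqP.
rewrite -[x in x == _]scale1r -subr_eq0 -scalerBl scaler_eq0 (negPf x0) orbF subr_eq0.
rewrite eq_sym -(prim_order_dvd zeta_prim) => Nk; rewrite ii0; congr (_, _); apply: val_inj => /=.
by apply/eqP; move: Nk; rewrite /dvdn modn_small.
Qed.

(** By [trace_phi] the trace is an integral polynomial [q] in [zeta].  At a root of
    unity [z] of [algC], the product [N * q(z)] is the form of [equivalence_form] for
    the relation [R] and the weights [z ^+ k], hence nonzero; then [q] does not vanish
    at [zeta] either. *)
Lemma trace_phi_neq0 : tr e c phi != 0.
Proof.
rewrite trace_phi; apply/eqP => tr0.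
pose q : {poly int} := \sum_i \sum_j \sum_(k < N) 'X^k *+ pE i j k.
have qE (F : fieldType) (x : F) : (map_poly intr q).[x] =
    \sum_i \sum_j \sum_(k < N) (pE i j k)%:R * x ^+ k.
  rewrite rmorph_sum horner_sum; apply: eq_bigr => i _.
  rewrite rmorph_sum horner_sum; apply: eq_bigr => j _.
  rewrite rmorph_sum horner_sum; apply: eq_bigr => k _.
  by rewrite raddfMn /= map_polyXn hornerMn hornerXn mulr_natl.
have [|z zN1 /rootP] := @root_of_unity_transfer K zeta N q K0 N_gt0 zN.
  by apply/rootP; rewrite qE.
rewrite qE => qz.
have [i0 pi0] := L_block.
have z0 : z != 0.
  by apply/eqP => z0; move: zN1; rewrite z0 expr0n gtn_eqF // => /eqP; rewrite eq_sym oner_eq0.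
have := @equivalence_form _ R (fun s => z ^+ s.2) (i0, Ordinal N_gt0)
  R_refl R_sym R_trans (fun s => R_L pi0) (oner_neq0 _).
case/eqP.
have zc l : (l <= N)%N -> (z ^+ l)^* = z ^+ (N - l).
  move=> lN; apply: (mulfI (expf_neq0 l z0)).
  rewrite -normCK -exprD subnKC // zN1 normrX.
  suff -> : `|z| = 1 by rewrite !expr1n.
  by apply/eqP; rewrite -(@pexpr_eq1 _ _ N) // -normrX zN1 normr1.
have shift (f : nat -> algC) d : (forall k, f (k + N)%N = f k) ->
    \sum_(k < N) f (k + d)%N = \sum_(k < N) f k.
  move=> fN; elim: d => [|d IHd]; first by apply: eq_bigr => k _; rewrite addn0.
  rewrite -IHd; apply: (addrI (f d)).
  transitivity (\sum_(k < N.+1) f (k + d)%N).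
    by rewrite big_ord_recl /=; congr (_ + _); apply: eq_bigr => k _; rewrite addnS.
  by rewrite big_ord_recr /= addrC addnC fN.
transitivity (\sum_i \sum_(k < N) \sum_j \sum_(l < N) (pE i j (k + (N - l)))%:R * z ^+ (k + (N - l))).
  rewrite [RHS]pair_bigA /=; apply: eq_bigr => -[i k] _ /=.
  rewrite [RHS]pair_bigA /=; apply: eq_bigr => -[j l] _ /=.
  by rewrite exprD zc // ltnW.
pose f i j k : algC := (pE i j k)%:R * z ^+ k.
have fper i j k : f i j (k + N)%N = f i j k by rewrite /f pE_per exprD zN1 mulr1.
transitivity (\sum_i \sum_j (\sum_(k < N) f i j k) *+ N).
  apply: eq_bigr => i _; rewrite exchange_big /=; apply: eq_bigr => j _.
  rewrite exchange_big /= (eq_bigr (fun => \sum_(k < N) f i j k)) => [|l _].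
    by rewrite sumr_const card_ord.
  exact: (shift (f i j)).
under eq_bigr do rewrite sumrMnl.
by rewrite sumrMnl qz mul0rn.
Qed.

End Blocks.

Lemma prim_root_exists : exists zeta : K, N.-primitive_root zeta.
Proof.
have [rs rsE] := closed_field_poly_normal ('X^N - 1 : {poly K}).
move: rsE; rewrite lead_coefDl ?lead_coefXn ?scale1r => [rsE|]; last first.
  by rewrite size_polyXn size_polyN size_poly1 ltnS.
have urs : uniq rs.
  rewrite -separable_prod_XsubC -rsE cyclotomic.separable_Xn_sub_1 // nK -lt0n.
  exact: N_gt0.
have : has N.-primitive_root rs.
  apply: cyclic.has_prim_root => //; last first.
    by rewrite -ltnS -(size_prod_XsubC rs id) -rsE (size_XnsubC 1).
  apply/allP => x xrs; rewrite unity_rootE -subr_eq0.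
  have : root ('X^N - 1) x by rewrite rsE root_prod_XsubC.
  by rewrite rootE !hornerE.
by case/hasP => x _ ?; exists x.
Qed.

Theorem finite_order_trace (ep : H -> K) (L : H) :
  linear (ep : H -> K^o) -> ep 1 = 1 -> {morph ep : a b / a * b} ->
  (forall h, ep (phi h) = ep h) -> (forall h, h * L = ep h *: L) ->
  (forall h, L * h = ep h *: L) -> ep L = 1 -> tr e c phi != 0.
Proof.
move=> epl ep1 epM epphi hL Lh epL.
have [r [p [porth pprim]]] := primitive_decomposition.
have [zeta zp] := prim_root_exists.
exact: (trace_phi_neq0 porth pprim zp epl ep1 epM epphi hL Lh epL).
Qed.

End TwistedTrace.

(** * The square of the antipode is the identity *)

Section SquareOfAntipode.
Variables (K : closedFieldType) (H : algType K) (A : hopf H).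
Implicit Types (a b h : H) (W : lmodType K).

Local Notation S := (S A).
Local Notation eps := (eps A).
Local Notation sw := (sw (dl A)).
Local Notation "'\sw_' ( a , b <- h ) E" := (sw (fun a b => E) h)
  (at level 41, a name, b name, h at level 60, E at level 41, right associativity,
   format "'\sw_' ( a ,  b  <-  h )  E").

Hypothesis K0 : [pchar K] =i pred0.
Variables (n : nat) (e : 'I_n -> H) (c : 'I_n -> H -> K^o).
Hypothesis B : is_basis e c.
Hypothesis ss : semisimple_algebra H.
Variable L : H.
Hypothesis hL : forall h, h * L = eps h *: L.
Hypothesis eL : eps L = 1.

Local Notation phi h := (S (S h)).

Local Notation lam := (lam A e c).

Lemma iter_phi k a : iter k.*2 (fun h => phi h) a * dgl A e c L ^+ k = dgl A e c L ^+ k * a.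
Proof.
elim: k => [|k IHk]; first by rewrite mulr1 mul1r.
rewrite doubleS !iterS exprS mulrA (phi_phi B hL eL).
by rewrite -[LHS]mulrA IHk mulrA.
Qed.

Lemma lam1_neq0 : lam 1 != 0.
Proof.
have [m m0 gm] := grouplike_order B (dgl_invl B hL eL) (dgl_grouplike B hL eL).
rewrite lam1; apply: (finite_order_trace K0 B ss (N := m.*2) _ _ _ _ _ (ep := eps) (L := L)) => //.
- by move=> a b; rewrite !SM.
- by rewrite !S1.
- by rewrite double_gt0.
- by move=> h; have := iter_phi m h; rewrite gm mulr1 mul1r.
- exact: eps1.
- exact: epsM.
- by move=> h; rewrite !eps_S.
- exact: (integralr B hL eL).
Qed.

Let phi2 a : phi (phi a) = a := phi_invol B hL eL lam1_neq0 a.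

(** The character of the regular comodule, see [xregE]. *)
Definition xreg : H := \sum_i \sw_(a, b <- e i) c i b *: a.

Lemma xregE (f : H -> K^o) : linear f ->
  f xreg = tr e c (fun y => \sw_(a, b <- y) f a *: b).
Proof.
move=> fl; rewrite (lin_bigsum _ _ _ fl); apply: eq_bigr => i _.
have cl := coord_lin B i; rewrite (sw_lin A (g := f)) // (sw_lin A (g := c i)) //.
by apply: eq_sw => a b; rewrite linZ // linZ // -[LHS]/(_ * _) mulrC.
Qed.

Lemma eps_xreg : eps xreg = n%:R.
Proof.
rewrite (xregE (eps_lin A)) -(tr_id B); apply: eq_tr => y.
exact: counit_l.
Qed.

Lemma lam_xreg : lam xreg = lam 1.
Proof.
have ll := lam_lin A B; rewrite (xregE ll) -(tr_rank1 B 1 ll); apply: eq_tr => y.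
exact: lam_integral.
Qed.

Lemma phi_xreg : phi xreg = xreg.
Proof.
apply: (eq_functional B) => f fl.
pose G y := \sw_(a, b <- y) f a *: b.
have Gl : linear G by rewrite /G; lin.
rewrite (xregE (f := fun x => f (phi x))) // xregE //.
transitivity (tr e c (fun y => phi (G (phi y)))).
  apply: eq_tr => y; rewrite /G !swS //.
  rewrite !(sw_lin A (g := S)) //; apply: eq_sw => a b.
  by rewrite !(linZ _ _ (S_lin A)) phi2.
rewrite (tr_comp (f := fun y => G (phi y)) (g := fun y => phi y) B B) //.
by apply: eq_tr => y; rewrite phi2.
Qed.

(** [f (x * x)] is the trace of [g (x) h |-> f (g_1 h_1) g_2 (x) h_2] on [H (x) H].
    Conjugation by the invertible map [g (x) h |-> g h_1 (x) h_2] turns it into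
    [g (x) h |-> f (g_1) g_2 (x) h], whose trace is [n * f x]. *)
Lemma xreg_sqr : xreg * xreg = n%:R *: xreg.
Proof.
apply: (eq_functional B) => f fl.
have [m [e' [c' B']]] := tensor_basis B B.
have pl := pure_linl (H := H) c (X := H); have pr := pure_linr B (X := H).
pose G g h := \sw_(h1, h2 <- h) pure c (\sw_(g1, g2 <- g) f (g1 * h1) *: g2) h2.
pose V g h := \sw_(h1, h2 <- h) pure c (g * h1) h2.
pose V' g h := \sw_(h1, h2 <- h) pure c (g * S h1) h2.
pose G' g h := pure c (\sw_(g1, g2 <- g) f g1 *: g2) h.
have [Gl Gr] : (forall h, linear (fun x => G x h)) /\ (forall x, linear (fun h => G x h)).
  by split; rewrite /G; lin.
have [G'l G'r] : (forall h, linear (fun x => G' x h)) /\ (forall x, linear (fun h => G' x h)).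
  by split; rewrite /G'; lin.
have [Vl Vr] : (forall h, linear (fun x => V x h)) /\ (forall x, linear (fun h => V x h)).
  by split; rewrite /V; lin.
have [V'l V'r] : (forall h, linear (fun x => V' x h)) /\ (forall x, linear (fun h => V' x h)).
  by split; rewrite /V'; lin.
have lGl := ext_lin e Gl; have lG'l := ext_lin e G'l.
have lVl := ext_lin e Vl; have lV'l := ext_lin e V'l.
have VV' F : ext e V (ext e V' F) = F.
  apply: (lin_pure_ext B (f := fun F => ext e V (ext e V' F)) (g := id)) => // g h.
  rewrite (ext_pure B) // -[V' g h]/(sw (fun a b => pure c (g * S a) b) h).
  rewrite (sw_lin A (g := ext e V)) //.
  transitivity (\sw_(a, r <- h) \sw_(u, v <- r) pure c (g * (S a * u)) v).
    by apply: eq_sw => a b; rewrite (ext_pure B) //; apply: eq_sw => u v; rewrite mulrA.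
  by rewrite (sw_SlA _ (G := fun x y => pure c (g * x) y)) // mulr1.
have VG F : ext e G F = ext e V' (ext e G' (ext e V F)).
  apply: (lin_pure_ext B (g := fun F => ext e V' (ext e G' (ext e V F)))) => // g h.
  rewrite !(ext_pure B) // -[V g h]/(sw (fun a b => pure c (g * a) b) h).
  rewrite (sw_lin A (g := fun F => ext e V' (ext e G' F))) //.
  transitivity (\sw_(a, b <- h) V' (\sw_(x, y <- g * a) f x *: y) b); last first.
    by apply: eq_sw => a b; rewrite !(ext_pure B).
  transitivity (\sw_(p, q <- h) \sw_(u, v <- q) \sw_(g1, g2 <- g)
     \sw_(p1, p2 <- p) f (g1 * p1) *: pure c (g2 * p2 * S u) v); last first.
    apply: eq_sw => p q.
    rewrite swM // !(sw_lin A (g := fun x => V' x q)) //.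
    rewrite sw_exch; apply: eq_sw => u v.
    rewrite sw_exch (sw_lin A (g := fun x => V' x q)) //; apply: eq_sw => p1 p2.
    rewrite (linZ (f := fun x => V' x q)) //.
    rewrite -[V' _ q]/(sw (fun a b => pure c (v * p2 * S a) b) q).
    by rewrite (sw_lin A (g := fun x => f (u * p1) *: x)).
  transitivity (\sw_(p1, r <- h) \sw_(p2, q <- r) \sw_(u, v <- q) \sw_(g1, g2 <- g)
     f (g1 * p1) *: pure c (g2 * (p2 * S u)) v).
    apply: eq_sw => p1 r.
    rewrite (sw_SrA _ (G := fun x y => \sw_(g1, g2 <- g) f (g1 * p1) *: pure c (g2 * x) y)) //.
    rewrite (sw_lin A (g := fun x => pure c x r)) //; apply: eq_sw => g1 g2.
    by rewrite (linZ _ _ (pl r)) mulr1.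
  rewrite -(swA _ (F := fun p1 p2 q => \sw_(u, v <- q) \sw_(g1, g2 <- g)
     f (g1 * p1) *: pure c (g2 * (p2 * S u)) v)) //.
  apply: eq_sw => p q; rewrite sw_exch; apply: eq_sw => u v; rewrite sw_exch.
  by do 2 (apply: eq_sw => ? ?); rewrite mulrA.
have evl i j : linear (fun F : {ffun 'I_n -> H} => c i (F j) : K^o).
  by move=> a F F'; rewrite !ffunE (coord_lin B).
have fl2 : linear (fun x => f (xreg * x)) by lin.
transitivity (tr e' c' (ext e G)).
  rewrite (tr_tensor B B B') // /xreg (lin_bigsum _ _ _ fl2) exchange_big.
  apply: eq_bigr => j _; rewrite (sw_lin A (g := fun x => f (xreg * x))) //.
  under eq_bigr => i _ do rewrite (ext_pure B) // (sw_lin A (g := fun F : {ffun 'I_n -> H} => c i (F j))) //.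
  rewrite -sw_sum; apply: eq_sw => a b; rewrite (linZ _ _ fl2).
  have fla : linear (fun x => f (x * a)) by lin.
  rewrite /xreg (lin_bigsum _ _ _ fla) scaler_sumr; apply: eq_bigr => i _.
  rewrite ffunE (linZ _ _ (coord_lin B i)) (sw_lin A (g := fun x => f (x * a))) //.
  congr (_ *: _); rewrite (sw_lin A (g := c i)) //; apply: eq_sw => u v.
  by rewrite (linZ _ _ fla) (linZ _ _ (coord_lin B i)) -[LHS]/(_ * _) mulrC.
transitivity (tr e' c' (ext e G')).
  transitivity (tr e' c' (fun F => ext e G' (ext e V (ext e V' F)))).
    rewrite (eq_tr _ _ VG).
    exact: (tr_comp (f := fun F => ext e G' (ext e V F)) (g := ext e V') B' B').
  by apply: eq_tr => F; rewrite VV'.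
rewrite (tr_tensor B B B') // linZ // xregE // -[RHS]/(_ * _) mulr_natl.
rewrite -sumrMnl; apply: eq_bigr => i _.
rewrite -[n in RHS]card_ord -sumr_const; apply: eq_bigr => j _.
by rewrite (ext_pure B) // ffunE (coord_delta B) eqxx scale1r.
Qed.

Let nK k : (k%:R == 0 :> K) = (k == 0)%N := (pcharf0P K).1 K0 k.

Lemma natK_inj k l : k%:R = l%:R :> K -> k = l.
Proof.
wlog: k l / (l <= k)%N => [Hw|lk] kl.
  by case: (leqP l k) => [|/ltnW] lk; [exact: Hw|exact/esym/Hw].
apply/eqP; rewrite eqn_leq lk andbT -subn_eq0 -nK natrB // kl subrr eqxx //.
Qed.

Lemma dim_gt0 : (0 < n)%N.
Proof.
case: n e c B => // e' c' B'; have /eqP := coordE B' 1.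
by rewrite big_ord0 oner_eq0.
Qed.

(** If [u] is idempotent and [z] is an involution of its image, the eigenprojections of
    [z] are half of [u + z] and of [u - z]. *)
Lemma half_idem (u z : H -> H) (k : K) : k * k = 1 ->
  linear u -> linear z -> (forall y, u (u y) = u y) -> (forall y, u (z y) = z y) ->
  (forall y, z (u y) = z y) -> (forall y, z (z y) = u y) ->
  let p y := (2%:R)^-1 *: (u y + k *: z y) in
  linear p /\ forall y, p (p y) = p y.
Proof.
move=> kk ul zl uu uz zu zz p; split=> [|y]; first by rewrite /p; lin.
rewrite /p; set x := u y + k *: z y.
have ux : u (2%:R^-1 *: x) = 2%:R^-1 *: x.
  by rewrite (linZ _ _ ul) /x (linD _ _ ul) (linZ _ _ ul) uu uz.
have zx : k *: z (2%:R^-1 *: x) = 2%:R^-1 *: x.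
  rewrite (linZ _ _ zl) /x (linD _ _ zl) (linZ _ _ zl) zu zz.
  by rewrite scalerA [k * _]mulrC -scalerA scalerDr scalerA kk scale1r addrC.
rewrite ux zx -scalerDr -mulr2n -scaler_nat scalerA mulVf ?scale1r //.
by rewrite nK.
Qed.

Lemma tr_half_diff (u z : H -> H) :
  linear u -> linear z -> (forall y, u (u y) = u y) -> (forall y, u (z y) = z y) ->
  (forall y, z (u y) = z y) -> (forall y, z (z y) = u y) ->
  exists a b : nat, tr e c z = a%:R - b%:R.
Proof.
move=> ul zl uu uz zu zz.
have [pl pp] := half_idem (mulr1 1) ul zl uu uz zu zz.
have [ql qq] := half_idem (etrans (mulrNN 1 1) (mulr1 1)) ul zl uu uz zu zz.
have [a [ta _ _ _ _]] := tr_idem B pl pp.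
have [b [tb _ _ _ _]] := tr_idem B ql qq.
exists a, b; rewrite -ta -tb -(trB B); apply: eq_tr => y.
rewrite -scalerBr scaleN1r scale1r opprD opprK addrACA subrr add0r.
by rewrite -mulr2n -scaler_nat scalerA mulVf ?scale1r // nK.
Qed.

Let e0 := n%:R^-1 *: xreg.

Let nx0 : n%:R != 0 :> K.
Proof. by rewrite nK -lt0n dim_gt0. Qed.

Let e0_idem : e0 * e0 = e0.
Proof. by rewrite -scalerAl -scalerAr xreg_sqr [_ *: (n%:R *: _)]scalerA mulVf // scale1r. Qed.

Let phi_e0 : phi e0 = e0.
Proof. by rewrite !(linZ _ _ (S_lin A)) phi_xreg. Qed.

(** [lam e0] is the trace of [y |-> phi y * e0], an involution of the image of the
    idempotent [y |-> y * e0]; hence it is an integer.  So [n] divides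
    [Tr phi = 2 r - n], where [r] is the rank of the projection onto the fixed points of
    [phi].  As [Tr phi] is nonzero, [r] is [0] or [n], and [phi] fixes [1]. *)
Lemma phi_id h : phi h = h.
Proof.
have [a [b sab]] : exists a b : nat, lam e0 = a%:R - b%:R.
  apply: (tr_half_diff (u := fun y => y * e0) (z := fun y => phi y * e0)) => // y.
  - by rewrite -mulrA e0_idem.
  - by rewrite -mulrA e0_idem.
  - by rewrite phiM -mulrA phi_e0 e0_idem.
  - by rewrite phiM phi2 -mulrA phi_e0 e0_idem.
have ll := lam_lin A B.
have lamE : lam 1 = n%:R * (a%:R - b%:R).
  by rewrite -lam_xreg -sab -[RHS](linZK _ _ ll) /e0 scalerA mulfV // scale1r.
have [pl pp] := half_idem (mulr1 1) (@lin_id K H) (phi_lin A) (fun=> erefl) (fun=> erefl)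
  (fun=> erefl) phi2.
have [r [tr_r rn pn p0 _]] := tr_idem B pl pp.
have lam1E : lam 1 = 2%:R * r%:R - n%:R.
  rewrite -tr_r lam1 (trZ B) (trD B) (trZ B) (tr_id B) /= scale1r.
  rewrite -[_ *: _]/(2%:R^-1 * _) mulrA mulfV ?nK // mul1r addrC addKr //.
have r_eq : (2 * r + n * b = n + n * a)%N.
  apply: natK_inj; rewrite natrD [in RHS]natrD !natrM.
  have := lam1E; rewrite lamE mulrBr => /esym/(canRL (subrK _)) ->.
  by rewrite addrAC subrK addrC.
have rn_eq : r = n.
  have /dvdnP[k kE] : (n %| 2 * r)%N.
    by rewrite -(dvdn_addl _ (dvdn_mulr b (dvdnn n))) r_eq dvdn_add ?dvdn_mulr.
  have k2 : (k <= 2)%N by rewrite -(leq_pmul2r dim_gt0) -kE leq_pmul2l.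
  case: k k2 kE => [|[|[|k]]] // _ kE.
  - have r0 : r = 0%N by apply/eqP; move/eqP: kE; rewrite mul0n muln_eq0.
    have /eqP := p0 r0 1; rewrite !S1 scale1r -mulr2n -scaler_nat scalerA.
    by rewrite mulVf ?nK // scale1r oner_eq0.
  - by have := lam1_neq0; rewrite lam1E -natrM kE mul1n subrr eqxx.
  - by apply/eqP; rewrite -(@eqn_pmul2l 2) // kE.
have /(congr1 (fun x => 2%:R *: x)) := pn rn_eq h.
rewrite scalerA mulfV ?nK // !scale1r scaler_nat mulr2n.
exact: addrI.
Qed.

(** Since [phi = id], the value [lam e0 = 1] is the rank of [y |-> y * e0]; the image of
    this map contains both [L] and [e0]. *)
Lemma xreg_integral : xreg = n%:R *: L.
Proof.
have ll := lam_lin A B.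
have lame0 : lam e0 = 1.
  rewrite /e0 (linZK _ _ ll) lam_xreg lam1.
  by rewrite (eq_tr _ _ phi_id) (tr_id B) mulVf.
have [||r [tr_r _ _ _ p1]] := tr_idem B (p := fun y => y * e0) => [//|y|].
  by rewrite -mulrA e0_idem.
have [w [l lE]] : exists w (l : H -> K), forall x, x * e0 = l x *: w.
  apply/p1/natK_inj; rewrite -tr_r -lame0; apply: eq_tr => y.
  by rewrite phi_id.
have LE : L = l L *: w.
  rewrite -lE (integralr B hL eL) -[LHS]scale1r; congr (_ *: _).
  by rewrite /e0 epsZ eps_xreg mulVf.
have lL0 : l L != 0.
  apply/eqP => l0; have := eL; rewrite LE l0 scale0r.
  by rewrite (lin0 (eps_lin A)) => /eqP; rewrite eq_sym oner_eq0.
have e0L : e0 = (l 1 / l L) *: L.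
  by rewrite -[LHS]mul1r lE [X in _ = _ *: X]LE scalerA divfK.
have l1 : l 1 / l L = 1.
  by have := congr1 eps e0L; rewrite /e0 !epsZ eL mulr1 eps_xreg mulVf.
by rewrite l1 scale1r in e0L; rewrite -e0L /e0 scalerA mulfV // scale1r.
Qed.

(** Traces on the regular comodule are values at the integral. *)
Lemma tr_regular (f : H -> K^o) : linear f ->
  tr e c (fun y => \sw_(a, b <- y) f a *: b) = n%:R * f L.
Proof. by move=> fl; rewrite -xregE // xreg_integral (linZK _ _ fl). Qed.

End SquareOfAntipode.

(** * Yetter-Drinfeld modules *)

Section YetterDrinfeld.
Variables (K : fieldType) (H : algType K) (A : hopf H).
Variables (n : nat) (e : 'I_n -> H) (c : 'I_n -> H -> K^o).
Implicit Types (W : lmodType K).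

Local Notation S := (S A).
Local Notation eps := (eps A).
Local Notation sw := (sw (dl A)).
Local Notation "'\sw_' ( a , b <- h ) E" := (sw (fun a b => E) h)
  (at level 41, a name, b name, h at level 60, E at level 41, right associativity,
   format "'\sw_' ( a ,  b  <-  h )  E").

(** Yetter-Drinfeld modules, with coaction [m |-> m_0 (x) m_1] and compatibility
    [h_1 m_0 (x) h_2 m_1 = (h_2 m)_0 (x) (h_2 m)_1 h_1].  As for coproducts, identities
    are stated through the values of multilinear maps: [ext e F (yd_co m)] is the
    Sweedler sum of [F m_0 m_1]. *)
Record yd (M : lmodType K) := Yd {
  yd_act : H -> M -> M;
  yd_co : M -> {ffun 'I_n -> M};
  act_linr : forall h, linear (yd_act h);
  act_linl : forall m, linear (yd_act^~ m);
  actM : forall h k m, yd_act (h * k) m = yd_act h (yd_act k m);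
  act1 : forall m, yd_act 1 m = m;
  co_lin : linear yd_co;
  coA : forall W (F : M -> H -> H -> W) m,
    (forall h k, linear (fun m => F m h k)) -> (forall m k, linear (fun h => F m h k)) ->
    (forall m h, linear (fun k => F m h k)) ->
    ext e (fun x y => \sw_(a, b <- y) F x a b) (yd_co m) =
    ext e (fun x y => ext e (fun u v => F u v y) (yd_co x)) (yd_co m);
  co_eps : forall m, ext e (fun x y => eps y *: x) (yd_co m) = m;
  act_co : forall W (F : M -> H -> W) h m,
    (forall h, linear (fun m => F m h)) -> (forall m, linear (fun h => F m h)) ->
    \sw_(a, b <- h) ext e (fun x y => F (yd_act a x) (b * y)) (yd_co m) =
    \sw_(a, b <- h) ext e (fun x y => F x (y * a)) (yd_co (yd_act b m))
}.

Hypothesis B : is_basis e c.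
Hypothesis SS : forall h, S (S h) = h.
Variables (M : lmodType K) (Y : yd M) (t : K).
Variables (d : nat) (w : 'I_d -> M) (l : 'I_d -> M -> K^o).
Hypothesis BM : is_basis w l.

Local Notation "'\co_' ( x , y <- m ) E" := (ext e (fun x y => E) (yd_co Y m))
  (at level 41, x name, y name, m at level 60, E at level 41, right associativity,
   format "'\co_' ( x ,  y  <-  m )  E").
Local Notation act := (yd_act Y).

Hypothesis twist : forall m, \co_(x, y <- m) act y x = t *: m.

Let acr : forall h, linear (act h) := act_linr Y.
Let acl : forall m, linear (act^~ m) := act_linl Y.
Let col : linear (yd_co Y) := co_lin Y.

(** Functions with values in [M (x) H] model [M (x) H (x) H]; the outer index is that of
    the last factor. *)
Definition tens3 (m : M) h k := pure c (pure c m h) k.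
Definition ext3 W (F : M -> H -> H -> W) :=
  ext e (fun y k => ext e (fun m h => F m h k) y).

Let Tl1 h k : linear (fun m => tens3 m h k). Proof. by rewrite /tens3; lin. Qed.
Let Tl2 m k : linear (fun h => tens3 m h k). Proof. by rewrite /tens3; lin. Qed.
Let Tl3 m h : linear (fun k => tens3 m h k). Proof. by rewrite /tens3; lin. Qed.

Lemma ext3_lin W (F : M -> H -> H -> W) :
  (forall h k, linear (fun m => F m h k)) -> linear (ext3 F).
Proof. by move=> F1; rewrite /ext3; lin. Qed.

Lemma ext3_tens3 W (F : M -> H -> H -> W) m h k :
  (forall h k, linear (fun m => F m h k)) -> (forall m k, linear (fun h => F m h k)) ->
  (forall m h, linear (fun k => F m h k)) -> ext3 F (tens3 m h k) = F m h k.
Proof. by move=> F1 F2 F3; rewrite /ext3 /tens3 !(ext_pure B) //. Qed.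

Lemma lin_tens3_ext W (f g : {ffun 'I_n -> {ffun 'I_n -> M}} -> W) : linear f -> linear g ->
  (forall m h k, f (tens3 m h k) = g (tens3 m h k)) -> f =1 g.
Proof.
move=> fl gl fg; apply: (lin_pure_ext B) => // y k.
apply: (lin_pure_ext B (f := fun y => f (pure c y k)) (g := fun y => g (pure c y k))) => //.
by move=> m h; exact: fg.
Qed.

(** Operators on [M (x) H (x) H], indexed by the factors they act on.  The letters
    [a], [a'], [b'], [b] stand for the four maps [m (x) h |-> m_0 (x) m_1 h],
    [m_0 (x) h m_1], [h_1 m (x) h_2], [h_2 m (x) h_1]; [w23] and [v23] are the
    invertible maps of the pentagon equations, and a final [i] marks a left inverse. *)
Definition a12 := ext3 (fun m h k => \co_(x, y <- m) tens3 x (y * h) k).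
Definition a12i := ext3 (fun m h k => \co_(x, y <- m) tens3 x (S y * h) k).
Definition a13 := ext3 (fun m h k => \co_(x, y <- m) tens3 x h (y * k)).
Definition a13' := ext3 (fun m h k => \co_(x, y <- m) tens3 x h (k * y)).
Definition w23 := ext3 (fun m h k => \sw_(a, b <- h) tens3 m a (b * k)).
Definition w23i := ext3 (fun m h k => \sw_(a, b <- h) tens3 m a (S b * k)).
Definition b12' := ext3 (fun m h k => \sw_(a, b <- h) tens3 (act a m) b k).
Definition b12i := ext3 (fun m h k => \sw_(a, b <- h) tens3 (act (S a) m) b k).
Definition b13' := ext3 (fun m h k => \sw_(a, b <- k) tens3 (act a m) h b).
Definition b13 := ext3 (fun m h k => \sw_(a, b <- k) tens3 (act b m) h a).
Definition v23 := ext3 (fun m h k => \sw_(a, b <- k) tens3 m (h * a) b).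
Definition v23i := ext3 (fun m h k => \sw_(a, b <- k) tens3 m (h * S a) b).
Definition s3 := ext3 (fun m h k => tens3 m h (S k)).

Let a12l : linear a12. Proof. by apply: ext3_lin. Qed.
Let a12il : linear a12i. Proof. by apply: ext3_lin. Qed.
Let a13l : linear a13. Proof. by apply: ext3_lin. Qed.
Let a13'l : linear a13'. Proof. by apply: ext3_lin. Qed.
Let w23l : linear w23. Proof. by apply: ext3_lin. Qed.
Let w23il : linear w23i. Proof. by apply: ext3_lin. Qed.
Let b12'l : linear b12'. Proof. by apply: ext3_lin. Qed.
Let b12il : linear b12i. Proof. by apply: ext3_lin. Qed.
Let b13l : linear b13. Proof. by apply: ext3_lin. Qed.
Let b13'l : linear b13'. Proof. by apply: ext3_lin. Qed.
Let v23l : linear v23. Proof. by apply: ext3_lin. Qed.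
Let v23il : linear v23i. Proof. by apply: ext3_lin. Qed.
Let s3l : linear s3. Proof. by apply: ext3_lin. Qed.

Let a12E m h k : a12 (tens3 m h k) = \co_(x, y <- m) tens3 x (y * h) k.
Proof. by rewrite /a12 ext3_tens3. Qed.
Let a12iE m h k : a12i (tens3 m h k) = \co_(x, y <- m) tens3 x (S y * h) k.
Proof. by rewrite /a12i ext3_tens3. Qed.
Let a13E m h k : a13 (tens3 m h k) = \co_(x, y <- m) tens3 x h (y * k).
Proof. by rewrite /a13 ext3_tens3. Qed.
Let a13'E m h k : a13' (tens3 m h k) = \co_(x, y <- m) tens3 x h (k * y).
Proof. by rewrite /a13' ext3_tens3. Qed.
Let w23E m h k : w23 (tens3 m h k) = \sw_(a, b <- h) tens3 m a (b * k).
Proof. by rewrite /w23 ext3_tens3. Qed.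
Let w23iE m h k : w23i (tens3 m h k) = \sw_(a, b <- h) tens3 m a (S b * k).
Proof. by rewrite /w23i ext3_tens3. Qed.
Let b12'E m h k : b12' (tens3 m h k) = \sw_(a, b <- h) tens3 (act a m) b k.
Proof. by rewrite /b12' ext3_tens3. Qed.
Let b12iE m h k : b12i (tens3 m h k) = \sw_(a, b <- h) tens3 (act (S a) m) b k.
Proof. by rewrite /b12i ext3_tens3. Qed.
Let b13'E m h k : b13' (tens3 m h k) = \sw_(a, b <- k) tens3 (act a m) h b.
Proof. by rewrite /b13' ext3_tens3. Qed.
Let b13E m h k : b13 (tens3 m h k) = \sw_(a, b <- k) tens3 (act b m) h a.
Proof. by rewrite /b13 ext3_tens3. Qed.
Let v23E m h k : v23 (tens3 m h k) = \sw_(a, b <- k) tens3 m (h * a) b.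
Proof. by rewrite /v23 ext3_tens3. Qed.
Let v23iE m h k : v23i (tens3 m h k) = \sw_(a, b <- k) tens3 m (h * S a) b.
Proof. by rewrite /v23i ext3_tens3. Qed.
Let s3E m h k : s3 (tens3 m h k) = tens3 m h (S k).
Proof. by rewrite /s3 ext3_tens3. Qed.

(** [m_0 (x) S(m_1) m_2 = m (x) 1], from coassociativity of the coaction. *)
Lemma co_Sl W (F : M -> H -> W) m :
  (forall h, linear (fun m => F m h)) -> (forall m, linear (fun h => F m h)) ->
  \co_(x, y <- m) \co_(u, v <- x) F u (S v * y) = F m 1.
Proof.
move=> F1 F2; rewrite -(coA Y (F := fun u v y => F u (S v * y))) //.
rewrite -[in RHS](co_eps Y m) (ext_comp _ _ _ (F1 1)); apply: eq_ext => x y.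
by rewrite (sw_Sl A (G := F x)) // (linZ _ _ (F1 1)).
Qed.

Lemma co_Sl' W (F : M -> H -> W) m :
  (forall h, linear (fun m => F m h)) -> (forall m, linear (fun h => F m h)) ->
  \co_(x, y <- m) \co_(u, v <- x) F u (S y * v) = F m 1.
Proof.
move=> F1 F2; rewrite -(coA Y (F := fun u v y => F u (S y * v))) //.
rewrite -[in RHS](co_eps Y m) (ext_comp _ _ _ (F1 1)); apply: eq_ext => x y.
by rewrite (sw_Sl' SS (G := F x)) // (linZ _ _ (F1 1)).
Qed.

Lemma w23K y : w23i (w23 y) = y.
Proof.
apply: (lin_tens3_ext (f := fun y => w23i (w23 y)) (g := id)) => // m h k.
rewrite w23E (sw_lin A (g := w23i)) //.
transitivity (\sw_(a, r <- h) \sw_(u, v <- r) tens3 m a (S u * v * k)).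
  rewrite -swA //; apply: eq_sw => a b; rewrite w23iE.
  by apply: eq_sw => ? ?; rewrite mulrA.
by rewrite (swA_Sl A (G := fun a x => tens3 m a (x * k))) // mul1r.
Qed.

Lemma a12K y : a12i (a12 y) = y.
Proof.
apply: (lin_tens3_ext (f := fun y => a12i (a12 y)) (g := id)) => // m h k.
rewrite a12E (ext_comp _ _ _ a12il).
transitivity (\co_(x, y <- m) \co_(u, v <- x) tens3 u (S v * y * h) k).
  by apply: eq_ext => x z; rewrite a12iE; apply: eq_ext => ? ?; rewrite mulrA.
by rewrite (co_Sl (F := fun u v => tens3 u (v * h) k)) // mul1r.
Qed.

(** The pentagon equation of the coaction: both sides send [m (x) h (x) k] to
    [m_0 (x) m_1 h_1 (x) m_2 h_2 k]. *)
Lemma w23a y : w23 (a12 y) = a12 (a13 (w23 y)).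
Proof.
apply: (lin_tens3_ext (f := fun y => w23 (a12 y)) (g := fun y => a12 (a13 (w23 y)))) => // m h k.
rewrite a12E w23E (ext_comp _ _ _ w23l) (sw_lin A (g := fun y => a12 (a13 y))) //.
transitivity (\co_(x, y <- m) \sw_(p, q <- y) \sw_(a, b <- h) tens3 x (p * a) (q * b * k)).
  by apply: eq_ext => x y0; rewrite w23E swM.
under eq_ext => x y0 do rewrite sw_exch.
rewrite ext_sw; apply: eq_sw => a b.
rewrite (coA Y (F := fun x p q => tens3 x (p * a) (q * b * k))) // a13E (ext_comp _ _ _ a12l).
apply: eq_ext => x y0; rewrite a12E; apply: eq_ext => u v; by rewrite mulrA.
Qed.

Lemma v23K y : v23i (v23 y) = y.
Proof.
apply: (lin_tens3_ext (f := fun y => v23i (v23 y)) (g := id)) => // m h k.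
rewrite v23E (sw_lin A (g := v23i)) //.
transitivity (\sw_(a, r <- k) \sw_(u, v <- r) tens3 m (h * (a * S u)) v).
  by apply: eq_sw => a b; rewrite v23iE; apply: eq_sw => ? ?; rewrite mulrA.
by rewrite (sw_SrA A (G := fun x v => tens3 m (h * x) v)) // mulr1.
Qed.

Lemma b12'K y : b12i (b12' y) = y.
Proof.
apply: (lin_tens3_ext (f := fun y => b12i (b12' y)) (g := id)) => // m h k.
rewrite b12'E (sw_lin A (g := b12i)) //.
transitivity (\sw_(a, r <- h) \sw_(u, v <- r) tens3 (act (S u * a) m) v k).
  by apply: eq_sw => a b; rewrite b12iE; apply: eq_sw => ? ?; rewrite actM.
by rewrite (sw_SlA' SS (G := fun x v => tens3 (act x m) v k)) // act1.
Qed.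

(** The pentagon equation of the action: both sides send [m (x) h (x) k] to
    [h_1 k_1 m (x) h_2 k_2 (x) k_3]. *)
Lemma v23b y : b12' (v23 y) = v23 (b12' (b13' y)).
Proof.
apply: (lin_tens3_ext (f := fun y => b12' (v23 y)) (g := fun y => v23 (b12' (b13' y)))) => // m h k.
rewrite v23E (sw_lin A (g := b12')) // b13'E (sw_lin A (g := fun y => v23 (b12' y))) //.
transitivity (\sw_(a, b <- k) \sw_(p, q <- a) \sw_(u, v <- h)
   tens3 (act (u * p) m) (v * q) b).
  apply: eq_sw => a b; rewrite b12'E swM //; exact: sw_exch.
rewrite swA //; apply: eq_sw => a r; rewrite b12'E (sw_lin A (g := v23)) // sw_exch.
apply: eq_sw => u v; rewrite v23E; apply: eq_sw => x y0; by rewrite actM.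
Qed.

(** Conjugation by the antipode of the last factor exchanges [a] and the inverse of
    [a']; in [b13s] it does so for [b] and [b']. *)
Lemma a13s y : a13' (s3 (a13 y)) = s3 y.
Proof.
apply: (lin_tens3_ext (f := fun y => a13' (s3 (a13 y))) (g := s3)) => // m h k.
rewrite a13E (ext_comp _ _ _ (g := fun y => a13' (s3 y))) // s3E.
transitivity (\co_(x, y <- m) \co_(u, v <- x) tens3 u h (S k * (S y * v))).
  apply: eq_ext => x y0; rewrite s3E a13'E; apply: eq_ext => u v.
  by rewrite SM mulrA.
by rewrite (co_Sl' (F := fun u x => tens3 u h (S k * x))) // mulr1.
Qed.

Lemma b13s y : b13' (s3 (b13 y)) = s3 y.
Proof.
apply: (lin_tens3_ext (f := fun y => b13' (s3 (b13 y))) (g := s3)) => // m h k.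
rewrite b13E (sw_lin A (g := fun y => b13' (s3 y))) // s3E.
transitivity (\sw_(a, b <- k) \sw_(u, v <- a) tens3 (act (S v * b) m) h (S u)).
  apply: eq_sw => a b; rewrite s3E b13'E swS //; apply: eq_sw => u v.
  by rewrite actM.
rewrite swA // (swA_Sl A (G := fun u x => tens3 (act x m) h (S u))) //.
by rewrite act1.
Qed.

Lemma s3K y : s3 (s3 y) = y.
Proof.
apply: (lin_tens3_ext (f := fun y => s3 (s3 y)) (g := id)) => // m h k.
by rewrite !s3E SS.
Qed.

(** [h_1 m_1 m_0 (x) h_2 m_2 = t h_1 m_0 (x) h_2 m_1], which the compatibility of action
    and coaction identifies with [t (h_2 m)_0 (x) (h_2 m)_1 h_1]. *)
Lemma b13a y : b13' (a13' y) = t *: a13 (b13 y).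
Proof.
apply: (lin_tens3_ext (f := fun y => b13' (a13' y)) (g := fun y => t *: a13 (b13 y))) => // m h k.
rewrite a13'E (ext_comp _ _ _ b13'l) b13E (sw_lin A (g := fun y => t *: a13 y)) //.
transitivity (\co_(x, y <- m) \sw_(a, b <- k) \sw_(p, q <- y) tens3 (act a (act p x)) h (b * q)).
  apply: eq_ext => x y0; rewrite b13'E swM //; do 2 apply: eq_sw => ? ?.
  by rewrite actM.
rewrite ext_sw.
transitivity (\sw_(a, b <- k) \co_(x, y <- m) tens3 (t *: act a x) h (b * y)).
  apply: eq_sw => a b.
  rewrite (coA Y (F := fun x p q => tens3 (act a (act p x)) h (b * q))) //.
  apply: eq_ext => x y0.
  rewrite -(ext_comp _ _ _ (g := fun x => tens3 (act a x) h (b * y0))) // twist.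
  by rewrite (linZ _ _ (acr a)).
rewrite (act_co Y (F := fun x y => tens3 (t *: x) h y)) //.
apply: eq_sw => a b; rewrite a13E (ext_comp _ _ _ (g := fun x => t *: x)) //.
apply: eq_ext => x y0; by rewrite (linZ _ _ (Tl1 _ _)).
Qed.

(** By the pentagon equations [a] and [b'] have determinant [1], hence by [a13s] and
    [b13s] so do [a'] and [b].  The determinant of [b13a] is then [1 = t ^+ N], for [N] the
    dimension of [M (x) H (x) H]. *)
Theorem twist_root_of_unity (m0 : M) : m0 != 0 -> exists2 N, (0 < N)%N & t ^+ N = 1.
Proof.
move=> m00.
have [N1 [w1 [l1 B1]]] := tensor_basis B BM.
have [N [w2 [l2 B2]]] := tensor_basis B B1.
exists N.
  case: N w2 l2 B2 => // w2 l2 B2; case/eqP: m00.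
  have := coordE B2 (tens3 m0 1 1); rewrite big_ord0.
  have F0 : linear (ext3 (fun m h k => (eps h * eps k) *: m)).
    by apply: ext3_lin.
  move/(congr1 (ext3 (fun m h k => (eps h * eps k) *: m))); rewrite (lin0 F0) ext3_tens3 //.
  by rewrite eps1 mulr1 scale1r.
have a1 : dt w2 l2 a13 = 1.
  apply: (dt_conj B2 a12l a13l w23l _ _ w23a).
    exact: (dt_left_inv B2 w23il w23K).
  exact: (dt_left_inv B2 a12il a12K).
have b1 : dt w2 l2 b13' = 1.
  apply: (dt_conj' B2 b12'l b13'l v23l _ _ v23b).
    exact: (dt_left_inv B2 v23il v23K).
  exact: (dt_left_inv B2 b12il b12'K).
have s0 := dt_left_inv B2 s3l s3K.
have a1' : dt w2 l2 a13' = 1.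
  have := eq_dt w2 l2 a13s; rewrite (dt_comp B2 (fun y => s3 (a13 y)) a13'l) (dt_comp B2 a13 s3l) a1 mul1r.
  by rewrite -[RHS]mulr1 => /(mulfI s0).
have b1' : dt w2 l2 b13 = 1.
  have := eq_dt w2 l2 b13s; rewrite (dt_comp B2 (fun y => s3 (b13 y)) b13'l) (dt_comp B2 b13 s3l) b1 mulr1.
  by rewrite -[RHS]mul1r => /(mulIf s0).
have := eq_dt w2 l2 b13a; rewrite dt_scale // (dt_comp B2 a13' b13'l) (dt_comp B2 b13 a13l) a1 b1 a1' b1'.
by rewrite !mulr1.
Qed.

End YetterDrinfeld.

Section Restriction.
Variables (K : fieldType) (H : algType K) (A : hopf H).
Variables (n : nat) (e : 'I_n -> H) (c : 'I_n -> H -> K^o).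
Hypothesis B : is_basis e c.
Hypothesis SS : forall h, S A (S A h) = h.
Variables (M : lmodType K) (Y : yd A e M).

Local Notation "'\co_' ( x , y <- m ) E" := (ext e (fun x y => E) (yd_co Y m))
  (at level 41, x name, y name, m at level 60, E at level 41, right associativity,
   format "'\co_' ( x ,  y  <-  m )  E").

Let acr : forall h, linear (yd_act Y h) := act_linr Y.
Let acl : forall m, linear ((yd_act Y)^~ m) := act_linl Y.
Let col : linear (yd_co Y) := co_lin Y.

Section Stable.
Variables (U : lmodType K) (i : U -> M) (p : M -> U).
Hypotheses (il : linear i) (pl : linear p) (ip : cancel i p).
Hypothesis act_st : forall h u, i (p (yd_act Y h (i u))) = yd_act Y h (i u).
Hypothesis co_st : forall u j, i (p (yd_co Y (i u) j)) = yd_co Y (i u) j.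

Definition sub_act h u := p (yd_act Y h (i u)).
Definition sub_co u : {ffun 'I_n -> U} := [ffun j => p (yd_co Y (i u) j)].

Lemma sub_coE (W : lmodType K) (F : U -> H -> W) u :
  ext e F (sub_co u) = \co_(x, y <- i u) F (p x) y.
Proof. by apply: eq_bigr => j _; rewrite ffunE. Qed.

(** A subspace stable under the action and the coaction, given by an inclusion [i] and a
    retraction [p], is a Yetter-Drinfeld module. *)
Lemma sub_yd : {Z : yd A e U | yd_act Z = sub_act /\ yd_co Z = sub_co}.
Proof.
unshelve eexists (@Yd K H A n e U sub_act sub_co _ _ _ _ _ _ _ _); last by [].
- by move=> h; rewrite /sub_act; lin.
- by move=> m; rewrite /sub_act; lin.
- by move=> h k m; rewrite /sub_act act_st actM.
- by move=> m; rewrite /sub_act act1 ip.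
- by move=> a x y; apply/ffunP => j; rewrite !ffunE il col !ffunE pl.
- move=> W F m F1 F2 F3; rewrite !sub_coE.
  rewrite (coA Y (F := fun x a b => F (p x) a b)) //.
  by apply: eq_bigr => j _; rewrite sub_coE co_st.
- move=> m; rewrite sub_coE -[RHS]ip -[in RHS](co_eps Y (i m)) (ext_comp _ _ _ pl).
  by apply: eq_ext => x y; rewrite (linZ _ _ pl).
move=> W F h m F1 F2.
transitivity (sw (dl A) (fun a b => \co_(x, y <- i m) F (p (yd_act Y a x)) (b * y)) h).
  apply: eq_sw => a b; rewrite sub_coE; apply: eq_bigr => j _.
  by rewrite /sub_act co_st.
rewrite (act_co Y (F := fun x y => F (p x) y)) //.
by apply: eq_sw => a b; rewrite sub_coE /sub_act act_st.
Qed.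

End Stable.

Definition ydtwist m := \co_(x, y <- m) yd_act Y y x.
Hypothesis twist_act : forall h m, ydtwist (yd_act Y h m) = yd_act Y h (ydtwist m).
Hypothesis twist_co : forall m j, yd_co Y (ydtwist m) j = ydtwist (yd_co Y m j).

Variables (d : nat) (w : 'I_d -> M) (l : 'I_d -> M -> K^o).
Hypothesis BM : is_basis w l.

Lemma twist_lin : linear ydtwist. Proof. by rewrite /ydtwist; lin. Qed.

(** The twist commutes with the action and the coaction, so its eigenspaces are stable,
    and [twist_root_of_unity] applies to them. *)
Theorem twist_eigenvalue m t : m != 0 -> ydtwist m = t *: m ->
  exists2 N, (0 < N)%N & t ^+ N = 1.
Proof.
move=> m0 mt; have tl := twist_lin.
have [U [i [p [il pl ip iE pE]]]] := eigenspace_split BM t tl.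
have ast h u : i (p (yd_act Y h (i u))) = yd_act Y h (i u).
  by apply: pE; rewrite twist_act iE (linZ _ _ (acr h)).
have cst u j : i (p (yd_co Y (i u) j)) = yd_co Y (i u) j.
  by apply: pE; rewrite -twist_co iE (linZ _ _ col) ffunE.
have [Z [Za Zc]] := sub_yd il pl ip ast cst.
have [dU [wU [lU BU]]] := retract_basis BM il pl ip.
apply: (twist_root_of_unity B SS (Y := Z) (t := t) BU _ (m0 := p m)); last first.
  by apply: contraNneq m0 => pm; rewrite -(pE m mt) pm (lin0 il).
move=> u; rewrite Zc Za sub_coE -[in RHS](ip u) -(linZ _ _ pl) -iE /ydtwist.
rewrite (ext_comp _ _ _ pl); apply: eq_bigr => j _.
by rewrite /sub_act cst.
Qed.

End Restriction.

(** * The Yetter-Drinfeld module of a module *)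

Section Adjoint.
Variables (K : fieldType) (H : algType K) (A : hopf H).
Variables (n : nat) (e : 'I_n -> H) (c : 'I_n -> H -> K^o).
Implicit Types (W : lmodType K).

Local Notation S := (S A).
Local Notation eps := (eps A).
Local Notation sw := (sw (dl A)).
Local Notation "'\sw_' ( a , b <- h ) E" := (sw (fun a b => E) h)
  (at level 41, a name, b name, h at level 60, E at level 41, right associativity,
   format "'\sw_' ( a ,  b  <-  h )  E").

Hypothesis B : is_basis e c.
Hypothesis SS : forall h, S (S h) = h.
Variables (V : lmodType K) (rho : H -> V -> V).
Hypothesis rhor : forall h, linear (rho h).
Hypothesis rhol : forall v, linear (fun h => rho h v).
Hypothesis rhoM : forall h k v, rho (h * k) v = rho h (rho k v).
Hypothesis rho1 : forall v, rho 1 v = v.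

Local Notation X := {ffun 'I_n -> V}.
Let P v g : X := pure c v g.
Let Pl g : linear (fun v => P v g). Proof. exact: pure_linl. Qed.
Let Pr v : linear (P v). Proof. exact: (pure_linr B). Qed.

(** On [V (x) H], the coaction of the second factor and the action
    [k (v (x) g) = k_2 v (x) k_3 g S(k_1)] compatible with it; the twist is then [theta]. *)
Definition ad_act k : X -> X :=
  ext e (fun v g => \sw_(a, r <- k) \sw_(b, d <- r) P (rho b v) (d * g * S a)).
Definition ad_co : X -> {ffun 'I_n -> X} :=
  ext e (fun v g => \sw_(a, b <- g) pure c (P v a) b).
Definition theta : X -> X := ext e (fun v g => \sw_(a, b <- g) P (rho a v) b).

Let ad_actE k v g : ad_act k (P v g) =
  \sw_(a, r <- k) \sw_(b, d <- r) P (rho b v) (d * g * S a).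
Proof. by rewrite /ad_act (ext_pure B). Qed.
Let ad_coE v g : ad_co (P v g) = \sw_(a, b <- g) pure c (P v a) b.
Proof. by rewrite /ad_co (ext_pure B). Qed.
Let thetaE v g : theta (P v g) = \sw_(a, b <- g) P (rho a v) b.
Proof. by rewrite /theta (ext_pure B). Qed.

Let ad_actr k : linear (ad_act k). Proof. by rewrite /ad_act; lin. Qed.
Let ad_actl m : linear (ad_act^~ m). Proof. by rewrite /ad_act; lin. Qed.
Let ad_col : linear ad_co. Proof. by rewrite /ad_co; lin. Qed.
Lemma theta_lin : linear theta. Proof. by rewrite /theta; lin. Qed.

Let ext_co W (F : X -> H -> W) v g :
  (forall h, linear (fun m => F m h)) -> (forall m, linear (fun h => F m h)) ->
  ext e F (ad_co (P v g)) = \sw_(a, b <- g) F (P v a) b.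
Proof.
move=> F1 F2; have Fl : linear (ext e F) by lin.
rewrite ad_coE (sw_lin A (g := ext e F)) //.
by apply: eq_sw => a b; rewrite (ext_pure B).
Qed.

Let ext_P W (f g : X -> W) : linear f -> linear g ->
  (forall v h, f (P v h) = g (P v h)) -> f =1 g.
Proof. by move=> fl gl fg; apply: (lin_pure_ext B fl gl). Qed.

(** In the compatibility of action and coaction, the coproduct of [S(k_1)] produces a
    factor [S(k_2) k_1] in the last leg, which cancels because [S] is an involution. *)
Lemma adjoint_yd : {Z : yd A e X | yd_act Z = ad_act /\ yd_co Z = ad_co}.
Proof.
unshelve eexists (@Yd K H A n e X ad_act ad_co _ _ _ _ _ _ _ _); try by [].
- move=> h k m; apply: (ext_P (f := ad_act (h * k)) (g := fun m => ad_act h (ad_act k m))) => // v g.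
  rewrite !ad_actE swM // (sw_lin A (g := ad_act h)) //.
  under [LHS]eq_sw => a r.
    under eq_sw => a' r' do rewrite swM //.
    over.
  rewrite sw_exch [RHS]/=.
  transitivity (\sw_(a', r' <- k) \sw_(b', d' <- r') \sw_(a, r <- h) \sw_(b, d <- r)
     P (rho b (rho b' v)) (d * (d' * g * S a') * S a)).
    apply: eq_sw => a' r'; rewrite [RHS]sw_exch; apply: eq_sw => a r.
    rewrite [LHS]sw_exch; apply: eq_sw => b' d'; apply: eq_sw => b d.
    by rewrite rhoM SM !mulrA.
  apply: eq_sw => a' r'; rewrite (sw_lin A (g := ad_act h)) //.
  by apply: eq_sw => b' d'; rewrite ad_actE.
- move=> m; apply: (ext_P (f := ad_act 1) (g := id)) => // v g.
  by rewrite ad_actE !sw1 // rho1 S1 mul1r mulr1.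
- move=> W F m F1 F2 F3.
  apply: (ext_P (f := fun m => ext e (fun x y => \sw_(a, b <- y) F x a b) (ad_co m))
    (g := fun m => ext e (fun x y => ext e (fun u v => F u v y) (ad_co x)) (ad_co m))) => // v g.
  rewrite !ext_co // -swA //.
  by apply: eq_sw => a b; rewrite ext_co.
- move=> m; apply: (ext_P (f := fun m => ext e (fun x y => eps y *: x) (ad_co m)) (g := id)) => // v g.
  by rewrite ext_co // sw_eps2.
move=> W F h m F1 F2.
apply: (ext_P (f := fun m => \sw_(a, b <- h) ext e (fun x y => F (ad_act a x) (b * y)) (ad_co m))
  (g := fun m => \sw_(a, b <- h) ext e (fun x y => F x (y * a)) (ad_co (ad_act b m)))) => // v g.
pose Z q r s := \sw_(b, d <- r) \sw_(x, y <- d) \sw_(g1, g2 <- g)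
  F (P (rho b v) (x * g1 * S q)) (y * g2 * s).
have Z1 r s : linear (fun q => Z q r s) by rewrite /Z; lin.
have Z2 q s : linear (fun r => Z q r s) by rewrite /Z; lin.
have Z3 q r : linear (fun s => Z q r s) by rewrite /Z; lin.
transitivity (\sw_(q, r <- h) Z q r 1).
  transitivity (\sw_(a, b <- h) \sw_(a1, r <- a) \sw_(a2, a3 <- r) \sw_(g1, g2 <- g)
    F (P (rho a2 v) (a3 * g1 * S a1)) (b * g2)).
    apply: eq_sw => a b; rewrite ext_co //.
    transitivity (\sw_(g1, g2 <- g) \sw_(a1, r <- a) \sw_(a2, a3 <- r)
      F (P (rho a2 v) (a3 * g1 * S a1)) (b * g2)).
      apply: eq_sw => g1 g2; rewrite ad_actE (sw_lin A (g := fun x => F x (b * g2))) //.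
      by apply: eq_sw => a1 r; rewrite (sw_lin A (g := fun x => F x (b * g2))).
    rewrite sw_exch; apply: eq_sw => a1 r; exact: sw_exch.
  rewrite swA //; apply: eq_sw => q r; rewrite swA //.
  by do 3 apply: eq_sw => ? ?; rewrite mulr1.
transitivity (\sw_(a, b <- h) \sw_(p, r' <- b) \sw_(q, r <- r') Z q r (S p * a)).
  rewrite (sw_SlA' SS (G := fun s r' => \sw_(q, r <- r') Z q r s)) //.
apply: eq_sw => a b; rewrite -swA // ad_actE.
have Fl : linear (fun m => ext e (fun x y => F x (y * a)) (ad_co m)) by lin.
rewrite (sw_lin A (g := fun m => ext e (fun x y => F x (y * a)) (ad_co m))) //.
apply: eq_sw => b1 r; rewrite (sw_lin A (g := fun m => ext e (fun x y => F x (y * a)) (ad_co m))) //.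
rewrite /Z sw_exch; apply: eq_sw => b2 b3; rewrite ext_co // -mulrA swM //.
rewrite sw_exch; apply: eq_sw => x y; rewrite swM // sw_exch; apply: eq_sw => g1 g2.
rewrite swS //; apply: eq_sw => p q.
by rewrite !mulrA.
Qed.

(** [m_1 m_0] is [g_3 v (x) g_4 g_1 S(g_2)] for [m = v (x) g]. *)
Lemma theta_twist (Z : yd A e X) : yd_act Z = ad_act -> yd_co Z = ad_co -> ydtwist Z =1 theta.
Proof.
move=> Za Zc; apply: ext_P => [||v g]; [exact: twist_lin|exact: theta_lin|].
rewrite /ydtwist Za Zc ext_co // thetaE.
transitivity (\sw_(a, b <- g) \sw_(b1, r <- b) \sw_(b2, b3 <- r) P (rho b2 v) (b3 * (a * S b1))).
  by apply: eq_sw => a b; rewrite ad_actE; do 2 apply: eq_sw => ? ?; rewrite mulrA.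
rewrite (sw_SrA A (G := fun u r => \sw_(b2, b3 <- r) P (rho b2 v) (b3 * u))) //.
by apply: eq_sw => a b; rewrite mulr1.
Qed.

Lemma theta_act k m : theta (ad_act k m) = ad_act k (theta m).
Proof.
have tl := theta_lin.
apply: (ext_P (f := fun m => theta (ad_act k m)) (g := fun m => ad_act k (theta m))) => // v g.
rewrite ad_actE thetaE (sw_lin A (g := theta)) // (sw_lin A (g := ad_act k)) //.
pose Z p u r' := \sw_(x, y <- r') \sw_(g1, g2 <- g) P (rho (x * g1 * u) v) (y * g2 * S p).
have Z1 u r : linear (fun p => Z p u r) by rewrite /Z; lin.
have Z2 p r : linear (fun u => Z p u r) by rewrite /Z; lin.
have Z3 p u : linear (fun r => Z p u r) by rewrite /Z; lin.
transitivity (\sw_(p, r' <- k) Z p 1 r'); last first.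
  transitivity (\sw_(p, r' <- k) \sw_(g1, g2 <- g) \sw_(x, y <- r')
    P (rho x (rho g1 v)) (y * g2 * S p)).
    apply: eq_sw => p r'; rewrite /Z sw_exch.
    by do 2 apply: eq_sw => ? ?; rewrite mulr1 rhoM.
  rewrite sw_exch; apply: eq_sw => g1 g2; by rewrite ad_actE.
transitivity (\sw_(p, r' <- k) \sw_(q, r <- r') \sw_(k2, k3 <- r) Z p (S q * k2) k3); last first.
  by apply: eq_sw => p r'; rewrite (sw_SlA A (G := fun u r => Z p u r)).
rewrite -swA //; apply: eq_sw => k1 r; rewrite (sw_lin A (g := theta)) // sw_exch.
apply: eq_sw => k2 k3; rewrite thetaE -mulrA swM // /Z.
rewrite [RHS]sw_exch; apply: eq_sw => x y; rewrite swM // [RHS]sw_exch; apply: eq_sw => g1 g2.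
rewrite swS //; apply: eq_sw => p q.
by rewrite -!rhoM !mulrA.
Qed.

Lemma theta_co m j : ad_co (theta m) j = theta (ad_co m j).
Proof.
have tl := theta_lin; have cl := coord_lin B j.
have evl (F : lmodType K) : linear (fun x : {ffun 'I_n -> F} => x j).
  by move=> a x y; rewrite !ffunE.
apply: (ext_P (f := fun m => ad_co (theta m) j) (g := fun m => theta (ad_co m j))) => [||v g].
- exact: (lin_comp (evl _)).
- exact: (lin_comp tl (lin_comp (evl _) _)).
rewrite thetaE (sw_lin A (g := fun m => ad_co m j)); last exact: (lin_comp (evl _)).
rewrite ad_coE (sw_lin A (g := fun m : {ffun 'I_n -> X} => theta (m j))); last first.
  exact: (lin_comp tl (evl _)).
transitivity (\sw_(a, b <- g) \sw_(p, q <- b) (c j q *: P (rho a v) p)).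
  apply: eq_sw => a b; rewrite ad_coE (sw_lin A (g := fun m : {ffun 'I_n -> X} => m j)) //.
  by apply: eq_sw => p q; rewrite ffunE.
rewrite -swA //; apply: eq_sw => a b.
by rewrite ffunE (linZ _ _ tl) thetaE (sw_lin A (g := fun x => c j b *: x)).
Qed.

Variables (d : nat) (w : 'I_d -> V) (l : 'I_d -> V -> K^o).
Hypothesis BV : is_basis w l.

Theorem theta_eigenvalue m t : m != 0 -> theta m = t *: m ->
  exists2 N, (0 < N)%N & t ^+ N = 1.
Proof.
move=> m0 mt; have [Z [Za Zc]] := adjoint_yd.
have ZE := theta_twist Za Zc.
have [N' [w' [l' BX]]] := tensor_basis B BV.
apply: (twist_eigenvalue B SS (Y := Z) _ _ BX (m := m)) => // [h x|x j|].
- by rewrite Za !ZE theta_act.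
- by rewrite Zc !ZE theta_co.
by rewrite ZE.
Qed.

End Adjoint.

Section TwistTraces.
Variables (K : closedFieldType) (H : algType K) (A : hopf H).
Hypothesis K0 : [pchar K] =i pred0.
Variables (n : nat) (e : 'I_n -> H) (c : 'I_n -> H -> K^o).
Hypothesis B : is_basis e c.
Hypothesis ss : semisimple_algebra H.
Variable L : H.
Hypothesis hL : forall h, h * L = eps A h *: L.
Hypothesis eL : eps A L = 1.
Variables (V : lmodType K) (d : nat) (w : 'I_d -> V) (l : 'I_d -> V -> K^o).
Hypothesis BV : is_basis w l.

Local Notation sw := (sw (dl A)).
Local Notation "'\sw_' ( a , b <- h ) E" := (sw (fun a b => E) h)
  (at level 41, a name, b name, h at level 60, E at level 41, right associativity,
   format "'\sw_' ( a ,  b  <-  h )  E").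
Local Notation X := {ffun 'I_n -> V}.

(** For each basis vector of [V] this is the trace on the regular comodule, computed by
    [tr_regular]. *)
Lemma tr_free_coaction (F : H -> V -> V) N (w' : 'I_N -> X) l' : is_basis w' l' ->
  (forall h, linear (F h)) -> (forall v, linear (fun h => F h v)) ->
  tr w' l' (ext e (fun v g => \sw_(a, b <- g) pure c (F a v) b)) =
  n%:R * tr w l (F L).
Proof.
move=> B' F1 F2; rewrite (tr_tensor B BV B') // mulr_sumr; apply: eq_bigr => i _.
have cl := coord_lin BV i.
rewrite -(tr_regular K0 B ss hL eL (f := fun h => l i (F h (w i)))) //.
apply: eq_bigr => j _; rewrite (ext_pure B) //.
have evl : linear (fun x : X => l i (x j) : K^o) by move=> a x y; rewrite !ffunE cl.
have cj := coord_lin B j.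
rewrite (sw_lin A (g := fun x : X => l i (x j))) // (sw_lin A (g := c j)) //.
apply: eq_sw => a b; rewrite ffunE (linZ _ _ cl) (linZ _ _ cj).
by rewrite -[LHS]/(_ * _) mulrC.
Qed.

Variable rho : H -> V -> V.
Hypothesis rhor : forall h, linear (rho h).
Hypothesis rhol : forall v, linear (fun h => rho h v).
Hypothesis rhoM : forall h k v, rho (h * k) v = rho h (rho k v).

Lemma tr_theta N (w' : 'I_N -> X) l' : is_basis w' l' ->
  tr w' l' (theta A e c rho) = n%:R * tr w l (rho L).
Proof. by move=> B'; exact: tr_free_coaction. Qed.

Lemma tr_theta2 N (w' : 'I_N -> X) l' : is_basis w' l' ->
  tr w' l' (fun m => theta A e c rho (theta A e c rho m)) =
  n%:R * tr w l (fun v => \sw_(x, y <- L) rho (y * x) v).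
Proof.
move=> B'; rewrite -(tr_free_coaction (F := fun h v => \sw_(x, y <- h) rho (y * x) v) B') //.
have tl : linear (theta A e c rho) by rewrite /theta; lin.
apply: eq_tr; apply: (lin_pure_ext B (f := fun m => theta A e c rho (theta A e c rho m))) => // v g.
have thE u h : theta A e c rho (pure c u h) = \sw_(a, b <- h) pure c (rho a u) b.
  by rewrite /theta (ext_pure B).
rewrite thE (ext_pure B) // (sw_lin A (g := theta A e c rho)) //.
transitivity (\sw_(a, b <- g) \sw_(p, q <- b) pure c (rho (p * a) v) q).
  by apply: eq_sw => a b; rewrite thE; apply: eq_sw => p q; rewrite rhoM.
rewrite -swA //; apply: eq_sw => a b.
by rewrite (sw_lin A (g := fun x => pure c x b)).
Qed.

End TwistTraces.

(** * The Frobenius-Schur indicator *)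

Section FrobeniusSchur.
Variables (K : fieldType) (H : algType K) (A : hopf H).
Hypothesis SS : forall h, S A (S A h) = h.
Variable L : H.
Hypothesis hL : forall h, h * L = eps A h *: L.
Hypothesis eL : eps A L = 1.
Variables (V : lmodType K) (d : nat) (w : 'I_d -> V) (l : 'I_d -> V -> K^o).
Hypothesis BV : is_basis w l.
Hypothesis d0 : d%:R != 0 :> K.
Variable rho : H -> V -> V.
Hypothesis rhor : forall h, linear (rho h).
Hypothesis rhol : forall v, linear (fun h => rho h v).
Hypothesis rhoM : forall h k v, rho (h * k) v = rho h (rho k v).
Hypothesis rho1 : forall v, rho 1 v = v.
Hypothesis schur : forall X : V -> V, linear X -> (forall h v, X (rho h v) = rho h (X v)) ->
  exists k, forall v, X v = k *: v.
Variables (b : V -> V -> K^o) (s : K) (w' : 'I_d -> V).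
Hypothesis bl : forall v, linear (fun u => b u v).
Hypothesis br : forall u, linear (b u).
Hypothesis b_rho : forall h u v, b (rho h u) v = b u (rho (S A h) v).
Hypothesis b_sym : forall u v, b u v = s * b v u.
Hypothesis w'E : forall i v, l i v = b (w' i) v.

Local Notation sw := (sw (dl A)).
Local Notation "'\sw_' ( x , y <- h ) E" := (sw (fun x y => E) h)
  (at level 41, x name, y name, h at level 60, E at level 41, right associativity,
   format "'\sw_' ( x ,  y  <-  h )  E").

(** Averaging the rank one map [b z (-) *: u] over the Casimir element gives a map
    commuting with [H] and of the same trace; it is a scalar by Schur's lemma. *)
Lemma schur_average z u v :
  d%:R *: (\sw_(x, y <- L) b (rho y z) v *: rho x u) = b z u *: v.
Proof.
pose X v := \sw_(x, y <- L) b z (rho (S A y) v) *: rho x u.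
have Xl : linear X by rewrite /X; lin.
have Xh h v' : X (rho h v') = rho h (X v').
  rewrite /X (sw_lin A (g := rho h)) //.
  transitivity (\sw_(x, y <- L) b z (rho (S A y * h) v') *: rho x u).
    by apply: eq_sw => x y; rewrite rhoM.
  rewrite -(casimir (F := fun x y => b z (rho y v') *: rho x u) h hL) //.
  by apply: eq_sw => x y; rewrite (linZ _ _ (rhor h)) rhoM.
have [k Xk] := schur Xl Xh.
have -> : \sw_(x, y <- L) b (rho y z) v *: rho x u = X v.
  by apply: eq_sw => x y; rewrite b_rho.
rewrite Xk scalerA; congr (_ *: _).
transitivity (tr w l X).
  rewrite (eq_tr _ _ Xk) (trZ BV) (tr_id BV) mulrC; by [].
rewrite (tr_sum BV).
transitivity (\sw_(x, y <- L) b z (rho (S A y * x) u) : K^o).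
  apply: eq_bigr => p _.
  by rewrite (tr_rank1 BV (l := fun v => b z (rho (S A p.2) v))) // rhoM.
by rewrite (sw_Sl' SS (G := fun h => b z (rho h u))) // eL scale1r rho1.
Qed.

(** Expand the trace of [rho y \o rho x] in the basis [w] and the basis [w'] dual to it for
    [b]; the symmetry of [b] brings each term to the form averaged in
    [schur_average]. *)
Lemma frobenius_schur : tr w l (fun v => \sw_(x, y <- L) rho (y * x) v) = s.
Proof.
have ll := coord_lin BV; apply: (mulfI d0); rewrite mulr_sumr.
transitivity (\sum_i \sum_j s * (b (w j) (w i) * b (w' j) (w' i)) : K^o).
  apply: eq_bigr => i _.
  transitivity (d%:R *: \sum_j (s *: b (w' j) (\sw_(x, y <- L) b (rho y (w j)) (w' i) *: rho x (w i))) : K^o).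
    congr (_ * _); rewrite (sw_lin A (g := l i)) //.
    under [RHS]eq_bigr => j _ do rewrite (sw_lin A (g := fun v => s *: b (w' j) v)) //.
    rewrite [RHS]exchange_big; apply: eq_bigr => -[x y] _ /=; rewrite rhoM.
    rewrite (coord_app BV (g := fun v => l i (rho y v))) //; apply: eq_bigr => j _.
    rewrite !w'E [b (w' i) _]b_sym (linZ _ _ (br (w' j))) -[LHS]/(_ * (s * _)).
    by rewrite -[RHS]/(s * (_ * _)) mulrCA; congr (_ * _); rewrite mulrC.
  rewrite -[LHS]/(d%:R * _) mulr_sumr; apply: eq_bigr => j _.
  rewrite -[LHS]/(d%:R * (s * _)) mulrCA; congr (_ * _).
  by rewrite -[LHS](linZ _ _ (br (w' j))) schur_average (linZ _ _ (br (w' j))).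
transitivity (\sum_(i < d) s); last by rewrite sumr_const card_ord mulr_natl.
apply: eq_bigr => i _; rewrite -mulr_sumr -[RHS]mulr1; congr (_ * _).
transitivity (b (w' i) (w i)); last by rewrite -w'E (coord_delta BV) eqxx.
rewrite (coord_app BV (g := fun u => b u (w i))) //; apply: eq_bigr => j _.
by rewrite w'E -[RHS]/(_ * _) mulrC.
Qed.

End FrobeniusSchur.

(** * Integrality of traces *)

Section SquareTrace.
Variables (K : closedFieldType) (N : nat) (M : 'M[K]_N).

Let char_comp (A : 'M[K]_N) (q : {poly K}) :
  char_poly A \Po q = \det (q%:M - map_mx polyC A).
Proof.
rewrite -[LHS]/(comp_poly q (\det (char_poly_mx A))) -det_map_mx; congr (\det _).
apply/matrixP => i j; rewrite !mxE.
by rewrite rmorphB rmorphMn /= comp_polyX comp_polyC.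
Qed.

Let comp_prod (s : seq K) (q : {poly K}) :
  (\prod_(z <- s) ('X - z%:P)) \Po q = \prod_(z <- s) (q - z%:P).
Proof.
rewrite -[LHS]/(comp_poly q _) rmorph_prod; apply: eq_bigr => z _.
by rewrite rmorphB /= comp_polyX comp_polyC.
Qed.

(** [\det (X^2 - M^2) = \det (X - M) * \det (X + M)], where the last determinant is the
    characteristic polynomial at [- X] up to sign. *)
Lemma char_poly_sqr s : char_poly M = \prod_(z <- s) ('X - z%:P) ->
  char_poly (M *m M) = \prod_(z <- s) ('X - (z ^+ 2)%:P).
Proof.
move=> Ms.
have sN : size s = N by apply/eq_add_S; rewrite -(size_char_poly M) Ms size_prod_XsubC.
suff E : char_poly (M *m M) \Po 'X^2 = (\prod_(z <- s) ('X - (z ^+ 2)%:P)) \Po 'X^2.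
  apply/polyP => i; have := congr1 (fun q : {poly K} => q`_(i * 2)) E.
  by rewrite !coef_comp_poly_Xn // dvdn_mull // mulnK.
have -> : \prod_(z <- s) ('X - (z ^+ 2)%:P) =
    \prod_(z <- [seq z ^+ 2 | z <- s]) ('X - z%:P) :> {poly K} by rewrite big_map.
rewrite comp_prod big_map char_comp.
set C := map_mx polyC M.
have -> : ('X^2)%:M - map_mx polyC (M *m M) =
    ('X%:M - C) *m ((-1) *: ((- 'X : {poly K})%:M - C)).
  rewrite map_mxM -/C scaleN1r opprB raddfN opprK mulmxDr !mulmxBl /=.
  rewrite [C *m _%:M]scalar_mxC -scalar_mxM -expr2 [RHS]addrC subrKA.
  by [].
rewrite det_mulmx detZ -!char_comp Ms !comp_prod -[X in _ ^+ X]sN.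
rewrite -(count_predT s) -iter_mulr_1 -big_const_seq -!big_split /=.
apply: eq_bigr => z _; rewrite mulN1r opprB opprK rmorphXn /=.
by rewrite [_%:P + _]addrC -subr_sqr.
Qed.

(** [z] is the second elementary symmetric function of the eigenvalues. *)
Lemma tr_sqr_integral : (0 < N)%N ->
  (forall t, eigenvalue M t -> exists2 m, (0 < m)%N & t ^+ m = 1) ->
  exists2 z : K, integralOver (intr : int -> K) z &
    (\tr M) ^+ 2 = \tr (M *m M) + z *+ 2.
Proof.
move=> N0 Mroot; have [s] := closed_field_poly_normal (char_poly M).
rewrite (monicP (char_poly_monic M)) scale1r => Ms.
have sN : size s = N by apply/eq_add_S; rewrite -(size_char_poly M) Ms size_prod_XsubC.
have sint t : t \in s -> integralOver (intr : int -> K) t.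
  move=> ts; have [|m m0 tm] := Mroot t; first by rewrite eigenvalue_root_char Ms root_prod_XsubC.
  exists ('X^m - 1); first by rewrite monicXnsubC.
  by rewrite rmorphB /= map_polyXn rmorph1 rootE !hornerE tm subrr.
have trE (A : 'M[K]_N) r : size r = N -> char_poly A = \prod_(z <- r) ('X - z%:P) ->
    \tr A = \sum_(z <- r) z.
  move=> rN Ar; apply: oppr_inj; rewrite -char_poly_trace // Ar -{1}rN.
  by rewrite coefPn_prod_XsubC // rN -lt0n.
rewrite (trE _ _ sN Ms) (trE _ [seq z ^+ 2 | z <- s]) ?size_map //; last first.
  by rewrite (char_poly_sqr Ms) big_map.
rewrite big_map; elim: s sint {Ms sN} => [|t s IHs] sint.
  by exists 0; [exact: integral0|rewrite !big_nil expr0n mul0rn addr0].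
have [|z zint zE] := IHs; first by move=> x xs; apply: sint; rewrite inE xs orbT.
exists (z + t * \sum_(x <- s) x).
  apply: integral_add => //; apply: integral_mul; first by apply: sint; rewrite inE eqxx.
  elim: s sint {IHs zE} => [|x s IHs] sint; first by rewrite big_nil; exact: integral0.
  rewrite big_cons; apply: integral_add; first by apply: sint; rewrite !inE eqxx orbT.
  apply: IHs => y; rewrite inE => /orP[/eqP->|ys]; apply: sint; rewrite !inE ?eqxx //.
  by rewrite ys !orbT.
rewrite !big_cons sqrrD zE mulrnDl.
by rewrite addrACA [X in _ + X = _]addrC.
Qed.

End SquareTrace.

(** Clearing denominators in an integral equation of degree [d] for [n / 2] shows that [2]
    divides [n ^ d]. *)
Lemma half_integral_even (K : fieldType) (K0 : [pchar K] =i pred0) (z : K) n :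
  integralOver (intr : int -> K) z -> n%:R = z *+ 2 -> ~~ odd n.
Proof.
move=> [p pm /rootP pz] nz.
have int0 (m : int) : m%:~R = 0 :> K -> m = 0.
  have nK := (pcharf0P K).1 K0.
  case: m => m; first by rewrite -pmulrn => /eqP; rewrite nK => /eqP->.
  by rewrite NegzE rmorphN /= -pmulrn => /eqP; rewrite oppr_eq0 nK.
set d := (size p).-1.
have sp : size p = d.+1 by rewrite prednK // lt0n size_poly_eq0 monic_neq0.
have pd : p`_d = 1 by rewrite -(monicP pm) lead_coefE.
have : \sum_(i < d.+1) p`_i * n%:Z ^+ i * 2 ^+ (d - i) = 0 :> int.
  apply: int0; rewrite rmorph_sum /=.
  have sp' : (size (map_poly intr p : {poly K}) <= d.+1)%N by rewrite -sp size_poly.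
  transitivity (2 ^+ d * (map_poly intr p).[z]); last by rewrite pz mulr0.
  rewrite (horner_coef_wide _ sp') mulr_sumr.
  apply: eq_bigr => i _; rewrite !rmorphM !rmorphXn /= coef_map /= -pmulrn nz.
  rewrite -[z *+ 2]mulr_natr exprMn -[X in _ = _ ^+ X * _](subnK (leq_ord i)) exprD.
  by rewrite mulrA [RHS]mulrC !mulrA mulrAC.
rewrite big_ord_recr /= pd mul1r subnn mulr1 => /eqP.
rewrite addrC addr_eq0 => /eqP nd.
have : (2 %| n%:Z ^+ d)%Z.
  rewrite nd rpredN; apply: rpred_sum => i _; apply: dvdz_mull.
  by rewrite -[(d - i)%N]prednK ?subn_gt0 // exprS dvdz_mulr.
by rewrite dvdzE abszX dvdn2 oddX negb_or => /andP[].
Qed.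

(** * Simple modules *)

Section SimpleModule.
Variables (K : closedFieldType) (H : algType K) (V : lmodType H).
Local Notation U := (underlying V).

Definition rho (h : H) (v : U) : U := h *: (v : V).

Lemma rhoM h k v : rho (h * k) v = rho h (rho k v).
Proof. by rewrite /rho (@scalerA H V). Qed.

Lemma rho1 v : rho 1 v = v.
Proof. exact: (@scale1r H V). Qed.

Lemma underlyingE (k : K) (v : U) : k *: v = rho k%:A v.
Proof. by []. Qed.

Lemma rho_linr h : linear (rho h).
Proof.
move=> k u v; rewrite !underlyingE -rhoM mulr_algl -[k *: h]mulr_algr rhoM.
exact: (@scalerDr H V).
Qed.

Lemma rho_linl v : linear (fun h => rho h v).
Proof.
move=> k g h; rewrite underlyingE -rhoM mulr_algl.
exact: (@scalerDl H V).
Qed.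

Hypothesis V_simple : simple_module V.

Lemma simple_nonzero : exists v : U, v != 0.
Proof. by case: V_simple. Qed.

Lemma simple_submod (P : U -> Prop) v0 : P 0 -> (forall h x y, P x -> P y -> P (rho h x + y)) ->
  P v0 -> v0 != 0 -> forall v, P v.
Proof.
move=> P0 PD Pv v00; pose M : {pred V} := fun v : V => `[< P v >].
have [|M0|Mall] := V_simple.2 M.
- split=> [|h x y]; first exact/asboolP.
  by move=> /asboolP Px /asboolP Py; exact/asboolP/PD.
- by case/eqP: v00; apply: (M0 v0); exact/asboolP.
- by move=> v; apply/asboolP; exact: (Mall v).
Qed.

Variables (n : nat) (e : 'I_n -> H) (c : 'I_n -> H -> K^o).
Hypothesis B : is_basis e c.

(** A simple module is generated by any nonzero vector. *)
Lemma simple_finite : exists d (w : 'I_d -> U) l, is_basis w l.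
Proof.
have [v0 v00] := simple_nonzero.
apply: (@finite_basis _ _ _ (fun i => rho (e i) v0)) => v.
have [h ->] : exists h, v = rho h v0.
  apply: (simple_submod (P := fun v => exists h, v = rho h v0) (v0 := v0)) v => //.
  - by exists 0; rewrite (lin0 (rho_linl v0)).
  - move=> k _ _ [g ->] [h ->]; exists (k * g + h).
    by rewrite -rhoM -(linD _ _ (rho_linl v0)).
  - by exists 1; rewrite rho1.
exists (fun i => c i h); exact: (coord_app B (g := fun h => rho h v0) h (rho_linl v0)).
Qed.

Variables (d : nat) (w : 'I_d -> U) (l : 'I_d -> U -> K^o).
Hypothesis BV : is_basis w l.

Lemma simple_dim_gt0 : (0 < d)%N.
Proof.
have [v0] := simple_nonzero; case: d w l BV => // w0 l0 B0.
by rewrite (coordE B0 v0) big_ord0 eqxx.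
Qed.

(** An eigenspace is a nonzero submodule, hence everything. *)
Lemma schur_lemma (X : U -> U) : linear X -> (forall h v, X (rho h v) = rho h (X v)) ->
  exists k, forall v, X v = k *: v.
Proof.
move=> Xl Xh; pose M := mat w l X.
have /closed_rootP[k] : size (char_poly M) != 1.
  by rewrite size_char_poly eqSS -lt0n simple_dim_gt0.
rewrite -eigenvalue_root_char => /eigenvalueP[r rM r0].
exists k; apply: (simple_submod (v0 := vct w r)).
- by rewrite (lin0 Xl) scaler0.
- move=> h x y Xx Xy; rewrite (linD _ _ Xl) Xh Xx Xy scalerDr.
  by rewrite (linZ _ _ (rho_linr h)).
- apply: (can_inj (crdK BV)); rewrite (crd_mat BV) // (vctK BV) rM.
  apply/rowP => j; rewrite !mxE (linZK _ _ (coord_lin BV j)).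
  by have := congr1 (fun q : 'rV_d => q 0 j) (vctK BV r); rewrite mxE => ->.
apply: contraNneq r0 => r0; apply/eqP; rewrite -[r](vctK BV) r0; apply/rowP => j.
by rewrite !mxE (lin0 (coord_lin BV j)).
Qed.

Variable A : hopf H.
Variable L : H.
Hypothesis hL : forall h, h * L = eps A h *: L.

(** The vector [L v0] is invariant, so it spans a submodule, which is all of [V]. *)
Lemma invariant_trivial v0 : rho L v0 != 0 ->
  exists (f : U -> K^o) (g : K -> U),
  [/\ linear f, cancel f g, cancel g f & forall h v, f (rho h v) = eps A h * f v].
Proof.
set u := rho L v0 => u0.
have hu h : rho h u = eps A h *: u.
  by rewrite /u -rhoM hL (linZ _ _ (rho_linl v0)).
have [|||f [fl fu _]] := @functional_sep K U (fun x => x = 0) u.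
- by [].
- by move=> a x y -> ->; rewrite scaler0 addr0.
- by apply/eqP.
have Vu v : v = f v *: u.
  apply: (simple_submod (P := fun v => v = f v *: u) (v0 := u)) v => //.
  - by rewrite (lin0 fl) scale0r.
  - move=> h x y Ex Ey; rewrite {1}Ex {1}Ey (linZ _ _ (rho_linr h)) hu.
    rewrite (linD _ _ fl) scalerDl; congr (_ + _).
    rewrite Ex (linZ _ _ (rho_linr h)) hu !(linZK _ _ fl) fu.
    by rewrite !mulr1 scalerA.
  - by rewrite fu scale1r.
exists f, (fun a => a *: u); split=> //.
- by move=> a; rewrite (linZK _ _ fl) fu mulr1.
- move=> h v; rewrite {1}(Vu v) (linZ _ _ (rho_linr h)) hu !(linZK _ _ fl) fu mulr1.
  exact: mulrC.
Qed.

Hypothesis SS : forall h, S A (S A h) = h.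
Variable b : U -> U -> K^o.
Hypothesis bl : forall v, linear (fun u => b u v).
Hypothesis br : forall u, linear (b u).
Hypothesis b_rho : forall h u v, b (rho h u) v = b u (rho (S A h) v).
Hypothesis b_nondeg : forall u, (forall v, b u v = 0) -> u = 0.
Hypothesis b_repr : forall f : U -> K^o, linear f -> exists u, forall v, b u v = f v.

(** As [S] is an involution, [fun u v => b v u] is invariant as well, so it is
    [fun u v => b (T u) v] with [T] commuting with [H].  By Schur's lemma [T] is a
    scalar [s], and exchanging the arguments twice gives [s * s = 1]. *)
Lemma invariant_form_sym : exists s, s * s = 1 /\ forall u v, b u v = s * b v u.
Proof.
have [T TE] := choice (fun v => b_repr (bl v)).
have b_inj u u' : (forall v, b u v = b u' v) -> u = u'.
  move=> uu; apply/eqP; rewrite -subr_eq0; apply/eqP/b_nondeg => v.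
  by rewrite (linB _ _ (bl v)) uu subrr.
have Tl : linear T.
  by move=> a x y; apply: b_inj => v; rewrite (bl v) !TE (br v).
have Th h v : T (rho h v) = rho h (T v).
  by apply: b_inj => u; rewrite b_rho !TE b_rho SS.
have [s sE] := schur_lemma Tl Th.
have sym u v : b u v = s * b v u by rewrite -TE sE (linZK _ _ (bl u)).
exists s; split=> //.
have [v0 v00] := simple_nonzero.
have [i li] : exists i, l i v0 != 0.
  apply: contrapT => /forallNP l0; case/eqP: v00; rewrite (coordE BV v0).
  by apply: big1 => i _; have /negP := l0 i; rewrite negbK => /eqP->; rewrite scale0r.
have [u uE] := b_repr (coord_lin BV i).
apply: (mulIf li); rewrite mul1r -uE [in RHS]sym [b v0 u]sym.
by rewrite mulrA.
Qed.

End SimpleModule.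

(** * Parity of the dimension *)

Section EvenDimension.
Variables (K : closedFieldType) (H : algType K) (A : hopf H).
Hypothesis K0 : [pchar K] =i pred0.
Variables (n : nat) (e : 'I_n -> H) (c : 'I_n -> H -> K^o).
Hypothesis B : is_basis e c.
Hypothesis ss : semisimple_algebra H.
Variable L : H.
Hypothesis hL : forall h, h * L = eps A h *: L.
Hypothesis eL : eps A L = 1.
Variable V : lmodType H.
Hypothesis V_simple : simple_module V.
Local Notation U := (underlying V).
Local Notation rho := (@rho K H V).
Hypothesis LV0 : forall v, rho L v = 0.
Variable b : U -> U -> K^o.
Hypothesis bl : forall v, linear (fun u => b u v).
Hypothesis br : forall u, linear (b u).
Hypothesis b_rho : forall h u v, b (rho h u) v = b u (rho (S A h) v).
Hypothesis b_nondeg : forall u, (forall v, b u v = 0) -> u = 0.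
Hypothesis b_repr : forall f : U -> K^o, linear f -> exists u, forall v, b u v = f v.

(** The trace of [theta] vanishes and that of its square is [n * s], so that [n * s] is
    minus twice an algebraic integer. *)
Theorem even_dimension : ~~ odd n.
Proof.
have SS h : S A (S A h) = h := phi_id K0 B ss hL eL h.
have [d [w [l BV]]] := simple_finite V_simple B.
have schur := schur_lemma V_simple BV.
have [s [s1 bs]] := invariant_form_sym V_simple BV SS bl br b_rho b_nondeg b_repr.
have [w' w'E] := choice (fun i => b_repr (coord_lin BV i)).
have d0 : d%:R != 0 :> K.
  by rewrite ((pcharf0P K).1 K0) -lt0n (simple_dim_gt0 V_simple BV).
have rr := @rho_linr K H V; have rl := @rho_linl K H V.
have rM := @rhoM K H V; have r1 := @rho1 K H V.
have FS := frobenius_schur SS hL eL BV d0 rr rl rM r1 schur bl br b_rho bs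
  (fun i v => esym (w'E i v)).
have [N [wX [lX BX]]] := tensor_basis B BV.
pose th := theta A e c rho; pose M := mat wX lX th.
have thl : linear th by rewrite /th /theta; lin.
have trM : \tr M = 0.
  rewrite -tr_mat (tr_theta K0 B ss hL eL BV rr rl BX).
  by rewrite [tr _ _ _]big1 ?mulr0 // => i _; rewrite LV0 (lin0 (coord_lin BV i)).
have trMM : \tr (M *m M) = n%:R * s.
  by rewrite -(mat_comp BX) // -tr_mat (tr_theta2 K0 B ss hL eL BV rr rl rM BX) FS.
have s0 : s != 0 by apply/eqP => s0; move/eqP: s1; rewrite s0 mul0r eq_sym oner_eq0.
have [N0|N0] := posnP N.
  have : n%:R * s == 0 by rewrite -trMM /mxtrace big1 // => i _; have := ltn_ord i; rewrite [X in (_ < X)%N]N0.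
  by rewrite mulf_eq0 (negPf s0) orbF ((pcharf0P K).1 K0) => /eqP->.
have [t /eigenvalueP[r rt r0]|z zint] := @tr_sqr_integral K N M N0.
  have mt : th (vct wX r) = t *: vct wX r.
    rewrite -[LHS](crdK BX) (crd_mat BX) // (vctK BX) rt /vct scaler_sumr.
    by apply: eq_bigr => i _; rewrite mxE scalerA.
  apply: (theta_eigenvalue B SS rr rl rM r1 BV (m := vct wX r) _ mt).
  apply: contraNneq r0 => m0; apply/eqP; rewrite -[r](vctK BX) m0; apply/rowP => j.
  by rewrite !mxE (lin0 (coord_lin BX j)).
rewrite trM trMM expr0n /= => /esym/eqP; rewrite addr_eq0 => /eqP nz.
apply: (half_integral_even K0 (z := - z * s)).
  apply: integral_mul; first exact: integral_opp.
  exists ('X^2 - 1); first by rewrite monicXnsubC.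
  by rewrite rmorphB /= map_polyXn rmorph1 rootE !hornerE expr2 s1 subrr.
transitivity (n%:R * s * s); first by rewrite -mulrA s1 mulr1.
by rewrite nz -mulrnAl mulNrn.
Qed.

End EvenDimension.

Section HopfModules.
Variables (K : closedFieldType) (H : hopfAlgType K) (V : lmodType H) (A : hopf H).
Hypotheses (AS : S A =1 antipode) (Aeps : eps A =1 counit).
Local Notation U := (underlying V).
Local Notation rho := (@rho K H V).

Lemma trivial_iso (f : U -> K^o) (g : K -> U) : linear f -> cancel f g -> cancel g f ->
  (forall h v, f (rho h v) = eps A h * f v) -> isomorphic V (trivial_module H).
Proof.
move=> fl fg gf fh.
have fl' : linear (f : V -> trivial_module H).
  move=> h x y; rewrite (linD _ _ fl) -[h *: x]/(rho h x) fh Aeps.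
  by [].
pose ff : {linear V -> trivial_module H} :=
  HB.pack (f : V -> trivial_module H) (GRing.isLinear.Build H V (trivial_module H) _ _ fl').
by exists ff; exists g.
Qed.

(** An isomorphism onto the dual module is a nondegenerate invariant form. *)
Lemma dual_form : self_dual V -> exists b : U -> U -> K^o,
  [/\ forall v, linear (fun u => b u v), forall u, linear (b u),
      forall h u v, b (rho h u) v = b u (rho (S A h) v),
      forall u, (forall v, b u v = 0) -> u = 0 &
      forall f : U -> K^o, linear f -> exists u, forall v, b u v = f v].
Proof.
case=> f [g fg gf]; pose b (u v : U) : K^o := dual_fun (f u) v.
have br u : linear (b u) by have /asboolP := dual_funP (f u).
have bh h u v : b (rho h u) v = b u (rho (S A h) v).
  by rewrite /b linearZ AS.
exists b; split=> //.
- move=> v k x y; rewrite /b.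
  have -> : f (k *: x + y) = f (rho k%:A x) + f y by rewrite -linearD.
  rewrite -[LHS]/(b (rho k%:A x) v + b y v) bh (linZ _ _ (S_lin A)) S1.
  by rewrite -(linZ _ _ (br x)).
- move=> u u0; rewrite -[u]fg; have -> : f u = 0 by apply: dualP => v; exact: u0.
  by rewrite -[RHS](fg 0) linear0.
move=> h hl; have hP : (h : U -> K) \in @is_functional K H V by apply/asboolP.
by exists (g (Dual hP)) => v; rewrite /b gf.
Qed.

End HopfModules.

Theorem mainTheorem1 (K : closedFieldType) (K_char0 : [pchar K] =i pred0)
    (H : hopfAlgType K) (H_semisimple : semisimple_algebra H) :
  (exists V : lmodType H,
    [/\ simple_module V, ~ isomorphic V (trivial_module H) & self_dual V]) ->
  exists n : nat, has_dimension H n /\ ~~ odd n.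
Proof.
case=> V [V_simple V_nontrivial V_dual].
have [A AS Aeps] := hopf_of H.
have [L hL eL] := semisimple_integral A H_semisimple.
have [n [e [c B]]] := hopf_finite hL eL.
exists n; split; first exact: basis_dim B.
have [b [bl br b_rho b_nondeg b_repr]] := dual_form AS V_dual.
apply: (even_dimension K_char0 B H_semisimple hL eL V_simple _ bl br b_rho b_nondeg b_repr) => v.
apply: contrapT => /eqP Lv; have [f [g [fl fg gf fh]]] := invariant_trivial V_simple hL Lv.
exact/V_nontrivial/(trivial_iso Aeps fl fg gf fh).
Qed.
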